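(* Let $X$ be a coherent scheme. Then the inclusion functor $j\colon (\mathrm{Sch}_{\mathrm{trig}}/X)\hookrightarrow(\mathrm{Sch}_{\mathrm{coh}}/X)$ of the category of topologically rigid $X$-schemes into the category of coherent $X$-schemes admits a right adjoint.
   Context: A scheme is coherent if it is quasicompact and quasiseparated. A morphism $f\colon Y\to X$ of schemes is a universal homeomorphism if every base change of $f$ is a homeomorphism on underlying topological spaces. A coherent scheme $Y$ is topologically rigid if any universal homeomorphism $Y'\to Y$ with $Y'$ reduced is an isomorphism. For a scheme $X$, $(\mathrm{Sch}_{\mathrm{coh}}/X)$ is the category of coherent schemes over $X$ (with all $X$-morphisms), and $(\mathrm{Sch}_{\mathrm{trig}}/X)$ is its full subcategory spanned by the $X$-schemes that are topologically rigid. *)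

(* Defs.v *)
From HB Require Import structures.
From mathcomp Require Import all_boot all_algebra.
From mathcomp Require Import boolp classical_sets topology.

Set Implicit Arguments.
Unset Strict Implicit.
Unset Printing Implicit Defensive.

Import GRing.Theory.
Local Open Scope classical_set_scope.
Local Open Scope ring_scope.

Record category := Category {
  obj :> Type;
  hom : obj -> obj -> Type;
  idm : forall a, hom a a;
  comp : forall a b c, hom b c -> hom a b -> hom a c;
  comp1m : forall a b (f : hom a b), comp (idm b) f = f;
  compm1 : forall a b (f : hom a b), comp f (idm a) = f;
  compA : forall a b c d (h : hom c d) (g : hom b c) (f : hom a b),
    comp h (comp g f) = comp (comp h g) f }.

Arguments hom {_} a b.
Arguments idm {_} a.
Arguments comp {_ a b c} g f : rename.
Notation "g '\;o' f" := (comp g f) (at level 40, left associativity).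

Record functor (C D : category) := Functor {
  fobj :> C -> D;
  fhom : forall a b : C, hom a b -> hom (fobj a) (fobj b);
  fhom_id : forall a : C, fhom (idm a) = idm (fobj a);
  fhom_comp : forall (a b c : C) (g : hom b c) (f : hom a b),
    fhom (g \;o f) = fhom g \;o fhom f }.

Arguments fhom {C D} F {a b} f : rename.

Record adjunction (C D : category) (F : functor C D) (G : functor D C) :=
  Adjunction {
  adj : forall (c : C) (d : D), hom (F c) d -> hom c (G d);
  adj_bij : forall c d, bijective (@adj c d);
  adj_natl : forall (c c' : C) (d : D) (u : hom c' c) (f : hom (F c) d),
    adj (f \;o fhom F u) = adj f \;o u;
  adj_natr : forall (c : C) (d d' : D) (v : hom d d') (f : hom (F c) d),
    adj (v \;o f) = fhom G v \;o adj f }.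

Definition has_right_adjoint (C D : category) (F : functor C D) : Prop :=
  exists G : functor D C, inhabited (adjunction F G).

Definition full_subcategory (C : category) (P : C -> Prop) : category :=
  @Category {a : C | P a} (fun a b => hom (sval a) (sval b))
    (fun a => idm (sval a)) (fun _ _ _ g f => g \;o f)
    (fun _ _ f => comp1m f) (fun _ _ f => compm1 f)
    (fun _ _ _ _ h g f => compA h g f).

Definition inclusion (C : category) (P : C -> Prop) :
    functor (full_subcategory P) C :=
  @Functor (full_subcategory P) C (fun a => sval a) (fun _ _ f => f)
    (fun _ => erefl) (fun _ _ _ _ _ => erefl).

Section Slice.
Variables (C : category) (x : C).

Record over := Over { dom : C; str : hom dom x }.

Record over_hom (a b : over) := OverHom {
  over_fun :> hom (dom a) (dom b);
  over_funP : str b \;o over_fun = str a }.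

Lemma over_hom_eq (a b : over) (f g : over_hom a b) :
  over_fun f = over_fun g -> f = g.
Proof.
case: f g => [f fP] [g gP] /= fg; subst g.
by rewrite (Prop_irrelevance fP gP).
Qed.

Definition over_id (a : over) : over_hom a a := OverHom (compm1 (str a)).

Lemma over_comp_subproof (a b c : over) (g : over_hom b c) (f : over_hom a b) :
  str c \;o (over_fun g \;o over_fun f) = str a.
Proof. by rewrite compA !over_funP. Qed.

Definition over_comp (a b c : over) (g : over_hom b c) (f : over_hom a b) :
  over_hom a c := OverHom (over_comp_subproof g f).

Lemma over_comp1m (a b : over) (f : over_hom a b) :
  over_comp (over_id b) f = f.
Proof. exact/over_hom_eq/comp1m. Qed.

Lemma over_compm1 (a b : over) (f : over_hom a b) :
  over_comp f (over_id a) = f.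
Proof. exact/over_hom_eq/compm1. Qed.

Lemma over_compA (a b c d : over)
    (h : over_hom c d) (g : over_hom b c) (f : over_hom a b) :
  over_comp h (over_comp g f) = over_comp (over_comp h g) f.
Proof. exact/over_hom_eq/compA. Qed.

Definition slice : category := Category over_comp1m over_compm1 over_compA.

End Slice.

Definition is_iso (C : category) (a b : C) (f : hom a b) : Prop :=
  exists g : hom b a, g \;o f = idm a /\ f \;o g = idm b.

Definition is_pullback (C : category) (a b c p : C)
    (f : hom a c) (g : hom b c) (pa : hom p a) (pb : hom p b) : Prop :=
  f \;o pa = g \;o pb /\
  forall (t : C) (ta : hom t a) (tb : hom t b), f \;o ta = g \;o tb ->
    exists! u : hom t p, pa \;o u = ta /\ pb \;o u = tb.

(* The zero ring has to be allowed ([comPzRingType]): it is the ring of sections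
   over the empty open set. *)

Record prime_ideal (A : comPzRingType) := PrimeIdeal {
  pideal :> set A;
  pideal0 : pideal 0;
  pidealD : forall a b, pideal a -> pideal b -> pideal (a + b);
  pidealM : forall a b, pideal b -> pideal (a * b);
  pideal1 : ~ pideal 1;
  pideal_prime : forall a b, pideal (a * b) -> pideal a \/ pideal b }.

HB.instance Definition _ (A : comPzRingType) := gen_eqMixin (prime_ideal A).
HB.instance Definition _ (A : comPzRingType) := gen_choiceMixin (prime_ideal A).

Definition zariski_open (A : comPzRingType) (U : set (prime_ideal A)) : Prop :=
  exists E : set A, U = [set p | ~ (E `<=` p)].

Lemma zariski_openT (A : comPzRingType) : @zariski_open A setT.
Proof.
exists [set 1]; apply/seteqP; split=> p //= _ /(_ 1 erefl).
exact: pideal1.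
Qed.

Lemma zariski_openI (A : comPzRingType) : setI_closed (@zariski_open A).
Proof.
move=> _ _ [E ->] [F ->].
exists [set c | exists a b, [/\ E a, F b & c = a * b]].
apply/seteqP; split=> p /=.
  move=> [nE nF] EFp; apply: nE => a Ea; apply: contrapT => npa.
  apply: nF => b Fb.
  by have [|//|] := @pideal_prime _ p a b; first by apply: EFp; exists a, b.
move=> nEF; split=> sub; apply: nEF => _ [a [b [Ea Fb ->]]].
  by rewrite mulrC; apply/pidealM/sub.
exact/pidealM/sub.
Qed.

Lemma zariski_open_bigU (A : comPzRingType) (I : Type)
    (f : I -> set (prime_ideal A)) :
  (forall i, zariski_open (f i)) -> zariski_open (\bigcup_i f i).
Proof.
move=> fo; have [E fE] := choice fo.
exists (\bigcup_i E i); apply/seteqP; split=> p /=.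
  by move=> [i _]; rewrite fE /= => nEi sub; apply: nEi => a Ea; apply: sub; exists i.
move=> nE; apply: contrapT => nf; apply: nE => a [i _ Eia].
apply: contrapT => npa; apply: nf; exists i => //; rewrite fE /= => sub.
exact/npa/sub.
Qed.

HB.instance Definition _ (A : comPzRingType) :=
  isOpenTopological.Build (prime_ideal A) (@zariski_openT A) (@zariski_openI A)
    (@zariski_open_bigU A).

Definition Dset (A : comPzRingType) (f : A) : set (prime_ideal A) :=
  [set p : prime_ideal A | ~ pideal p f].

(* [phi] exhibits [B] as the ring of fractions [A_f]. *)
Definition is_localization (A B : comPzRingType) (f : A)
    (phi : {rmorphism A -> B}) : Prop :=
  [/\ exists t : B, phi f * t = 1,
      forall b : B, exists (n : nat) (a : A), b * phi f ^+ n = phi a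
    & forall a : A, phi a = 0 -> exists n : nat, a * f ^+ n = 0].

#[projections(primitive)]
Record opens (T : topologicalType) := Opens {
  oset :> set T;
  osetP : open oset }.

Definition opensI (T : topologicalType) (U V : opens T) : opens T :=
  Opens (openI (osetP U) (osetP V)).

Record ringed_space := RingedSpace {
  space :> topologicalType;
  sec : opens space -> comPzRingType;
  res : forall U V : opens space, V `<=` U -> {rmorphism sec U -> sec V};
  res_id : forall (U : opens space) (h : U `<=` U) (s : sec U), res h s = s;
  res_comp : forall (U V W : opens space)
      (hUV : V `<=` U) (hVW : W `<=` V) (hUW : W `<=` U) (s : sec U),
    res hVW (res hUV s) = res hUW s;
  res_glue : forall (I : Type) (U : opens space) (W : I -> opens space)
      (hW : forall i, W i `<=` U) (s : forall i, sec (W i)),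
    U `<=` \bigcup_i W i ->
    (forall i j, res (V := opensI (W i) (W j)) (@subIsetl _ _ _) (s i) =
                 res (V := opensI (W i) (W j)) (@subIsetr _ _ _) (s j)) ->
    exists! t : sec U, forall i, res (hW i) t = s i }.

Arguments sec {r} U.
Arguments res {r U V} h.

(* The germ of [s] at [x] is a unit of the stalk at [x]. *)
Definition unit_germ (X : ringed_space) (x : X) (U : opens X) (s : sec U) :
    Prop :=
  exists (V : opens X) (h : V `<=` U), oset V x /\ exists t : sec V, res h s * t = 1.

(* Continuity is phrased with open preimages, and the proof of continuity of a
   composite is transparent, so that [preim (comp_cont fc gc) W] and
   [preim fc (preim gc W)] are convertible. *)
Definition cont (T S : topologicalType) (f : T -> S) : Prop :=
  forall V : set S, open V -> open (f @^-1` V).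

Definition preim (T S : topologicalType) (f : T -> S) (fc : cont f)
  (V : opens S) : opens T := Opens (fc V (osetP V)).

Definition id_cont (T : topologicalType) : cont (@idfun T) := fun _ Vo => Vo.

Definition comp_cont (T S R : topologicalType) (f : T -> S) (g : S -> R)
  (fc : cont f) (gc : cont g) : cont (g \o f) := fun V Vo => fc _ (gc V Vo).

(* A morphism of ringed spaces such that all the induced maps on stalks are
   local, that is, reflect units. *)
Record lrs_hom (X Y : ringed_space) := LrsHom {
  base :> X -> Y;
  base_cont : cont base;
  sharp : forall V : opens Y, {rmorphism sec V -> sec (preim base_cont V)};
  sharp_nat : forall (U V : opens Y) (h : V `<=` U)
      (h' : preim base_cont V `<=` preim base_cont U) (s : sec U),
    res h' (sharp U s) = sharp V (res h s);
  sharp_local : forall (x : X) (V : opens Y) (s : sec V), oset V (base x) ->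
    unit_germ x (sharp V s) -> unit_germ (base x) s }.

(* [psi] and [iota] identify the open subspace of [X] with underlying set the
   image of [psi] with [Spec A]: [psi] is a homeomorphism onto that open set,
   and the pushforward sheaf is the structure sheaf of [Spec A], i.e. the sheaf
   with value the [A]-algebra [A_f] on each basic open set [D(f)]. *)
Definition is_affine_chart (X : ringed_space) (A : comPzRingType)
    (psi : prime_ideal A -> X) (U : opens X) (iota : {rmorphism A -> sec U}) :
    Prop :=
  [/\ range psi = U :> set X, injective psi, cont psi,
      forall W : set (prime_ideal A), open W -> open (psi @` W)
    & forall (f : A) (V : opens X) (h : V `<=` U), psi @` Dset f = V :> set X ->
        is_localization f (res h \o iota : {rmorphism A -> sec V})].

(* Stalks of schemes are automatically local rings, since those of [Spec A]
   are. *)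
Record scheme := Scheme {
  ringed :> ringed_space;
  affine_cover : forall x : ringed,
    exists (U : opens ringed) (A : comPzRingType)
      (psi : prime_ideal A -> ringed) (iota : {rmorphism A -> sec U}),
    oset U x /\ is_affine_chart psi iota }.

Lemma rmorph_eq (A B : comPzRingType) (f g : {rmorphism A -> B}) :
  f =1 g -> f = g.
Proof.
case: f g => [f [[fD] [fM]]] [g [[gD] [gM]]] /= fg.
have {}fg : f = g by apply: funext.
subst g; rewrite (Prop_irrelevance fD gD).
by rewrite (Prop_irrelevance fM gM).
Qed.

Lemma lrs_hom_eq (X Y : ringed_space) (f : X -> Y) (fc : cont f)
    (s s' : forall V : opens Y, {rmorphism sec V -> sec (preim fc V)}) n n' l l' :
  (forall V, s V =1 s' V) -> @LrsHom X Y f fc s n l = @LrsHom X Y f fc s' n' l'.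
Proof.
move=> ss'; have {}ss' : s = s'.
  by apply: functional_extensionality_dep => V; apply/rmorph_eq/ss'.
subst s'; rewrite (Prop_irrelevance n n').
by rewrite (Prop_irrelevance l l').
Qed.

Definition lrs_id (X : ringed_space) : lrs_hom X X.
Proof.
refine (@LrsHom X X idfun (@id_cont X)
  (fun V => idfun : {rmorphism sec V -> sec V}) _ _).
- by move=> U V h h' s /=; rewrite (Prop_irrelevance h' h).
- by [].
Defined.

Definition lrs_comp (X Y Z : ringed_space) (g : lrs_hom Y Z) (f : lrs_hom X Y) :
  lrs_hom X Z.
Proof.
refine (@LrsHom X Z (g \o f) (comp_cont (base_cont f) (base_cont g))
  (fun V => sharp f (preim (base_cont g) V) \o sharp g V
     : {rmorphism sec V -> sec (preim (base_cont f) (preim (base_cont g) V))})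
  _ _).
- move=> U V h h' s /=.
  have k : preim (base_cont g) V `<=` preim (base_cont g) U by move=> y /h.
  by rewrite -(sharp_nat h k) -(sharp_nat k h').
- move=> x V s Vx /(sharp_local (x := x) (V := preim (base_cont g) V) Vx).
  exact: sharp_local.
Defined.

Lemma lrs_comp1m (X Y : ringed_space) (f : lrs_hom X Y) :
  lrs_comp (lrs_id Y) f = f.
Proof. by case: f => f fc s n l; exact: lrs_hom_eq. Qed.

Lemma lrs_compm1 (X Y : ringed_space) (f : lrs_hom X Y) :
  lrs_comp f (lrs_id X) = f.
Proof. by case: f => f fc s n l; exact: lrs_hom_eq. Qed.

Lemma lrs_compA (X Y Z T : ringed_space)
    (h : lrs_hom Z T) (g : lrs_hom Y Z) (f : lrs_hom X Y) :
  lrs_comp h (lrs_comp g f) = lrs_comp (lrs_comp h g) f.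
Proof. exact: lrs_hom_eq. Qed.

Definition Sch : category :=
  @Category scheme (fun X Y => lrs_hom X Y) (fun X => lrs_id X)
    (fun _ _ _ g f => lrs_comp g f) (fun _ _ f => lrs_comp1m f)
    (fun _ _ f => lrs_compm1 f) (fun _ _ _ _ h g f => lrs_compA h g f).

Definition quasicompact (X : scheme) : Prop := compact [set: X].

(* For schemes, this is quasicompactness of the diagonal over [Spec Z]. *)
Definition quasiseparated (X : scheme) : Prop :=
  forall U V : set X, open U -> open V -> compact U -> compact V ->
    compact (U `&` V).

Definition coherent (X : scheme) : Prop := quasicompact X /\ quasiseparated X.

Definition reduced (X : scheme) : Prop :=
  forall (U : opens X) (s : sec U) (n : nat), s ^+ n = 0 -> s = 0.

Definition homeomorphism (T S : topologicalType) (f : T -> S) : Prop :=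
  exists g : S -> T, [/\ cancel f g, cancel g f, continuous f & continuous g].

(* The base changes of [f] along [g : X' -> X] are the projections [f'] of the
   cartesian squares on [f] and [g]. *)
Definition universal_homeomorphism (Y X : scheme) (f : lrs_hom Y X) : Prop :=
  forall (X' Y' : Sch) (g : lrs_hom X' X) (f' : lrs_hom Y' X')
      (g' : lrs_hom Y' Y),
    is_pullback (C := Sch) f g g' f' -> homeomorphism (base f').

Definition topologically_rigid (Y : scheme) : Prop :=
  forall (Y' : scheme) (f : lrs_hom Y' Y),
    reduced Y' -> universal_homeomorphism f -> is_iso (C := Sch) f.

Definition Sch_coh (X : scheme) : category :=
  full_subcategory (fun Y : slice (C := Sch) X => coherent (dom Y)).

Definition is_trig (X : scheme) (Y : Sch_coh X) : Prop :=
  topologically_rigid (dom (sval Y)).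

Definition Sch_trig (X : scheme) : category :=
  full_subcategory (@is_trig X).

Definition trig_inclusion (X : scheme) : functor (Sch_trig X) (Sch_coh X) :=
  inclusion (@is_trig X).

(* Main.v *)
From HB Require Import structures.
From mathcomp Require Import all_boot all_algebra generic_quotient.
From mathcomp Require Import boolp classical_sets topology.
From mathcomp Require Import ring zify.
Require Import Defs.

Set Implicit Arguments.
Unset Strict Implicit.
Unset Printing Implicit Defensive.

Import GRing.Theory.
Local Open Scope quotient_scope.
Local Open Scope classical_set_scope.
Local Open Scope ring_scope.

(** The coreflection is the absolute weak normalization [awn Y -> Y]. It has the
    underlying space of [Y]; a section of its structure sheaf is a function [s]
    with values in the perfect closures of the residue fields of [Y] such that,
    near every point [x], [s] is integral over the local sections of [Y] and
    [s ^+ Q - c] is integral over the maximal ideal of [x], for some power [Q] of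
    the characteristic exponent at [x] and some local section [c]. In other words
    the graph of [s] is closed in the affine line, with purely inseparable fibres.

    This construction is functorial, [awn_fmap (awn_map Y) = awn_map (awn Y)], and
    it is idempotent. Given a cartesian square on [awn_map Y] and [g : X' -> Y],
    the map [awn X' -> Y'] induced by [awn_fmap g] yields an inverse of
    [Y' -> X']; thus [awn_map Y] is a universal homeomorphism.

    Conversely, let [f : Z -> W] be a universal homeomorphism of reduced schemes.
    Locally it is [Spec B -> Spec A], and [Spec B[t] -> Spec A[t]] is still a
    homeomorphism. The image of [V (b t - 1)] being closed, [b] is integral over
    [A]; comparing the prime of [b] with the other factors of its minimal
    polynomial shows that the residue extensions are purely inseparable. Hence
    every [b] is a section of [awn W], and [awn_fmap f] is an isomorphism. So
    [awn Y] is topologically rigid, and a scheme [T] is topologically rigid only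
    if [awn_map T] is an isomorphism, which gives the universal property. *)

(** Sections of [awn Y], and of the spectrum of a reduced ring, are functions on points: ring
    identities are checked pointwise and gluing is gluing of functions. Values in perfect closures
    make every [kmap] of a universal homeomorphism of reduced schemes bijective, so functions on
    source and target correspond one to one; what remains is to compare the rings of admissible
    germs. The obstacle is that being a universal homeomorphism is a condition on all cartesian
    squares. It is exploited through two of them: the trivial square over the identity, which gives
    the homeomorphism itself, and the base change to the affine line over an affine open subset,
    built by hand from polynomial rings. Reducedness keeps the spectra of these rings within the
    reach of function sheaves. Weak subintegrality is defined by stable finite families, because
    families can be merged, which handles sums and products; equations are extracted from them
    whenever denominators must be cleared or the ring changes. *)

Lemma pidealN (A : comPzRingType) (P : prime_ideal A) a : pideal P a -> pideal P (- a).
Proof. by move=> Pa; rewrite -mulN1r; apply: pidealM. Qed.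

Lemma pidealB (A : comPzRingType) (P : prime_ideal A) a b : pideal P a -> pideal P b -> pideal P
  (a - b).
Proof. by move=> Pa Pb; apply/pidealD/pidealN. Qed.

Lemma pidealMr (A : comPzRingType) (P : prime_ideal A) a b : pideal P a -> pideal P (a * b).
Proof. by rewrite mulrC; apply: pidealM. Qed.

Lemma pidealX (A : comPzRingType) (P : prime_ideal A) a n : pideal P (a ^+ n) -> pideal P a.
Proof.
elim: n => [|n IH]; first by rewrite expr0 => /pideal1.
by rewrite exprS => /pideal_prime[].
Qed.

Lemma pidealV (A : comPzRingType) (P : prime_ideal A) a b : ~ pideal P a -> pideal P (a * b) ->
  pideal P b.
Proof. by move=> nPa /pideal_prime[]. Qed.

Lemma pideal_sum (A : comPzRingType) (P : prime_ideal A) n (F : 'I_n -> A) :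
  (forall i, pideal P (F i)) -> pideal P (\sum_(i < n) F i).
Proof. by move=> PF; elim/big_ind: _ => //; [apply: pideal0|apply: pidealD]. Qed.

(** * Residue fields and perfect closures *)

Section ResidueField.
Variables (A : comPzRingType) (P : prime_ideal A).
Implicit Types x y z : A * A.

(** The quotient is taken on all of A * A: a pair whose second entry lies in P counts as having
    denominator 1, which avoids a subtype of fractions. *)
Definition rden x : A := if `[<pideal P x.2>] then 1 else x.2.

Lemma rdenP x : ~ pideal P (rden x).
Proof. by rewrite /rden; case: asboolP => // _; apply: pideal1. Qed.

Lemma rden_id a f : ~ pideal P f -> rden (a, f) = f.
Proof. by rewrite /rden /=; case: asboolP. Qed.

Definition req x y : bool := `[<pideal P (x.1 * rden y - y.1 * rden x)>].

Lemma req_refl : reflexive req.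
Proof. by move=> x; apply/asboolP; rewrite subrr; apply: pideal0. Qed.

Lemma req_sym : symmetric req.
Proof.
by move=> x y; apply/asboolP/asboolP => /pidealN; rewrite opprB.
Qed.

Lemma req_trans : transitive req.
Proof.
move=> y x z /asboolP xy /asboolP yz; apply/asboolP.
apply: (pidealV (@rdenP y)).
suff -> : rden y * (x.1 * rden z - z.1 * rden x) =
  rden z * (x.1 * rden y - y.1 * rden x) + rden x * (y.1 * rden z - z.1 * rden y).
  by apply: pidealD; apply: pidealM.
by ring.
Qed.

Canonical req_equiv := EquivRel req req_refl req_sym req_trans.
Definition resfield := {eq_quot req}.
HB.instance Definition _ := Choice.on resfield.

Definition rfrac (a f : A) : resfield := \pi_resfield (a, f).

Lemma rfrac_ind (u : resfield) : exists a f, ~ pideal P f /\ u = rfrac a f.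
Proof.
exists (repr u).1, (rden (repr u)); split; first exact: rdenP.
rewrite -[LHS](reprK u); apply/eqmodP/asboolP => /=.
by rewrite (rden_id _ (@rdenP (repr u))) subrr; apply: pideal0.
Qed.

Lemma rfrac_eq a f b g : ~ pideal P f -> ~ pideal P g ->
  (rfrac a f = rfrac b g) <-> pideal P (a * g - b * f).
Proof.
move=> Pf Pg; split=> [/eqmodP/asboolP|PP]; first by rewrite /= !rden_id.
by apply/eqmodP/asboolP; rewrite /= !rden_id.
Qed.

Definition rnum (u : resfield) := (repr u).1.
Definition rdn (u : resfield) := rden (repr u).

Lemma rfrac_repr a f : ~ pideal P f -> pideal P (a * rdn (rfrac a f) - rnum (rfrac a f) * f).
Proof.
move=> Pf; have : (a, f) = repr (rfrac a f) %[mod resfield] by rewrite reprK.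
by move/eqmodP/asboolP; rewrite /= rden_id.
Qed.

Lemma pidealMN a b : ~ pideal P a -> ~ pideal P b -> ~ pideal P (a * b).
Proof. by move=> na nb /pideal_prime[]. Qed.

Definition radd u v := rfrac (rnum u * rdn v + rnum v * rdn u) (rdn u * rdn v).
Definition rmul u v := rfrac (rnum u * rnum v) (rdn u * rdn v).
Definition ropp u := rfrac (- rnum u) (rdn u).
Definition rinv u := if `[<pideal P (rnum u)>] then rfrac 0 1 else rfrac (rdn u) (rnum u).

Lemma rdnP u : ~ pideal P (rdn u). Proof. exact: rdenP. Qed.

Lemma raddE a f b g : ~ pideal P f -> ~ pideal P g ->
  radd (rfrac a f) (rfrac b g) = rfrac (a * g + b * f) (f * g).
Proof.
move=> Pf Pg; have := rfrac_repr a Pf; have := rfrac_repr b Pg.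
have := @rdnP (rfrac a f); have := @rdnP (rfrac b g); rewrite /radd.
move: (rdn (rfrac a f)) (rdn (rfrac b g)) (rnum (rfrac a f)) (rnum (rfrac b g)).
move=> d1 d2 n1 n2 Pd2 Pd1 P2 P1.
apply/rfrac_eq; try exact: pidealMN.
rewrite (_ : _ - _ = - (d1 * f * (b * d2 - n2 * g) + d2 * g * (a * d1 - n1 * f))).
  by apply/pidealN/pidealD; apply: pidealM.
by ring.
Qed.

Lemma rmulE a f b g : ~ pideal P f -> ~ pideal P g ->
  rmul (rfrac a f) (rfrac b g) = rfrac (a * b) (f * g).
Proof.
move=> Pf Pg; have := rfrac_repr a Pf; have := rfrac_repr b Pg.
have := @rdnP (rfrac a f); have := @rdnP (rfrac b g); rewrite /rmul.
move: (rdn (rfrac a f)) (rdn (rfrac b g)) (rnum (rfrac a f)) (rnum (rfrac b g)).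
move=> d1 d2 n1 n2 Pd2 Pd1 P2 P1.
apply/rfrac_eq; try exact: pidealMN.
rewrite (_ : _ - _ = - (n1 * f * (b * d2 - n2 * g) + b * d2 * (a * d1 - n1 * f))).
  by apply/pidealN/pidealD; apply: pidealM.
by ring.
Qed.

Lemma roppE a f : ~ pideal P f -> ropp (rfrac a f) = rfrac (- a) f.
Proof.
move=> Pf; have := rfrac_repr a Pf; have := @rdnP (rfrac a f); rewrite /ropp.
move: (rdn _) (rnum _) => d1 n1 Pd1 P1.
by apply/rfrac_eq => //; rewrite mulNr mulNr opprK addrC.
Qed.

Let P1 : ~ pideal P 1 := @pideal1 _ P.

Local Ltac npm := by repeat first [assumption | exact: P1 | apply: pidealMN].

Lemma raddA : associative radd.
Proof.
move=> u v w; have [a [f [Pf ->]]] := rfrac_ind u; have [b [g [Pg ->]]] := rfrac_ind v.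
have [c [h [Ph ->]]] := rfrac_ind w.
rewrite !raddE; try npm.
apply/rfrac_eq; try npm.
by rewrite (_ : _ - _ = 0); [exact: pideal0 | ring].
Qed.

Lemma raddC : commutative radd.
Proof.
move=> u v; rewrite /radd; congr rfrac; last exact: mulrC.
exact: addrC.
Qed.

Lemma radd0 : left_id (rfrac 0 1) radd.
Proof.
move=> u; have [a [f [Pf ->]]] := rfrac_ind u; rewrite raddE //; try exact: P1.
by congr rfrac; ring.
Qed.

Lemma raddN : left_inverse (rfrac 0 1) ropp radd.
Proof.
move=> u; have [a [f [Pf ->]]] := rfrac_ind u; rewrite roppE ?raddE //.
apply/rfrac_eq; try npm.
by rewrite (_ : _ - _ = 0); [exact: pideal0 | ring].
Qed.

HB.instance Definition _ := GRing.isZmodule.Build resfield raddA raddC radd0 raddN.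

Lemma rmulA : associative rmul.
Proof.
move=> u v w; have [a [f [Pf ->]]] := rfrac_ind u; have [b [g [Pg ->]]] := rfrac_ind v.
have [c [h [Ph ->]]] := rfrac_ind w.
by rewrite !rmulE; try npm; congr rfrac; ring.
Qed.

Lemma rmulC : commutative rmul.
Proof. by move=> u v; rewrite /rmul; congr rfrac; ring. Qed.

Lemma rmul1 : left_id (rfrac 1 1) rmul.
Proof.
move=> u; have [a [f [Pf ->]]] := rfrac_ind u; rewrite rmulE //; try exact: P1.
by congr rfrac; ring.
Qed.

Lemma rmulDl : left_distributive rmul radd.
Proof.
move=> u v w; have [a [f [Pf ->]]] := rfrac_ind u; have [b [g [Pg ->]]] := rfrac_ind v.
have [c [h [Ph ->]]] := rfrac_ind w.
rewrite !(raddE, rmulE); try npm.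
apply/rfrac_eq; try npm.
by rewrite (_ : _ - _ = 0); [exact: pideal0 | ring].
Qed.

Lemma r1_neq0 : rfrac 1 1 != rfrac 0 1.
Proof.
by apply/eqP => /(rfrac_eq _ _ P1 P1); rewrite mulr1 mul0r subr0; apply: P1.
Qed.

HB.instance Definition _ := GRing.Zmodule_isComNzRing.Build resfield
  rmulA rmulC rmul1 rmulDl r1_neq0.

Lemma rfrac0P a f : ~ pideal P f -> rfrac a f = 0 <-> pideal P a.
Proof.
by move=> Pf; rewrite (rfrac_eq a 0 Pf P1) mulr1 mul0r subr0.
Qed.

Lemma rmulV (u : resfield) : u != 0 -> rinv u * u = 1.
Proof.
move=> /eqP; have [a [f [Pf ->]]] := rfrac_ind u => u0.
have Pa : ~ pideal P a by move=> Pa; apply/u0/rfrac0P.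
have := rfrac_repr a Pf; have := @rdnP (rfrac a f); rewrite /rinv.
move: (rdn _) (rnum _) => d n Pd Pn.
have Pn' : ~ pideal P n.
  move=> nn; apply: (pidealMN Pa Pd); rewrite -[_ * _](subrK (n * f)).
  by apply: pidealD => //; apply: pidealMr.
case: asboolP => // _.
rewrite [LHS]rmulE //; apply/rfrac_eq => //; first exact: pidealMN.
by rewrite mulr1 mul1r [d * a]mulrC.
Qed.

Lemma rinv0 : rinv 0 = 0.
Proof.
rewrite /rinv; case: asboolP => // H; case: H.
have := rfrac_repr 0 P1; rewrite mul0r mulr1 sub0r => /pidealN.
by rewrite opprK.
Qed.

HB.instance Definition _ := GRing.ComNzRing_isField.Build resfield rmulV rinv0.

Definition rval (a : A) : resfield := rfrac a 1.

Lemma rval_zmod : zmod_morphism rval.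
Proof.
move=> a b; rewrite /rval; apply: esym.
rewrite [LHS](_ : _ = radd (rfrac a 1) (ropp (rfrac b 1))) //.
by rewrite roppE ?raddE ?mulr1 //; exact: P1.
Qed.

Lemma rval_monoid : monoid_morphism rval.
Proof.
split=> // a b; rewrite /rval [RHS](_ : _ = rmul (rfrac a 1) (rfrac b 1)) //.
by rewrite rmulE ?mulr1 //; exact: P1.
Qed.

HB.instance Definition _ := GRing.isZmodMorphism.Build A resfield rval rval_zmod.
HB.instance Definition _ := GRing.isMonoidMorphism.Build A resfield rval rval_monoid.

Lemma rval_eq0 a : rval a = 0 <-> pideal P a.
Proof. exact/rfrac0P/P1. Qed.

Lemma rval_surj (u : resfield) : exists a f, ~ pideal P f /\ u * rval f = rval a.
Proof.
have [a [f [Pf ->]]] := rfrac_ind u; exists a, f; split => //.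
rewrite [LHS]rmulE //; apply/rfrac_eq; rewrite ?mulr1 //.
by rewrite (_ : _ - _ = 0); [exact: pideal0 | ring].
Qed.

End ResidueField.

Section FrobeniusPowers.
Variable F : fieldType.

(** The characteristic exponent: the default 1 of [xget] is its value in characteristic zero. *)
Definition expchar : nat := xget 1%N [set p | p \in [pchar F]].

Lemma expchar_pnat k : [pchar F].-nat (expchar ^ k)%N.
Proof.
rewrite pnatX /expchar; case: xgetP => [p _ /= hp|_] //.
by rewrite pnatE ?hp // (pcharf_prime hp).
Qed.

Lemma pnat_expchar Q : [pchar F].-nat Q -> exists k, Q = (expchar ^ k)%N.
Proof.
rewrite /expchar; case: xgetP => [p _ /= hp|no] hQ.
  have : p.-nat Q by rewrite -(eq_pnat _ (pcharf_eq hp)).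
  by move=> /p_natP[k ->]; exists k.
(* In characteristic zero a prime divisor of Q would belong to an empty set, so Q = 1. *)
exists 0%N; rewrite expn0; apply/eqP.
have [Q0 /allP hall] := andP hQ; rewrite eqn_leq Q0 andbT leqNgt; apply/negP => Q1.
have /hall hp : pdiv Q \in primes Q by rewrite mem_primes pdiv_prime // Q0 pdiv_dvd.
exact: (no (pdiv Q)).
Qed.

Lemma expr_pnat_inj Q (x y : F) : [pchar F].-nat Q -> x ^+ Q = y ^+ Q -> x = y.
Proof.
move=> hQ e; apply/eqP; rewrite -subr_eq0.
have : x ^+ Q = (x - y) ^+ Q + y ^+ Q by rewrite -exprDn_pchar // subrK.
by rewrite e => /eqP; rewrite -subr_eq subrr eq_sym expf_eq0 => /andP[].
Qed.

Lemma exprB_pnat Q (x y : F) : [pchar F].-nat Q -> (x - y) ^+ Q = x ^+ Q - y ^+ Q.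
Proof.
move=> hQ; apply/eqP; rewrite eq_sym subr_eq -exprDn_pchar // subrK; exact: eqxx.
Qed.
End FrobeniusPowers.

Section PerfectClosure.
Variable F : fieldType.
Local Notation p := (expchar F).
Implicit Types f g h : nat -> F.

Let powD k : {morph (fun x : F => x ^+ (p ^ k)) : x y / x + y}.
Proof. by move=> x y; rewrite exprDn_pchar // expchar_pnat. Qed.

Let powB k : {morph (fun x : F => x ^+ (p ^ k)) : x y / x - y}.
Proof. by move=> x y; rewrite exprB_pnat // expchar_pnat. Qed.

(* An eventually Frobenius-compatible sequence [f] stands for the element whose
   [p ^ n]-kmap power is [f n] for all large [n]. *)
Definition pconv f := exists N, forall n, (N <= n)%N -> f n.+1 = f n ^+ p.

Record pseq := PSeq { pval :> nat -> F; pvalP : pconv pval }.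

HB.instance Definition _ := gen_eqMixin pseq.
HB.instance Definition _ := gen_choiceMixin pseq.

Definition pev f g := exists N, forall n, (N <= n)%N -> f n = g n.
Definition peq (s t : pseq) : bool := `[<pev s t>].

Lemma peq_refl : reflexive peq.
Proof. by move=> s; apply/asboolP; exists 0%N. Qed.
Lemma peq_sym : symmetric peq.
Proof.
by move=> s t; apply/asboolP/asboolP => -[N h]; exists N => n /h.
Qed.
Lemma peq_trans : transitive peq.
Proof.
move=> t s u /asboolP[N h] /asboolP[M k]; apply/asboolP.
by exists (N + M)%N => n nm; rewrite h ?k //; lia.
Qed.

Canonical peq_equiv := EquivRel peq peq_refl peq_sym peq_trans.
Definition perfcl := {eq_quot peq}.
HB.instance Definition _ := Choice.on perfcl.

Definition pcl (s : pseq) : perfcl := \pi_perfcl s.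

Lemma pclP s t : pcl s = pcl t <-> pev s t.
Proof. by split=> [/eqmodP/asboolP|h] //; apply/eqmodP/asboolP. Qed.

Lemma repr_pcl s : pev (repr (pcl s)) s.
Proof. by apply/pclP; rewrite /pcl reprK. Qed.

Lemma pclK (u : perfcl) : pcl (repr u) = u.
Proof. exact: reprK. Qed.

Lemma pconvD f g : pconv f -> pconv g -> pconv (fun n => f n + g n).
Proof.
move=> [N hN] [M hM]; exists (N + M)%N => n nm.
by rewrite hN ?hM ?(powD 1) //; lia.
Qed.
Lemma expchar_gt0 : (0 < p)%N.
Proof.
by rewrite /expchar; case: xgetP => [q _ /= /pcharf_prime/prime_gt0|].
Qed.

Lemma pconvN f : pconv f -> pconv (fun n => - f n).
Proof.
move=> [N hN]; exists N => n nm; rewrite hN // -[- f n]sub0r -[p]expn1 powB expn1.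
by rewrite expr0n gtn_eqF ?expchar_gt0 // sub0r.
Qed.
Lemma pconvM f g : pconv f -> pconv g -> pconv (fun n => f n * g n).
Proof.
move=> [N hN] [M hM]; exists (N + M)%N => n nm.
by rewrite hN ?hM ?exprMn //; lia.
Qed.
Lemma pconvV f : pconv f -> pconv (fun n => (f n)^-1).
Proof. by move=> [N hN]; exists N => n nm; rewrite hN // exprVn. Qed.

Definition pembed (x : F) n := x ^+ (p ^ n).
Lemma pconv_embed x : pconv (pembed x).
Proof. by exists 0%N => n _; rewrite /pembed expnSr exprM. Qed.

Definition padd (u v : perfcl) : perfcl := pcl (PSeq (pconvD (pvalP (repr u)) (pvalP (repr v)))).
Definition pmul (u v : perfcl) : perfcl := pcl (PSeq (pconvM (pvalP (repr u)) (pvalP (repr v)))).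
Definition popp (u : perfcl) : perfcl := pcl (PSeq (pconvN (pvalP (repr u)))).
Definition pinv (u : perfcl) : perfcl := pcl (PSeq (pconvV (pvalP (repr u)))).
Definition pemb (x : F) : perfcl := pcl (PSeq (pconv_embed x)).

Lemma pcl_ind (u : perfcl) : exists s, u = pcl s.
Proof. by exists (repr u); rewrite pclK. Qed.

Lemma paddE s t : padd (pcl s) (pcl t) = pcl (PSeq (pconvD (pvalP s) (pvalP t))).
Proof.
have [N hN] := repr_pcl s; have [M hM] := repr_pcl t.
by apply/pclP; exists (N + M)%N => n nm /=; rewrite hN ?hM //; lia.
Qed.

Lemma pmulE s t : pmul (pcl s) (pcl t) = pcl (PSeq (pconvM (pvalP s) (pvalP t))).
Proof.
have [N hN] := repr_pcl s; have [M hM] := repr_pcl t.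
by apply/pclP; exists (N + M)%N => n nm /=; rewrite hN ?hM //; lia.
Qed.

Lemma poppE s : popp (pcl s) = pcl (PSeq (pconvN (pvalP s))).
Proof. by have [N hN] := repr_pcl s; apply/pclP; exists N => n nm /=; rewrite hN. Qed.

Lemma pinvE s : pinv (pcl s) = pcl (PSeq (pconvV (pvalP s))).
Proof. by have [N hN] := repr_pcl s; apply/pclP; exists N => n nm /=; rewrite hN. Qed.

Let pemb0n n : pembed 0 n = 0.
Proof. by rewrite /pembed expr0n expn_eq0 gtn_eqF // expchar_gt0. Qed.

Let pemb1n n : pembed 1 n = 1.
Proof. by rewrite /pembed expr1n. Qed.

Lemma paddA : associative padd.
Proof.
move=> u v w; have [a ->] := pcl_ind u; have [b ->] := pcl_ind v; have [c ->] := pcl_ind w.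
by rewrite !paddE; apply/pclP; exists 0%N => n _ /=; rewrite addrA.
Qed.

Lemma paddC : commutative padd.
Proof.
move=> u v; have [a ->] := pcl_ind u; have [b ->] := pcl_ind v.
by rewrite !paddE; apply/pclP; exists 0%N => n _ /=; rewrite addrC.
Qed.

Lemma padd0 : left_id (pemb 0) padd.
Proof.
move=> u; have [a ->] := pcl_ind u.
by rewrite !paddE; apply/pclP; exists 0%N => n _ /=; rewrite pemb0n add0r.
Qed.

Lemma paddN : left_inverse (pemb 0) popp padd.
Proof.
move=> u; have [a ->] := pcl_ind u.
by rewrite poppE paddE; apply/pclP; exists 0%N => n _ /=; rewrite pemb0n addNr.
Qed.

HB.instance Definition _ := GRing.isZmodule.Build perfcl paddA paddC padd0 paddN.

Lemma pmulA : associative pmul.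
Proof.
move=> u v w; have [a ->] := pcl_ind u; have [b ->] := pcl_ind v; have [c ->] := pcl_ind w.
by rewrite !pmulE; apply/pclP; exists 0%N => n _ /=; rewrite mulrA.
Qed.

Lemma pmulC : commutative pmul.
Proof.
move=> u v; have [a ->] := pcl_ind u; have [b ->] := pcl_ind v.
by rewrite !pmulE; apply/pclP; exists 0%N => n _ /=; rewrite mulrC.
Qed.

Lemma pmul1 : left_id (pemb 1) pmul.
Proof.
move=> u; have [a ->] := pcl_ind u.
by rewrite !pmulE; apply/pclP; exists 0%N => n _ /=; rewrite pemb1n mul1r.
Qed.

Lemma pmulDl : left_distributive pmul padd.
Proof.
move=> u v w; have [a ->] := pcl_ind u; have [b ->] := pcl_ind v; have [c ->] := pcl_ind w.
by rewrite !(pmulE, paddE); apply/pclP; exists 0%N => n _ /=; rewrite mulrDl.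
Qed.

Lemma p1_neq0 : pemb 1 != pemb 0.
Proof.
apply/eqP => /pclP[N /(_ N (leqnn N))] /=; rewrite pemb0n pemb1n => /eqP.
by rewrite oner_eq0.
Qed.

HB.instance Definition _ := GRing.Zmodule_isComNzRing.Build perfcl
  pmulA pmulC pmul1 pmulDl p1_neq0.

(** Once the sequence is Frobenius-compatible, a single zero forces all later terms to be zero, and
    the class with them. *)
Let pcl_eq0 s : pcl s <> 0 -> exists N, forall n, (N <= n)%N -> s n != 0.
Proof.
have [N hN] := pvalP s => s0; exists N => n Nn; apply/eqP => sn0; apply: s0.
apply/pclP; exists n => k nk /=; rewrite pemb0n -(subnKC nk).
elim: (k - n)%N => [|j IH]; first by rewrite addn0.
by rewrite addnS hN ?IH ?expr0n ?gtn_eqF ?expchar_gt0 //; lia.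
Qed.

Lemma pmulV (u : perfcl) : u != 0 -> pinv u * u = 1.
Proof.
have [s ->] := pcl_ind u => /eqP /pcl_eq0[N hN].
rewrite pinvE [LHS]pmulE; apply/pclP; exists N => n nm /=.
by rewrite pemb1n mulVf // hN.
Qed.

Lemma pinv0 : pinv 0 = 0.
Proof. by rewrite pinvE; apply/pclP; exists 0%N => n _ /=; rewrite pemb0n invr0. Qed.

HB.instance Definition _ := GRing.ComNzRing_isField.Build perfcl pmulV pinv0.

Lemma psubE s t : pcl s - pcl t = pcl (PSeq (pconvD (pvalP s) (pconvN (pvalP t)))).
Proof. by rewrite (_ : _ - _ = padd (pcl s) (popp (pcl t))) // poppE paddE. Qed.

Lemma pemb_zmod : zmod_morphism pemb.
Proof.
move=> x y; apply: esym; rewrite [LHS](_ : _ = padd (pemb x) (popp (pemb y))) //.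
by rewrite poppE paddE; apply/pclP; exists 0%N => n _ /=; rewrite /pembed powB.
Qed.

Lemma pemb_monoid : monoid_morphism pemb.
Proof.
split=> // x y; rewrite [RHS]pmulE.
by apply/pclP; exists 0%N => n _ /=; rewrite /pembed exprMn.
Qed.

HB.instance Definition _ := GRing.isZmodMorphism.Build F perfcl pemb pemb_zmod.
HB.instance Definition _ := GRing.isMonoidMorphism.Build F perfcl pemb pemb_monoid.

Let pclX (s : pseq) k : 
  exists hk : pconv (fun n => s n ^+ k), pcl s ^+ k = pcl (PSeq hk).
Proof.
have h j : pconv (fun n => s n ^+ j).
  by have [N hN] := pvalP s; exists N => n nm; rewrite hN // exprAC.
exists (h k); elim: k => [|k IH].
  by apply/pclP; exists 0%N => n _ /=; rewrite pemb1n expr0.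
by rewrite exprS IH [LHS]pmulE; apply/pclP; exists 0%N => n _ /=; rewrite exprS.
Qed.

Lemma perfcl_pow (u : perfcl) : exists k x, u ^+ (p ^ k) = pemb x.
Proof.
have [s ->] := pcl_ind u; have [N hN] := pvalP s.
(* In the chosen encoding [s N] stands for the p ^ N-th power of u. *)
exists N, (s N); have [h ->] := pclX s (p ^ N); apply/pclP; exists N => n nm /=.
rewrite /pembed -(subnKC nm); elim: (n - N)%N => [|k IH]; first by rewrite addn0.
by rewrite addnS expnSr exprM -IH hN ?leq_addr // exprAC.
Qed.

Lemma perfcl_root (u : perfcl) k : exists v : perfcl, v ^+ (p ^ k) = u.
Proof.
have [s ->] := pcl_ind u; have [N hN] := pvalP s.
(* Delaying the sequence by k steps extracts a p ^ k-th root. *)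
have h : pconv (fun n => s (n - k)%N).
  by exists (N + k)%N => n nm; rewrite subSn ?hN //; lia.
exists (pcl (PSeq h)); have [h' ->] := pclX (PSeq h) (p ^ k).
apply/pclP; exists (N + k)%N => n nm /=.
have e : forall j m, (N <= m)%N -> s m ^+ (p ^ j) = s (m + j)%N.
  elim=> [|j IH] m Nm; first by rewrite addn0.
  by rewrite expnSr exprM IH // addnS hN //; lia.
by rewrite e ?subnK //; lia.
Qed.
End PerfectClosure.

Lemma expchar_rmorph (F L : fieldType) (phi : {rmorphism F -> L}) : expchar F = expchar L.
Proof. by rewrite /expchar; congr xget; apply/funext => q; rewrite /mkset (fmorph_pchar phi). Qed.

Section PerfectMap.
Variables (F L : fieldType) (phi : {rmorphism F -> L}).

Lemma pconv_map f : pconv f -> @pconv L (phi \o f).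
Proof.
by move=> [N hN]; exists N => n /hN /= ->; rewrite rmorphXn (expchar_rmorph phi).
Qed.

Definition pmap (u : perfcl F) : perfcl L := pcl (PSeq (pconv_map (pvalP (repr u)))).

Lemma pmapE (s : pseq F) : pmap (pcl s) = pcl (PSeq (pconv_map (pvalP s))).
Proof.
have [N hN] := repr_pcl s.
by apply: (pclP _ _).2; exists N => n /hN /= ->.
Qed.

Lemma pmap_zmod : zmod_morphism pmap.
Proof.
move=> u v; have [s ->] := pcl_ind u; have [t ->] := pcl_ind v.
rewrite psubE !pmapE psubE.
by apply: (pclP _ _).2; exists 0%N => n _ /=; rewrite rmorphB.
Qed.

Lemma pmap_monoid : monoid_morphism pmap.
Proof.
split=> [|u v].
  by rewrite pmapE; apply: (pclP _ _).2; exists 0%N => n _ /=; rewrite /pembed !expr1n rmorph1.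
have [s ->] := pcl_ind u; have [t ->] := pcl_ind v.
rewrite (pmulE s t : pcl s * pcl t = _) !pmapE [RHS]pmulE.
by apply: (pclP _ _).2; exists 0%N => n _ /=; rewrite rmorphM.
Qed.

HB.instance Definition _ := GRing.isZmodMorphism.Build (perfcl F) (perfcl L) pmap pmap_zmod.
HB.instance Definition _ := GRing.isMonoidMorphism.Build (perfcl F) (perfcl L) pmap pmap_monoid.

Lemma pmap_emb x : pmap (pemb x) = pemb (phi x).
Proof.
rewrite /pemb pmapE; apply: (pclP _ _).2; exists 0%N => n _ /=.
by rewrite /pembed rmorphXn (expchar_rmorph phi).
Qed.
End PerfectMap.

(** * Prime ideals avoiding a multiplicative set, and radicals *)

Definition ideal (A : comPzRingType) (I : set A) :=
  [/\ I 0, forall a b, I a -> I b -> I (a + b) & forall a b, I b -> I (a * b)].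

Definition mulset (A : comPzRingType) (S : set A) :=
  S 1 /\ forall a b, S a -> S b -> S (a * b).

Lemma prime_avoiding (A : comPzRingType) (I S : set A) :
  ideal I -> mulset S -> (forall a, I a -> S a -> False) ->
  exists P : prime_ideal A, (forall a, I a -> pideal P a) /\
    (forall a, S a -> ~ pideal P a).
Proof.
move=> [I0 ID IM] [S1 SM] IS.
pose good (X : set A) := ideal X /\ forall a, X a -> S a -> False.
(* The predicate is about the union with I, because the empty chain has an empty union, for which
   the predicate must hold as well. *)
have [] := @Zorn_bigcup A [set J | good (J `|` I)].
  move=> C CP tot; split; last first.
    move=> a [[X CX Xa]|Ia] Sa; last exact: IS Sa.
    by have [_ /(_ a)] := CP _ CX; apply=> //; left.
  split; first by right.
  - have cl X a b : C X -> (X `|` I) a -> (X `|` I) b -> (\bigcup_(X in C) X `|` I) (a + b).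
      move=> CX Xa Xb; have [[_ D _] _] := CP _ CX.
      by have [Z|Z] := D a b Xa Xb; [left; exists X|right].
    move=> a b [[X CX Xa]|Ia] [[Y CY Yb]|Ib].
    + have [XY|YX] := tot _ _ CX CY.
        by apply: (cl Y) => //; left => //; apply: XY.
      by apply: (cl X) => //; left => //; apply: YX.
    + by apply: (cl X) => //; [left|right].
    + by apply: (cl Y) => //; [right|left].
    + by right; apply: ID.
  - move=> a b [[X CX Xb]|Ib]; last by right; apply: IM.
    have [[_ _ M] _] := CP _ CX.
    by have [|Z|Z] := M a b; [left|left; exists X|right].
move=> M [gM maxM]; pose N := M `|` I.
have [[N0 ND NM] NS] : good N by [].
have max X : good X -> N `<=` X -> X `<=` N.
  move=> gX NX a Xa; apply: contrapT => nNa; apply: (maxM X).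
    by split=> [b Mb|XM]; [apply: NX; left|apply: nNa; left; apply: XM].
  rewrite /= (_ : X `|` I = X) //; apply/seteqP; split=> [b [//|Ib]|b]; last by left.
  by apply: NX; right.
(* By maximality the ideal generated by N and an element outside of N meets S. *)
have adj a : ~ N a -> exists n x, N n /\ S (n + x * a).
  move=> nNa; apply: contrapT => no; apply: nNa.
  pose X := [set y | exists n x, N n /\ y = n + x * a].
  apply: (max X); last first.
  - by exists 0, 1; split=> //; rewrite add0r mul1r.
  - by move=> b Nb; exists b, 0; split=> //; rewrite mul0r addr0.
  split; last by move=> _ [n [x [Nn ->]]] Sx; apply: no; exists n, x.
  split.
  - by exists 0, 0; split=> //; rewrite mul0r addr0.
  - move=> _ _ [n [x [Nn ->]]] [n' [x' [Nn' ->]]]; exists (n + n'), (x + x').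
    by split; [apply: ND|ring].
  - move=> c _ [n [x [Nn ->]]]; exists (c * n), (c * x).
    by split; [apply: NM|ring].
have N1 : ~ N 1 by move=> N1; apply: (NS 1).
(* If a and b were both outside of N, the product of two elements of S given by [adj] would lie in N
   and in S. *)
have Npr a b : N (a * b) -> N a \/ N b.
  move=> Nab; apply: contrapT => /not_orP[/adj[n [x [Nn Sn]]] /adj[m [y [Nm Sm]]]].
  apply: (NS _ _ (SM _ _ Sn Sm)).
  rewrite (_ : _ * _ = (m + y * b) * n + (x * a * m + x * y * (a * b))); last by ring.
  by apply: (ND); [apply: (NM)|apply: (ND); apply: (NM)].
exists (@PrimeIdeal A N N0 ND NM N1 Npr); split=> a /=; first by right.
by move=> Sa Na; apply: NS Na Sa.
Qed.

(** Apply [prime_avoiding] to the powers of f. Two special cases recur: I = 0 for nilpotent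
    elements, and f = 1 to show that an ideal contained in no prime is the unit ideal. *)
Lemma prime_notin_power (A : comPzRingType) (I : set A) (f : A) :
  ideal I -> (forall P : prime_ideal A, (forall a, I a -> pideal P a) -> pideal P f) ->
  exists n, I (f ^+ n).
Proof.
move=> hI hf; apply: contrapT => no.
have [||P [IP SP]] := @prime_avoiding A I [set f ^+ n | n in setT] hI.
- split; first by exists 0%N.
  by move=> _ _ [n _ <-] [m _ <-]; exists (n + m)%N => //; rewrite exprD.
- by move=> a Ia [n _ e]; apply: no; exists n; rewrite e.
- by apply: (SP f); [exists 1%N; rewrite ?expr1|apply: hf].
Qed.

(** * Sheaves of functions *)

Definition dfun (T : Type) (K : T -> fieldType) : Type := forall x, K x.

Section DependentFunctions.
Variables (T : Type) (K : T -> fieldType).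
Implicit Types s t u : dfun K.

HB.instance Definition _ := gen_eqMixin (dfun K).
HB.instance Definition _ := gen_choiceMixin (dfun K).

Lemma dfunP s t : (forall x, s x = t x) -> s = t.
Proof. exact: functional_extensionality_dep. Qed.

Definition dadd s t : dfun K := fun x => s x + t x.
Definition dopp s : dfun K := fun x => - s x.
Definition dmul s t : dfun K := fun x => s x * t x.
Definition dzero : dfun K := fun x => 0.
Definition dunit : dfun K := fun x => 1.

Lemma daddA : associative dadd. Proof. by move=> s t u; apply: dfunP => x; apply: addrA. Qed.
Lemma daddC : commutative dadd. Proof. by move=> s t; apply: dfunP => x; apply: addrC. Qed.
Lemma dadd0 : left_id dzero dadd. Proof. by move=> s; apply: dfunP => x; apply: add0r. Qed.
Lemma daddN : left_inverse dzero dopp dadd.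
Proof. by move=> s; apply: dfunP => x; apply: addNr. Qed.
HB.instance Definition _ := GRing.isZmodule.Build (dfun K) daddA daddC dadd0 daddN.

Lemma dmulA : associative dmul. Proof. by move=> s t u; apply: dfunP => x; apply: mulrA. Qed.
Lemma dmulC : commutative dmul. Proof. by move=> s t; apply: dfunP => x; apply: mulrC. Qed.
Lemma dmul1 : left_id dunit dmul. Proof. by move=> s; apply: dfunP => x; apply: mul1r. Qed.
Lemma dmulDl : left_distributive dmul dadd.
Proof. by move=> s t u; apply: dfunP => x; apply: mulrDl. Qed.
HB.instance Definition _ := GRing.Zmodule_isComPzRing.Build (dfun K) dmulA dmulC dmul1 dmulDl.

Definition dev (x : T) (s : dfun K) : K x := s x.
Lemma dev_zmod x : zmod_morphism (dev x). Proof. by []. Qed.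
Lemma dev_monoid x : monoid_morphism (dev x). Proof. by []. Qed.
HB.instance Definition _ x := GRing.isZmodMorphism.Build (dfun K) (K x) (dev x) (dev_zmod x).
HB.instance Definition _ x := GRing.isMonoidMorphism.Build (dfun K) (K x) (dev x) (dev_monoid x).

Lemma dfunD s t x : (s + t) x = s x + t x. Proof. by []. Qed.
Lemma dfunB s t x : (s - t) x = s x - t x. Proof. by []. Qed.
Lemma dfunM s t x : (s * t) x = s x * t x. Proof. by []. Qed.
Lemma dfunN s x : (- s) x = - s x. Proof. by []. Qed.
Lemma dfunX s n x : (s ^+ n) x = s x ^+ n. Proof. exact: (rmorphXn (dev x)). Qed.
Lemma dfun_sum n (F : 'I_n -> dfun K) x : (\sum_(i < n) F i) x = \sum_(i < n) F i x.
Proof. exact: (rmorph_sum (dev x)). Qed.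
End DependentFunctions.

Lemma choice_dfun (T : Type) (K : T -> Type) (P : forall x, K x -> Prop) :
  (forall x, exists v, P x v) -> exists g : forall x, K x, forall x, P x (g x).
Proof. by move=> H; exists (fun x => projT1 (cid (H x))) => x; apply: projT2 (cid (H x)). Qed.

Lemma choice_ex (X Y : Type) (P : X -> Y -> Prop) :
  (forall x, exists y, P x y) -> exists f, forall x, P x (f x).
Proof. by move=> /choice[f hf]; exists f. Qed.

Definition subring (F : comPzRingType) (G : set F) :=
  [/\ G 1, forall a b, G a -> G b -> G (a - b) & forall a b, G a -> G b -> G (a * b)].

Definition near_eq (T : topologicalType) (K : T -> fieldType) (x : T) (s t : dfun K) :=
  exists V : opens T, oset V x /\ forall y, oset V y -> s y = t y.

Section Subring.
Variables (F : comPzRingType) (G : set F) (hG : subring G).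
Lemma sub1 : G 1. Proof. by case: hG. Qed.
Lemma subB a b : G a -> G b -> G (a - b). Proof. by case: hG => _ h _; apply: h. Qed.
Lemma subM a b : G a -> G b -> G (a * b). Proof. by case: hG => _ _ h; apply: h. Qed.
Lemma sub0 : G 0. Proof. by rewrite -(subrr 1); apply: subB; apply: sub1. Qed.
Lemma subN a : G a -> G (- a). Proof. by rewrite -sub0r; apply/subB/sub0. Qed.
Lemma subD a b : G a -> G b -> G (a + b).
Proof. by move=> Ga Gb; rewrite -[b]opprK; apply/subB/subN. Qed.
Lemma subX a n : G a -> G (a ^+ n).
Proof. by move=> Ga; elim: n => [|n IH]; rewrite ?expr0 ?exprS; [apply: sub1|apply: subM]. Qed.
Lemma sub_sum n (f : 'I_n -> F) : (forall i, G (f i)) -> G (\sum_(i < n) f i).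
Proof. by move=> Gf; elim/big_ind: _ => //; [apply: sub0|apply: subD]. Qed.
End Subring.

(* A sheaf of rings of functions with values in fields, given by the rings
   [fG x] of functions that are admissible near [x]. *)
Record fsys := FSys {
  ftop : topologicalType;
  fK : ftop -> fieldType;
  fG : forall x : ftop, set (dfun fK);
  fGring : forall x, subring (fG x);
  fGloc : forall x s t, fG x s -> near_eq x s t -> fG x t }.
Arguments fG : clear implicits.

Section FunctionSheaf.
Variable S : fsys.
Local Notation T := (ftop S).
Local Notation K := (fK (f := S)).

Definition ind (U : set T) : dfun K := fun x => if `[<U x>] then 1 else 0.

Lemma indT (U : set T) x : U x -> ind U x = 1.
Proof. by rewrite /ind; case: asboolP. Qed.
Lemma indF (U : set T) x : ~ U x -> ind U x = 0.
Proof. by rewrite /ind; case: asboolP. Qed.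

Section Sections.
Variable U : opens T.

(** Sections over U are total functions extended by zero. All sections then live in one ring
    [dfun K], restriction is multiplication by an indicator, and the unit is the indicator of U. *)
Record fsec := FSec {
  fval : dfun K;
  fval0 : forall x, ~ oset U x -> fval x = 0;
  fvalG : forall x, oset U x -> fG S x fval }.

Lemma fsecP s t : fval s = fval t -> s = t.
Proof.
case: s t => [s s0 sG] [t t0 tG] /= e; subst t.
by congr FSec; apply: Prop_irrelevance.
Qed.

HB.instance Definition _ := gen_eqMixin fsec.
HB.instance Definition _ := gen_choiceMixin fsec.

Program Definition fadd (s t : fsec) := @FSec (fval s + fval t) _ _.
Next Obligation. by move=> s t x Ux; rewrite dfunD !fval0 // addr0. Qed.
Next Obligation. by move=> s t x Ux; apply: (subD (fGring x)); apply: fvalG. Qed.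

Program Definition fopp (s : fsec) := @FSec (- fval s) _ _.
Next Obligation. by move=> s x Ux; rewrite dfunN !fval0 // oppr0. Qed.
Next Obligation. by move=> s x Ux; apply: (subN (fGring x)); apply: fvalG. Qed.

Program Definition fmul (s t : fsec) := @FSec (fval s * fval t) _ _.
Next Obligation. by move=> s t x Ux; rewrite dfunM !fval0 // mulr0. Qed.
Next Obligation. by move=> s t x Ux; apply: (subM (fGring x)); apply: fvalG. Qed.

Program Definition fzero := @FSec 0 _ _.
Next Obligation. by []. Qed.
Next Obligation. by move=> x Ux; apply: (sub0 (fGring x)). Qed.

Program Definition fone := @FSec (ind U) _ _.
Next Obligation. exact: indF. Qed.
Next Obligation.
move=> x Ux; apply: fGloc (sub1 (fGring x)) _.
by exists U; split=> // y Uy; rewrite indT.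
Qed.

Lemma faddA : associative fadd. Proof. by move=> *; apply/fsecP/addrA. Qed.
Lemma faddC : commutative fadd. Proof. by move=> *; apply/fsecP/addrC. Qed.
Lemma fadd0 : left_id fzero fadd. Proof. by move=> *; apply/fsecP/add0r. Qed.
Lemma faddN : left_inverse fzero fopp fadd. Proof. by move=> *; apply/fsecP/addNr. Qed.
HB.instance Definition _ := GRing.isZmodule.Build fsec faddA faddC fadd0 faddN.
Lemma fmulA : associative fmul. Proof. by move=> *; apply/fsecP/mulrA. Qed.
Lemma fmulC : commutative fmul. Proof. by move=> *; apply/fsecP/mulrC. Qed.
Lemma fmul1 : left_id fone fmul.
Proof.
move=> s; apply/fsecP/dfunP => x; rewrite /= dfunM.
have [Ux|Ux] := asboolP (oset U x); first by rewrite indT // mul1r.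
by rewrite indF // mul0r fval0.
Qed.
Lemma fmulDl : left_distributive fmul fadd. Proof. by move=> *; apply/fsecP/mulrDl. Qed.
HB.instance Definition _ := GRing.Zmodule_isComPzRing.Build fsec fmulA fmulC fmul1 fmulDl.

End Sections.

Arguments fval {U}.

Section Restriction.
Variables (U V : opens T) (h : V `<=` U).

Program Definition fres (s : fsec U) := @FSec V (ind V * fval s) _ _.
Next Obligation. by move=> s x Vx; rewrite dfunM indF // mul0r. Qed.
Next Obligation.
move=> s x Vx; apply: fGloc (fvalG s (h Vx)) _.
by exists V; split=> // y Vy; rewrite dfunM indT // mul1r.
Qed.

Lemma fres_zmod : zmod_morphism fres.
Proof. by move=> s t; apply/fsecP; rewrite /= mulrBr. Qed.
Lemma fres_monoid : monoid_morphism fres.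
Proof.
split=> [|s t]; apply/fsecP/dfunP => x; rewrite /= !dfunM.
  have [Vx|Vx] := asboolP (oset V x); last by rewrite indF // mul0r.
  by rewrite !indT ?mulr1 //; apply: h.
have [Vx|Vx] := asboolP (oset V x); last by rewrite indF // !mul0r.
by rewrite indT // !mul1r.
Qed.
HB.instance Definition _ := GRing.isZmodMorphism.Build (fsec U) (fsec V) fres fres_zmod.
HB.instance Definition _ := GRing.isMonoidMorphism.Build (fsec U) (fsec V) fres fres_monoid.

Lemma fresE (s : fsec U) x : oset V x -> fval (fres s) x = fval s x.
Proof. by move=> Vx; rewrite /= dfunM indT // mul1r. Qed.

End Restriction.

Lemma fsec_eq (U : opens T) (s t : fsec U) :
  (forall x, oset U x -> fval s x = fval t x) -> s = t.
Proof.
move=> st; apply/fsecP/dfunP => x.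
have [Ux|Ux] := asboolP (oset U x); first exact: st.
by rewrite !fval0.
Qed.

Lemma fglue (I : Type) (U : opens T) (W : I -> opens T)
    (hW : forall i, W i `<=` U) (s : forall i, fsec (W i)) :
  U `<=` \bigcup_i W i ->
  (forall i j, fres (V := opensI (W i) (W j)) (@subIsetl _ _ _) (s i) =
               fres (V := opensI (W i) (W j)) (@subIsetr _ _ _) (s j)) ->
  exists! t : fsec U, forall i, fres (hW i) t = s i.
Proof.
move=> cov compat.
have sij i j x : oset (W i) x -> oset (W j) x -> fval (s i) x = fval (s j) x.
  move=> Wi Wj; have := congr1 (fun t => fval t x) (compat i j).
  by rewrite /= !dfunM indT ?mul1r //=; split.
have [g gP] : exists g : dfun K, forall x i, oset (W i) x -> g x = fval (s i) x.
  apply: (choice_dfun (P := fun x v => forall i, oset (W i) x -> v = fval (s i) x)).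
  move=> x; have [[i Wi]|no] := pselect (exists i, oset (W i) x).
    by exists (fval (s i) x) => j Wj; apply: sij.
  by exists 0 => i Wi; case: no; exists i.
pose t0 : dfun K := ind U * g.
have t0W i x : oset (W i) x -> t0 x = fval (s i) x.
  by move=> Wx; rewrite /t0 dfunM indT ?mul1r; [apply: gP|apply: hW Wx].
have t0P x : oset U x -> fG S x t0.
  move=> Ux; have [i _ Wi] := cov _ Ux.
  apply: fGloc (fvalG (s i) Wi) _; exists (W i); split=> // y Wy.
  by rewrite (t0W i).
have t00 x : ~ oset U x -> t0 x = 0 by move=> Ux; rewrite /t0 dfunM indF ?mul0r.
exists (@FSec U t0 t00 t0P).
split=> [i|t ht]; first by apply: fsec_eq => x Wx; rewrite fresE //=; apply: t0W.
apply: fsec_eq => x Ux /=; have [i _ Wi] := cov _ Ux.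
by rewrite (t0W i) // -(ht i) fresE.
Qed.

Definition fspace : ringed_space.
Proof.
refine (@RingedSpace T fsec (fun U V h => fres h : {rmorphism fsec U -> fsec V}) _ _ _).
- by move=> U h s; apply: fsec_eq => x Ux; rewrite fresE.
- move=> U V W hUV hVW hUW s; apply: fsec_eq => x Wx.
  by rewrite !fresE //; apply: hVW.
- exact: fglue.
Defined.

End FunctionSheaf.

(** * Weakly subintegral elements *)

Section DeterminantTrick.
Variables (F : comNzRingType) (k : comNzRingType) (eps : {rmorphism F -> k}) (G : set F).
Hypothesis hG : subring G.

Let PG (p : {poly F}) := forall i, G p`_i.

Let PGM p q : PG p -> PG q -> PG (p * q).
Proof. by move=> hp hq i; rewrite coefM; apply: (sub_sum hG) => j; apply: (subM hG). Qed.

Lemma char_poly_coef n (M : 'M[F]_n) : (forall i j, G (M i j)) -> PG (char_poly M).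
Proof.
move=> GM; rewrite /char_poly /determinant; elim/big_ind: _.
- by move=> i; rewrite coef0; apply: sub0.
- by move=> p q hp hq i; rewrite coefD; apply: subD.
move=> s _; apply: PGM.
  move: (nat_of_bool _) => m; elim: m => [|m IH] i.
    by rewrite expr0 coef1; case: (i == 0)%N; [exact: (sub1 hG)|exact: (sub0 hG)].
  by rewrite exprS mulN1r coefN; apply: (subN hG).
elim/big_ind: _; [|exact: PGM|].
  by move=> i; rewrite coef1; case: (i == 0)%N; [exact: (sub1 hG)|exact: (sub0 hG)].
move=> i _ j; rewrite !mxE coefB coefMn coefX coefC.
apply: (subB hG); last by case: eqP => // _; exact: (sub0 hG).
by case: (i == _); case: (j == 1)%N; rewrite ?mulr1n ?mulr0n;
  try exact: (sub0 hG); exact: (sub1 hG).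
Qed.

Lemma char_poly_monic_eq n (M : 'M[F]_n) (t : F) : (char_poly M).[t] = 0 ->
  t ^+ n = \sum_(i < n) - (char_poly M)`_i * t ^+ i.
Proof.
have sz := size_char_poly M; have := monicP (char_poly_monic M); rewrite lead_coefE sz /= => lc.
rewrite horner_coef sz big_ord_recr /= lc mul1r => /eqP; rewrite addrC addr_eq0 => /eqP ->.
by rewrite -sumrN; apply: eq_bigr => i _; rewrite mulNr.
Qed.

(** Multiplying (t - M) v = 0 by the adjugate shows that det (t - M) kills v, in particular its
    entry 1. *)
Lemma determinant_trick n (M : 'M[F]_n) (v : 'cV[F]_n) (t : F) :
  t *: v = M *m v -> (exists i, v i ord0 = 1) -> (char_poly M).[t] = 0.
Proof.
move=> tv [i vi].
have dv : \det (t%:M - M) *: v = 0.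
  rewrite -mul_scalar_mx -mul_adj_mx -mulmxA mulmxBl mul_scalar_mx tv subrr.
  exact: mulmx0.
have : (\det (t%:M - M) *: v) i ord0 = 0 by rewrite dv mxE.
rewrite mxE vi mulr1 => d0; rewrite -[RHS]d0 /char_poly -horner_evalE -det_map_mx.
congr determinant; apply/matrixP => a b; rewrite !mxE /horner_eval.
by rewrite rmorphB rmorphMn /= /horner_eval hornerX hornerC.
Qed.

(** Under eps the matrix becomes 0, whose characteristic polynomial is a power of the variable. *)
Lemma char_poly_eps n (M : 'M[F]_n) : (forall i j, eps (M i j) = 0) ->
  forall i : 'I_n, eps (char_poly M)`_i = 0.
Proof.
move=> eM i; rewrite -coef_map map_char_poly.
rewrite (_ : map_mx _ _ = 0); last by apply/matrixP => a b; rewrite !mxE.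
rewrite /char_poly (_ : char_poly_mx 0 = 'X%:M); last first.
  by apply/matrixP => a b; rewrite !mxE subr0.
by rewrite det_scalar coefXn ltn_eqF.
Qed.

(** The flag z treats two statements at once: integrality over G, and integrality over the ideal of
    elements of G killed by eps. *)
Lemma finite_module_monic (z : bool) n (c : 'I_n -> 'I_n -> F) (v : 'I_n -> F) (t : F) :
  (forall i, t * v i = \sum_j c i j * v j) -> (exists i, v i = 1) ->
  (forall i j, G (c i j)) -> (z -> forall i j, eps (c i j) = 0) ->
  exists m : nat -> F, [/\ forall i, G (m i), z -> forall i, eps (m i) = 0 &
      t ^+ n = \sum_(i < n) m i * t ^+ i].
Proof.
move=> tv [i0 v1] Gc ec; pose M : 'M[F]_n := \matrix_(i, j) c i j.
have ch : (char_poly M).[t] = 0.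
  apply: (@determinant_trick _ M (\col_i v i)); last by exists i0; rewrite mxE.
  by apply/matrixP => i j; rewrite !mxE tv; apply: eq_bigr => l _; rewrite !mxE.
(* The leading coefficient 1 is not killed by eps, hence the cut at n. *)
exists (fun i => if (i < n)%N then - (char_poly M)`_i else 0); split.
- move=> i; case: ltnP => _; last exact: sub0.
  by apply: (subN hG); apply: char_poly_coef => // a b; rewrite mxE.
- move=> hz i; case: ltnP => hi; last exact: rmorph0.
  rewrite rmorphN (@char_poly_eps _ M _ (Ordinal hi)) ?oppr0 // => a b.
  by rewrite mxE; apply: ec.
- by rewrite (char_poly_monic_eq ch); apply: eq_bigr => i _; rewrite ltn_ord.
Qed.
End DeterminantTrick.

Section WeakNormality.
Variables (F : comPzRingType) (k : fieldType) (eps : {rmorphism F -> k}) (G : set F).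
Hypothesis hG : subring G.
Implicit Types (w : seq F) (z : bool) (t u : F).

Inductive span w z : F -> Prop :=
| SpanZero : span w z 0
| SpanCons c e t : G c -> (z -> eps c = 0) -> e \in w -> span w z t -> span w z (c * e + t).

(* [stab w z t]: multiplication by [t] maps the [G]-span of [w] into itself, and
   even into [(G :&: ker eps) w] if [z]. *)
Definition stab w z t := forall e, e \in w -> span w z (t * e).

Lemma spanD w z t u : span w z t -> span w z u -> span w z (t + u).
Proof.
by move=> ht hu; elim: ht => [|c e v Gc ec ew _ IH]; rewrite ?add0r -?addrA //; apply: SpanCons.
Qed.

Lemma span_scale w z z' c t : G c -> (z' -> eps c = 0) -> span w z t -> span w (z || z') (c * t).
Proof.
move=> Gc ec; elim=> [|d e v Gd ed ew _ IH]; first by rewrite mulr0; apply: SpanZero.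
rewrite mulrDr mulrA; apply: SpanCons => //; first exact: subM.
by rewrite rmorphM; case: z ed {IH} => [/(_ isT) ->|_ /= /ec ->]; rewrite ?mulr0 ?mul0r.
Qed.

Lemma span_weak w z t : span w z t -> span w false t.
Proof. by elim=> [|c e v Gc ec ew _ IH]; [apply: SpanZero|apply: SpanCons]. Qed.

Lemma span_mem w e : e \in w -> span w false e.
Proof.
move=> ew; rewrite -[e]mul1r -[1 * e]addr0; apply: SpanCons => //; [exact: sub1|exact: SpanZero].
Qed.

Lemma span_eps w t : span w true t -> eps t = 0.
Proof.
elim=> [|c e v Gc ec ew _ IH]; first by rewrite rmorph0.
by rewrite rmorphD rmorphM ec // IH mul0r addr0.
Qed.

Lemma stab_span w z z' t u : stab w z t -> span w z' u -> span w (z || z') (t * u).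
Proof.
move=> st; elim=> [|c e v Gc ec ew _ IH]; first by rewrite mulr0; apply: SpanZero.
by rewrite mulrDr mulrCA; apply: spanD => //; apply: span_scale => //; apply: st.
Qed.

Lemma stab_weak w z t : stab w z t -> stab w false t.
Proof. by move=> st e /st; apply: span_weak. Qed.

Lemma stab0 w z : stab w z 0.
Proof. by move=> e _; rewrite mul0r; apply: SpanZero. Qed.
Lemma stabD w z t u : stab w z t -> stab w z u -> stab w z (t + u).
Proof. by move=> st su e ew; rewrite mulrDl; apply: spanD; [apply: st|apply: su]. Qed.
Lemma stabM w z z' t u : stab w z t -> stab w z' u -> stab w (z || z') (t * u).
Proof. by move=> st su e ew; rewrite -mulrA; apply: stab_span => //; apply: su. Qed.
Lemma stab_scalar w z c : G c -> (z -> eps c = 0) -> stab w z c.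
Proof.
by move=> Gc ec e ew; apply: (@span_scale w false z) => //; apply: span_mem.
Qed.
Lemma stab1 w : stab w false 1. Proof. by apply: stab_scalar => //; apply: sub1. Qed.
Lemma stabN w z t : stab w z t -> stab w z (- t).
Proof.
move=> st; rewrite -mulN1r -[z]/(false || z); apply: stabM => //.
by apply: stab_scalar => //; apply: (subN hG); apply: sub1.
Qed.
Lemma stabB w z t u : stab w z t -> stab w z u -> stab w z (t - u).
Proof. by move=> st su; apply/stabD/stabN. Qed.
Lemma stabMf w t u : stab w false t -> stab w false u -> stab w false (t * u).
Proof. exact: (@stabM w false false). Qed.
Lemma stabMt w t u : stab w false t -> stab w true u -> stab w true (t * u).
Proof. exact: (@stabM w false true). Qed.
Lemma stabX w t n : stab w false t -> stab w false (t ^+ n).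
Proof.
by move=> st; elim: n => [|n IH]; rewrite ?expr0 ?exprS; [apply: stab1|apply: stabMf].
Qed.
Lemma stab_sum w z n (f : 'I_n -> F) :
  (forall i, stab w z (f i)) -> stab w z (\sum_(i < n) f i).
Proof. by move=> sf; elim/big_ind: _ => //; [apply: stab0|apply: stabD]. Qed.
Lemma stabMn w z t n : stab w z t -> stab w z (t *+ n).
Proof. by move=> st; elim: n => [|n IH]; rewrite ?mulrS; [apply: stab0|apply: stabD]. Qed.

Definition prodw w w' : seq F := [seq a * b | a <- w, b <- w'].

Lemma prodw1 w w' : 1 \in w -> 1 \in w' -> 1 \in prodw w w'.
Proof. by move=> h h'; apply/allpairsP; exists (1, 1); rewrite mulr1. Qed.

Lemma span_prodl w w' z t e : span w z t -> e \in w' -> span (prodw w w') z (t * e).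
Proof.
move=> st ew; elim: st => [|c d v Gc ec dw _ IH]; first by rewrite mul0r; apply: SpanZero.
rewrite mulrDl -mulrA; apply: SpanCons => //.
by apply/allpairsP; exists (d, e).
Qed.

Lemma span_prodr w w' z t e : span w' z t -> e \in w -> span (prodw w w') z (e * t).
Proof.
move=> st ew; elim: st => [|c d v Gc ec dw _ IH]; first by rewrite mulr0; apply: SpanZero.
rewrite mulrDr mulrCA; apply: SpanCons => //.
by apply/allpairsP; exists (e, d).
Qed.

Lemma stab_prodl w w' z t : stab w z t -> stab (prodw w w') z t.
Proof.
by move=> st e /allpairsP[[a b] /= [aw bw ->]]; rewrite mulrA; apply: span_prodl => //; apply: st.
Qed.

Lemma stab_prodr w w' z t : stab w' z t -> stab (prodw w w') z t.
Proof.
by move=> st e /allpairsP[[a b] /= [aw bw ->]]; rewrite mulrCA; apply: span_prodr => //; apply: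
  st.
Qed.

Lemma span_coef w z t : span w z t -> exists c : 'I_(size w) -> F,
  [/\ forall i, G (c i), z -> forall i, eps (c i) = 0 & t = \sum_i c i * w`_i].
Proof.
elim=> [|c e v Gc ec ew _ [d [Gd ed ->]]].
  exists (fun=> 0); split=> [_|_ _|]; [exact: sub0|exact: rmorph0|].
  by rewrite big1 // => i _; rewrite mul0r.
have ie : (index e w < size w)%N by rewrite index_mem.
exists (fun i => (if i == Ordinal ie then c else 0) + d i); split=> [i|hz i|].
- by apply: (subD hG) => //; case: eqP => // _; apply: sub0.
- by rewrite rmorphD ed // addr0; case: eqP; rewrite ?rmorph0 ?ec.
- under [in RHS]eq_bigr do rewrite mulrDl.
  rewrite big_split /=; congr (_ + _).
  rewrite (bigD1 (Ordinal ie)) //= eqxx nth_index // big1 ?addr0 // => i /negbTE ->.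
  exact: mul0r.
Qed.

Lemma stab_monic w z t : 1 \in w -> stab w z t -> exists n (m : nat -> F),
  [/\ forall i, G (m i), z -> forall i, eps (m i) = 0 &
      t ^+ n = \sum_(i < n) m i * t ^+ i].
Proof.
(* If 1 = 0 the equation of degree 0 holds. Otherwise F is repackaged as a nonzero ring for the
   matrix argument. *)
move=> w1 st; have [F0|F0] := eqVneq (1 : F) 0.
  exists 0%N, (fun=> 0); split=> [_|_ _|]; [exact: sub0|exact: rmorph0|].
  by rewrite big_ord0 expr0.
have [c hc] := @choice _ _ _ (fun i : 'I_(size w) => span_coef (st _ (mem_nth 0 (ltn_ord i)))).
pose F1 : comNzRingType := HB.pack F (GRing.PzSemiRing_isNonZero.Build F F0).
exists (size w); apply: (@finite_module_monic F1 k eps G hG z _ c (fun i => w`_i)).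
- by move=> i; have [] := hc i.
- have i1 : (index 1%R w < size w)%N by rewrite index_mem.
  by exists (Ordinal i1); rewrite /= nth_index.
- by move=> i; have [] := hc i.
- by move=> hz i; have [_ h _] := hc i; apply: h.
Qed.

(** When 1 belongs to w, such a t is integral over the ideal of elements of G killed by eps; this is
    the condition to be imposed on s ^+ Q - c. *)
Definition rad w t := stab w false t /\ exists N, stab w true (t ^+ N).

Lemma rad_prodl w w' t : rad w t -> rad (prodw w w') t.
Proof. by move=> [st [N sN]]; split; [|exists N]; apply: stab_prodl. Qed.
Lemma rad_prodr w w' t : rad w' t -> rad (prodw w w') t.
Proof. by move=> [st [N sN]]; split; [|exists N]; apply: stab_prodr. Qed.

Lemma rad_stab w t : stab w true t -> rad w t.
Proof. by move=> st; split; [apply: stab_weak st|exists 1%N; rewrite expr1]. Qed.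

Lemma rad0 w : rad w 0.
Proof. exact/rad_stab/stab0. Qed.

Lemma radM w t u : stab w false t -> rad w u -> rad w (t * u).
Proof.
move=> st [su [N sN]]; split; first exact: stabMf.
by exists N; rewrite exprMn; apply: stabMt => //; apply: stabX.
Qed.

Lemma radD w t u : rad w t -> rad w u -> rad w (t + u).
Proof.
move=> [st [N sN]] [su [M sM]]; split; first exact: stabD.
exists (N + M)%N; rewrite exprDn; apply: stab_sum => i; apply: stabMn.
have [iM|iM] := leqP M i.
  by rewrite -{2}(subnK iM) exprD mulrA; apply: stabMt => //; apply: stabMf; apply: stabX.
rewrite (_ : (N + M - i)%N = (N + M - i - N) + N)%N; last by lia.
by rewrite exprD mulrAC; apply: stabMt => //; apply: stabMf; apply: stabX.
Qed.

Lemma radX w t n : stab w false t -> rad w (t ^+ n) -> rad w t.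
Proof. by move=> st [_ [N sN]]; split=> //; exists (n * N)%N; rewrite exprM. Qed.

Lemma rad_sum w n (f : 'I_n -> F) : (forall i, rad w (f i)) -> rad w (\sum_(i < n) f i).
Proof. by move=> sf; elim/big_ind: _ => //; [apply: rad0|apply: radD]. Qed.

Lemma rad_scalar w c : G c -> eps c = 0 -> rad w c.
Proof. by move=> Gc ec; apply/rad_stab/stab_scalar. Qed.

Lemma rad_eps w t : 1 \in w -> rad w t -> eps t = 0.
Proof.
move=> w1 [_ [N /(_ 1 w1)]]; rewrite mulr1 => /span_eps.
by rewrite rmorphXn => /eqP; rewrite expf_eq0 => /andP[_ /eqP].
Qed.

Lemma rad_subX w t u n : stab w false t -> stab w false u -> rad w (t - u) ->
  rad w (t ^+ n - u ^+ n).
Proof.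
move=> st su r; rewrite subrXX mulrC; apply: radM => //.
by apply: stab_sum => i; apply: stabMf; apply: stabX.
Qed.

(** F itself may have any characteristic, but p is killed by eps and divides the inner binomial
    coefficients, so the p-th power map is additive modulo [rad w]. Iteration gives all powers Q. *)
Lemma rad_frobenius w t u Q : [pchar k].-nat Q -> stab w false t -> stab w false u ->
  rad w ((t + u) ^+ Q - (t ^+ Q + u ^+ Q)).
Proof.
move=> /pnat_expchar[j ->]; elim: j t u => [|j IH] t u st su.
  by rewrite expn0 !expr1 subrr; apply: rad0.
rewrite expnS !exprM; set p := expchar k in IH *.
have rp : rad w ((t + u) ^+ p - (t ^+ p + u ^+ p)).
  rewrite /p /expchar; case: xgetP => [q _ /= hq|_]; last by rewrite !expr1 subrr; apply: rad0.
  have pq := pcharf_prime hq; case: q pq hq => [//|[//|m]] pq hq.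
  rewrite exprDn big_ord_recl big_ord_recr /= bin0 binn !mulr1n subn0 subnn expr0 mulr1 mul1r.
  rewrite (_ : forall a b c : F, a + (c + b) - (a + b) = c); last by move=> *; ring.
  apply: rad_sum => i; rewrite /bump leq0n add1n.
  have /dvdnP[l ->] : (m.+2 %| 'C(m.+2, i.+1))%N by apply: prime_dvd_bin => //; have := ltn_ord
    i; lia.
  rewrite mulrnA -[_ *+ m.+2]mulr_natr; apply: radM.
    by apply: stabMn; apply: stabMf; apply: stabX.
  apply: rad_scalar; last by rewrite rmorph_nat (pcharf0 hq).
  by elim: (m.+2) => [|n IHn]; [apply: sub0|rewrite mulrS; apply: (subD hG) => //; apply: sub1].
have sp v : stab w false v -> stab w false (v ^+ p) by apply: stabX.
have := radD (rad_subX (p ^ j) (sp _ (stabD st su)) (stabD (sp _ st) (sp _ su)) rp)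
  (IH _ _ (sp _ st) (sp _ su)).
by rewrite addrA subrK.
Qed.

(* As [1] belongs to [w], the determinant trick turns [stab] into monic equations;
   for a fixed [w] the stable elements form a ring and [rad w] is an ideal of it,
   and any two families have a common refinement [prodw]. *)
Definition weakly_subintegral s := exists w, [/\ 1 \in w, stab w false s &
  exists Q c, [/\ [pchar k].-nat Q, G c & rad w (s ^+ Q - c)]].

Lemma wsi_sub c : G c -> weakly_subintegral c.
Proof.
move=> Gc; exists [:: 1]; split; first by rewrite mem_seq1.
  exact: stab_scalar.
by exists 1%N, c; split=> //; rewrite expr1 subrr; apply: rad0.
Qed.

Lemma wsi_common s t : weakly_subintegral s -> weakly_subintegral t -> exists w Q c d,
  [/\ 1 \in w, stab w false s, stab w false t, [pchar k].-nat Q & 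
   [/\ G c, G d, rad w (s ^+ Q - c) & rad w (t ^+ Q - d)]].
Proof.
move=> [w [w1 ss [Q [c [hQ Gc rc]]]]] [w' [w1' st [Q' [d [hQ' Gd rd]]]]].
(* Raising to the Q'-th, respectively Q-th, power brings both conditions to the exponent Q * Q'. *)
exists (prodw w w'), (Q * Q')%N, (c ^+ Q'), (d ^+ Q); split.
- exact: prodw1.
- exact: stab_prodl.
- exact: stab_prodr.
- by rewrite pnatM hQ.
split; try exact: (subX hG).
- apply: rad_prodl; rewrite exprM; apply: rad_subX => //; first exact: stabX.
  exact: stab_scalar.
- apply: rad_prodr; rewrite mulnC exprM; apply: rad_subX => //; first exact: stabX.
  exact: stab_scalar.
Qed.

Lemma wsi_ring : subring weakly_subintegral.
Proof.
have wnM a b : weakly_subintegral a -> weakly_subintegral b -> weakly_subintegral (a * b).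
  move=> wa wb; have [w [Q [c [d [w1 sa sb hQ [Gc Gd rc rd]]]]]] := wsi_common wa wb.
  exists w; split=> //; first exact: stabMf.
  exists Q, (c * d); split=> //; first exact: subM.
  rewrite exprMn (_ : _ - _ = a ^+ Q * (b ^+ Q - d) + d * (a ^+ Q - c)); last by ring.
  by apply: radD; apply: radM => //; [apply: stabX|apply: stab_scalar].
have wnD a b : weakly_subintegral a -> weakly_subintegral b -> weakly_subintegral (a + b).
  move=> wa wb; have [w [Q [c [d [w1 sa sb hQ [Gc Gd rc rd]]]]]] := wsi_common wa wb.
  exists w; split=> //; first exact: stabD.
  exists Q, (c + d); split=> //; first exact: subD.
  have := radD (rad_frobenius hQ sa sb) (radD rc rd).
  by congr (rad w _); ring.
split=> [|a b wa wb|]; [exact: wsi_sub (sub1 hG)| |exact: wnM].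
by rewrite -mulN1r; apply/wnD/wnM => //; apply: wsi_sub; apply: (subN hG); apply: sub1.
Qed.

Lemma wsi_monic s : weakly_subintegral s -> exists n (a : nat -> F),
  (forall i, G (a i)) /\ s ^+ n = \sum_(i < n) a i * s ^+ i.
Proof.
by move=> [w [w1 ss _]]; have [n [a [Ga _ e]]] := stab_monic w1 ss; exists n, a.
Qed.

(** The equational form: unlike a stable family, finitely many coefficients can be cleared of
    denominators or lifted along [pull]. [wsi_trans] goes back from equations to families. *)
Lemma wsi_poly s : weakly_subintegral s -> exists Q c N n (m : nat -> F),
  [/\ [pchar k].-nat Q, G c, forall i, G (m i), forall i, eps (m i) = 0 &
   ((s ^+ Q - c) ^+ N) ^+ n = \sum_(i < n) m i * ((s ^+ Q - c) ^+ N) ^+ i].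
Proof.
move=> [w [w1 ss [Q [c [hQ Gc [_ [N sN]]]]]]].
by have [n [m [Gm em e]]] := stab_monic w1 sN; exists Q, c, N, n, m; split=> //; apply: em.
Qed.

Lemma eps_monic0 t n (m : nat -> F) : (forall i, eps (m i) = 0) ->
  t ^+ n = \sum_(i < n) m i * t ^+ i -> eps t = 0.
Proof.
move=> em e; have : eps (t ^+ n) = 0.
  by rewrite e rmorph_sum big1 // => i _; rewrite rmorphM em mul0r.
by rewrite rmorphXn => /eqP; rewrite expf_eq0 => /andP[_ /eqP].
Qed.

Lemma wsi_poly_eps s Q c N n (m : nat -> F) : (forall i, eps (m i) = 0) ->
  ((s ^+ Q - c) ^+ N) ^+ n = \sum_(i < n) m i * ((s ^+ Q - c) ^+ N) ^+ i ->
  eps s ^+ Q = eps c.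
Proof.
move=> em /(eps_monic0 em) /eqP; rewrite rmorphXn expf_eq0 => /andP[_].
by rewrite rmorphB rmorphXn subr_eq0 => /eqP.
Qed.

Definition integral t := exists w, 1 \in w /\ stab w false t.

Lemma common_family (C : seq F -> nat -> Prop) n :
  (forall w w' i, C w i -> C (prodw w w') i) -> (forall w w' i, C w' i -> C (prodw w w') i) ->
  (forall i, (i < n)%N -> exists w, 1 \in w /\ C w i) ->
  exists w, 1 \in w /\ forall i, (i < n)%N -> C w i.
Proof.
move=> Cl Cr; elim: n => [|n IH] h; first by exists [:: 1]; rewrite mem_seq1.
have [w [w1 hw]] := IH (fun i hi => h i (ltnW hi)).
have [w' [w1' hw']] := h n (ltnSn n).
exists (prodw w w'); split; first exact: prodw1.
by move=> i; rewrite ltnS leq_eqVlt => /orP[/eqP ->|/hw]; [apply: Cr|apply: Cl].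
Qed.

Lemma integral_monic s n (a : nat -> F) : (forall i, (i < n)%N -> integral (a i)) ->
  s ^+ n = \sum_(i < n) a i * s ^+ i -> integral s.
Proof.
move=> ia e.
have [||//|W [W1 hW]] := @common_family (fun w i => stab w false (a i)) n.
- by move=> w w' i; apply: stab_prodl.
- by move=> w w' i; apply: stab_prodr.
(* The list runs up to s ^+ n inclusive, so it contains 1 also for n = 0. *)
have [w0 w0P] : exists w0, forall x, x \in w0 <-> exists2 i, (i <= n)%N & x = s ^+ i.
  exists [seq s ^+ i | i <- iota 0 n.+1] => x; split=> [/mapP[i hi ->]|[i hi ->]].
    by exists i => //; move: hi; rewrite mem_iota add0n ltnS.
  by apply: map_f; rewrite mem_iota add0n ltnS.
exists (prodw w0 W); split.
  by apply: prodw1 => //; apply/w0P; exists 0%N; rewrite ?expr0.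
move=> _ /allpairsP[[x v] /= [/w0P[i hi ->] vW ->]].
rewrite mulrA -exprS.
have sp j u : (j <= n)%N -> span W false u -> span (prodw w0 W) false (s ^+ j * u).
  by move=> hj hu; apply: span_prodr => //; apply/w0P; exists j.
move: hi; rewrite leq_eqVlt => /orP[/eqP ->|hi]; last first.
  by apply: sp => //; apply: span_mem.
(* Only the product s ^+ n.+1 leaves the list; the equation rewrites it through s ^+ j.+1 with j <
   n. *)
rewrite exprS e mulr_sumr mulr_suml.
elim/big_ind: _ => [|y z|j _]; [exact: SpanZero|exact: spanD|].
rewrite (_ : _ * v = s ^+ j.+1 * (a j * v)); last by rewrite exprS; ring.
by apply: sp => //; apply: hW.
Qed.

Lemma wsi_integral s : weakly_subintegral s -> integral s.
Proof. by move=> [w [w1 ss _]]; exists w. Qed.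

(** Meant for the case where (s ^+ Q - c) ^+ N is only known to lie in the extension of the maximal
    ideal. A family stable under s and all the e i turns this membership into stability with flag
    [true]. *)
Lemma wsi_criterion s Q c N n (m e : nat -> F) : [pchar k].-nat Q -> G c ->
  integral s -> (forall i, (i < n)%N -> integral (e i)) ->
  (forall i, G (m i)) -> (forall i, eps (m i) = 0) ->
  (s ^+ Q - c) ^+ N = \sum_(i < n) m i * e i -> weakly_subintegral s.
Proof.
move=> hQ Gc [w [w1 ss]] ie Gm em eN.
have [||//|W [W1 hW]] := @common_family (fun w i => stab w false (e i)) n.
- by move=> v v' i; apply: stab_prodl.
- by move=> v v' i; apply: stab_prodr.
have ss' : stab (prodw w W) false s by apply: stab_prodl.
exists (prodw w W); split=> //; first exact: prodw1.
exists Q, c; split=> //; split.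
  by apply: stabB; [apply: stabX|apply: stab_scalar].
exists N; rewrite eN; apply: stab_sum => i; rewrite mulrC; apply: stabMt.
  by apply: stab_prodr; apply: hW.
exact: stab_scalar.
Qed.

(* The polynomial satisfied by [u = s ^+ Q] takes a value invertible at [eps] for
   [u = 0], and this value is a multiple of [u]. *)
Lemma wsi_inv s : weakly_subintegral s -> eps s <> 0 ->
  exists s' d, [/\ weakly_subintegral s', G d, eps d <> 0 & s * s' = d].
Proof.
move=> ws es; have [Q [c [N [n [m [hQ Gc Gm em e]]]]]] := wsi_poly ws.
have ec : eps c <> 0.
  rewrite -(wsi_poly_eps em e) => /eqP; rewrite expf_eq0 => /andP[_ /eqP]; exact: es.
have wr := wsi_ring; have wc := wsi_sub Gc.
have hj j : exists h, weakly_subintegral h /\ (s ^+ Q - c) ^+ j - (- c) ^+ j = s ^+ Q * h.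
  rewrite subrXX opprK subrK; eexists; split; last reflexivity.
  apply: (sub_sum wr) => i; apply: (subM wr); apply: (subX wr).
    by apply: (subB wr) => //; apply: (subX wr).
  exact: (subN wr).
have {hj} [h hP] := choice hj.
pose d := - (((- c) ^+ N) ^+ n - \sum_(i < n) m i * ((- c) ^+ N) ^+ i).
have Q0 : (0 < Q)%N by case/andP: hQ.
exists (s ^+ Q.-1 * (h (N * n)%N - \sum_(i < n) m i * h (N * i)%N)), d; split.
- apply: (subM wr); first exact: (subX wr).
  apply: (subB wr); first by have [] := hP (N * n)%N.
  apply: (sub_sum wr) => i; apply: (subM wr); first exact: wsi_sub.
  by have [] := hP (N * i)%N.
- apply: (subN hG); apply: (subB hG); first by do 2 apply: (subX hG); apply: (subN hG).
  by apply: (sub_sum hG) => i; apply: (subM hG) => //; do 2 apply: (subX hG); apply: (subN hG).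
- rewrite /d rmorphN rmorphB rmorph_sum big1 ?subr0; last first.
    by move=> i _; rewrite rmorphM em mul0r.
  rewrite !rmorphXn rmorphN => /eqP; rewrite oppr_eq0 !expf_eq0 oppr_eq0 => /andP[_ /andP[_]].
  by move/eqP.
- rewrite mulrA -exprS prednK // mulrBr mulr_sumr.
  have [_ <-] := hP (N * n)%N.
  under eq_bigr => i _ do rewrite mulrCA -(hP _).2 mulrBr !exprM.
  by rewrite sumrB !exprM e /d; ring.
Qed.
End WeakNormality.

Section Transitivity.
Variables (F : comPzRingType) (k : fieldType) (eps : {rmorphism F -> k}) (G : set F).
Hypothesis hG : subring G.
Local Notation weakly_subintegral := (weakly_subintegral eps G).

(** From eps m = 0 follows eps c = 0, so c, then m ^+ Q, then m are in [rad]. *)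
Lemma wsi_rad m : weakly_subintegral m -> eps m = 0 -> exists w, 1 \in w /\ rad eps G w m.
Proof.
move=> [w [w1 sm [Q [c [hQ Gc rc]]]]] em; exists w; split=> //.
have Q0 : (0 < Q)%N by case/andP: hQ.
have ec : eps c = 0.
  have := rad_eps w1 rc; rewrite rmorphB rmorphXn em expr0n gtn_eqF // sub0r => /eqP.
  by rewrite oppr_eq0 => /eqP.
apply: (radX (n := Q)) => //; rewrite -[_ ^+ _](subrK c).
by apply: (radD hG) => //; apply: (rad_scalar hG).
Qed.

(** One family W serves s, c and all the m i. There the m i lie in [rad], hence so does s ^+ Q - c
    by its equation; replacing c by an element d of G costs the further exponent Q'. *)
Lemma wsi_trans s n (a : nat -> F) Q c N n' (m : nat -> F) :
  (forall i, weakly_subintegral (a i)) -> s ^+ n = \sum_(i < n) a i * s ^+ i ->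
  [pchar k].-nat Q -> weakly_subintegral c -> (forall i, weakly_subintegral (m i)) -> (forall i,
    eps (m i) = 0) ->
  ((s ^+ Q - c) ^+ N) ^+ n' = \sum_(i < n') m i * ((s ^+ Q - c) ^+ N) ^+ i -> weakly_subintegral
    s.
Proof.
move=> wa ea hQ [wc [wc1 sc [Q' [d [hQ' Gd rd]]]]] wm em et.
have [ws [ws1 ss]] : integral eps G s.
  by apply: (integral_monic hG (n := n) (a := a)) => // i _; apply: wsi_integral.
have [||i _|wM [wM1 hM]] := @common_family _ (fun w i => rad eps G w (m i)) n'.
- by move=> v v' i; apply: rad_prodl.
- by move=> v v' i; apply: rad_prodr.
- exact: wsi_rad.
pose W := prodw (prodw ws wc) wM.
have sW : stab eps G W false s by do 2 apply: stab_prodl.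
have cW : stab eps G W false c by apply: stab_prodl; apply: stab_prodr.
exists W; split=> //; first by do ?apply: prodw1.
exists (Q * Q')%N, d; split=> //; first by rewrite pnatM hQ.
have sT : stab eps G W false (s ^+ Q - c) by apply: (stabB hG) => //; apply: (stabX hG).
have rT : rad eps G W (s ^+ Q - c).
  apply: (radX (n := N)) => //; apply: (radX (n := n')); first exact: (stabX hG).
  rewrite et; apply: (rad_sum hG) => i; rewrite mulrC; apply: (radM hG).
    by do 2 apply: (stabX hG).
  by apply: rad_prodr; apply: hM.
rewrite exprM -[_ ^+ Q'](subrK (c ^+ Q')) -addrA; apply: (radD hG).
  by apply: (rad_subX hG) => //; apply: (stabX hG).
by apply: rad_prodl; apply: rad_prodr.
Qed.
End Transitivity.

(** * Values of sections of a scheme at its points *)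

Lemma open_local (T : topologicalType) (P : set T) :
  (forall x, P x -> exists V : opens T, oset V x /\ V `<=` P) -> open P.
Proof.
move=> h; rewrite openE => x /h[V [Vx VP]].
by rewrite /interior nbhsE; exists V => //; split=> //; apply: osetP.
Qed.

Lemma opIl (T : topologicalType) (U V : opens T) : opensI U V `<=` U.
Proof. by move=> x []. Qed.
Lemma opIr (T : topologicalType) (U V : opens T) : opensI U V `<=` V.
Proof. by move=> x []. Qed.

Section RingedSpaces.
Variable X : ringed_space.
Implicit Types U V W : opens X.

Lemma res_irr U V (h h' : V `<=` U) (s : sec U) : res h s = res h' s.
Proof. by rewrite (Prop_irrelevance h h'). Qed.

Lemma res2 U V W (h : V `<=` U) (h' : W `<=` V) (s : sec U) :
  res h' (res h s) = res (subset_trans h' h) s.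
Proof. exact: res_comp. Qed.

Lemma sec_eq_local U (s t : sec U) :
  (forall x, oset U x -> exists V (h : V `<=` U), oset V x /\ res h s = res h t) -> s = t.
Proof.
move=> st; pose I := {x : X | oset U x}.
have [|W hW] := @choice_ex I (opens X) (fun i V => exists h : V `<=` U,
    oset V (proj1_sig i) /\ res h s = res h t).
  by move=> -[x Ux]; have [V [h [Vx e]]] := st x Ux; exists V, h.
have hsub i : W i `<=` U by have [h _] := hW i.
have cov : U `<=` \bigcup_i W i.
  by move=> x Ux; exists (exist _ x Ux) => //; have [h []] := hW (exist _ x Ux).
have [|u [_ uniq]] := @res_glue X I U W hsub (fun i => res (hsub i) s) cov.
  by move=> i j; rewrite !res2; apply: res_irr.
rewrite -(uniq s) // -(uniq t) // => i.
by have [h [_ e]] := hW i; rewrite (res_irr _ h) -e; apply: res_irr.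
Qed.

Lemma unit_germ_res U V (h : V `<=` U) (s : sec U) x : oset V x ->
  unit_germ x (res h s) <-> unit_germ x s.
Proof.
move=> Vx; split=> [[W [hW [Wx [t e]]]]|[W [hW [Wx [t e]]]]].
  by exists W, (subset_trans hW h); split=> //; exists t; rewrite -e res2.
exists (opensI W V), (@opIr _ _ _); split=> //.
exists (res (@opIl _ W V) t); rewrite res2.
rewrite -(rmorph1 (res (@opIl _ W V))) -e rmorphM res2.
by congr (_ * _); apply: res_irr.
Qed.

Lemma unit_germM U (s t : sec U) x : unit_germ x (s * t) <-> unit_germ x s /\ unit_germ x t.
Proof.
split=> [[W [hW [Wx [u e]]]]|[[W [hW [Wx [u e]]]] [W' [hW' [Wx' [u' e']]]]]].
  split; exists W, hW; split=> //; [exists (res hW t * u)|exists (res hW s * u)].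
    by rewrite mulrA -rmorphM.
  by rewrite mulrA -rmorphM [t * s]mulrC.
have hU : opensI W W' `<=` U by move=> y [/hW].
exists (opensI W W'), hU; split=> //.
exists (res (@opIl _ W W') u * res (@opIr _ W W') u').
rewrite rmorphM mulrACA -[res hU s](res_comp hW (@opIl _ W W')).
rewrite -[res hU t](res_comp hW' (@opIr _ W W')) -!rmorphM e e' !rmorph1.
exact: mulr1.
Qed.

Lemma unit_germ_in U (s : sec U) x : unit_germ x s -> oset U x.
Proof. by move=> [V [h [/h]]]. Qed.

Lemma unit_germ_open U (s : sec U) : open [set x : X | unit_germ x s].
Proof.
apply: open_local => x [V [h [Vx [t e]]]]; exists V; split=> // y Vy.
by exists V, h; split=> //; exists t.
Qed.

Definition unit_opens U (s : sec U) : opens X := Opens (unit_germ_open s).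

Lemma mul_unit_inj U (s t u v : sec U) : s * t = 1 -> u * s = v * s -> u = v.
Proof. by move=> st e; rewrite -[u]mulr1 -[v]mulr1 -st !mulrA e. Qed.

(** Local inverses agree on overlaps because inverses are unique, hence they glue. *)
Lemma unit_section U (s : sec U) : (forall x, oset U x -> unit_germ x s) ->
  exists t, s * t = 1.
Proof.
move=> us; pose I := {x : X | oset U x}.
have [|W hW] := @choice_ex I (opens X) (fun i V => exists h : V `<=` U,
    oset V (proj1_sig i) /\ exists t : sec V, res h s * t = 1).
  by move=> -[x Ux]; have [V [h [Vx e]]] := us x Ux; exists V, h.
have hsub i : W i `<=` U by have [h _] := hW i.
have [|t tP] := @choice_dfun I (fun i => sec (W i)) (fun i t => res (hsub i) s * t = 1).
  by move=> i; have [h [_ [u e]]] := hW i; exists u; rewrite (res_irr _ h).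
have cov : U `<=` \bigcup_i W i.
  by move=> x Ux; exists (exist _ x Ux) => //; have [h []] := hW (exist _ x Ux).
have [|u [hu _]] := @res_glue X I U W hsub t cov.
  move=> i j.
  have hij : opensI (W i) (W j) `<=` U by move=> y [/hsub].
  have e1 : res hij s * res (@opIl _ (W i) (W j)) (t i) = 1.
    by rewrite -(res_comp (hsub i) (@opIl _ (W i) (W j))) -rmorphM tP rmorph1.
  have e2 : res hij s * res (@opIr _ (W i) (W j)) (t j) = 1.
    by rewrite -(res_comp (hsub j) (@opIr _ (W i) (W j))) -rmorphM tP rmorph1.
  rewrite (res_irr _ (@opIl _ (W i) (W j))) [RHS](res_irr _ (@opIr _ (W i) (W j))).
  by apply: (mul_unit_inj e1); rewrite mulrC e1 mulrC e2.
exists u; apply: sec_eq_local => x Ux; have [i _ Wi] := cov _ Ux.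
by exists (W i), (hsub i); split=> //; rewrite rmorphM hu tP rmorph1.
Qed.

End RingedSpaces.

Lemma sharp_unit (X Y : ringed_space) (f : lrs_hom X Y) (V : opens Y) (s : sec V) x :
  unit_germ (base f x) s -> unit_germ x (sharp f V s).
Proof.
move=> [W [h [Wx [t e]]]].
have h' : preim (base_cont f) W `<=` preim (base_cont f) V by move=> y /h.
exists (preim (base_cont f) W), h'; split=> //; exists (sharp f W t).
by rewrite (sharp_nat h h') -rmorphM e rmorph1.
Qed.

Lemma openD (A : comPzRingType) (f : A) : open (Dset f).
Proof.
exists [set f]; apply/seteqP; split=> P /= Pf; first by move=> /(_ f erefl).
by move=> Pf'; apply: Pf => _ ->.
Qed.

Lemma open_basic (A : comPzRingType) (W : set (prime_ideal A)) P : open W -> W P ->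
  exists f, ~ pideal P f /\ Dset f `<=` W.
Proof.
move=> [E ->] /= /existsNP[f /not_implyP[Ef Pf]]; exists f; split=> // Q /= Qf QE.
exact/Qf/QE.
Qed.

Section Chart.
Variables (X : ringed_space) (A : comPzRingType) (psi : prime_ideal A -> X).
Variables (U : opens X) (iota : {rmorphism A -> sec U}).
Hypothesis hc : is_affine_chart psi iota.

Lemma chart_range : range psi = U :> set X. Proof. by case: hc. Qed.

Lemma chart_in P : oset U (psi P).
Proof. by rewrite -chart_range; exists P. Qed.

Lemma chart_inj : injective psi. Proof. by case: hc. Qed.

Lemma chart_surj x : oset U x -> exists P, psi P = x.
Proof. by rewrite -chart_range => -[P _ <-]; exists P. Qed.

Definition chartD (f : A) : opens X.
Proof. by exists (psi @` Dset f); case: hc => _ _ _ h _; apply/h/openD. Defined.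

Lemma chartD_sub f : chartD f `<=` U.
Proof. by move=> _ [P _ <-]; apply: chart_in. Qed.

Lemma chartD_in f P : oset (chartD f) (psi P) <-> ~ pideal P f.
Proof. by split=> [[Q Qf /chart_inj <-]|Pf] //; exists P. Qed.

Lemma chart_nbhd (V : opens X) P : oset V (psi P) ->
  exists f, ~ pideal P f /\ chartD f `<=` V.
Proof.
move=> VP; case: hc => _ _ ct _ _.
have [f [Pf sub]] := open_basic (ct V (osetP V)) VP.
by exists f; split=> // _ [Q Qf <-]; apply: sub.
Qed.

Lemma chart_loc f : is_localization f (res (@chartD_sub f) \o iota : {rmorphism A -> sec (chartD
  f)}).
Proof. by case: hc => _ _ _ _; apply. Qed.

(** An inverse of a near psi P has the form b / f ^+ n on a basic open set, so a power of f is a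
    multiple of a, while f is outside of P. *)
Lemma chart_unit P (a : A) : unit_germ (psi P) (iota a) <-> ~ pideal P a.
Proof.
split=> [[V [hV [Vx [t e]]]] Pa|Pa]; last first.
  have [[t e] _ _] := chart_loc a; exists (chartD a), (@chartD_sub a).
  by split; [apply/chartD_in|exists t].
have [f [Pf hf]] := chart_nbhd Vx.
have [[i fi] frac ker] := chart_loc f.
have [n [b eb]] := frac (res hf t).
have [|m em] := ker (a * b - f ^+ n).
  rewrite rmorphB rmorphM rmorphXn -eb /= mulrA -{1}(res_comp hV hf) -rmorphM e.
  by rewrite rmorph1 mul1r subrr.
apply: (Pf); apply: (@pidealX _ _ _ (n + m)); rewrite exprD.
rewrite (_ : f ^+ n * f ^+ m = a * (b * f ^+ m)); first exact: pidealMr.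
by apply/eqP; rewrite mulrA -subr_eq0 -mulrBl -opprB mulNr em oppr0.
Qed.

(* [v] is the value [a / f] at [psi P] of a section which near [psi P] satisfies
   [s * f = a]. *)
Definition chart_value P V (s : sec V) (v : resfield P) := exists f a (W : opens X)
  (hV : W `<=` V) (hU : W `<=` U), [/\ oset W (psi P), ~ pideal P f,
  res hV s * res hU (iota f) = res hU (iota a) & v * rval P f = rval P a].

Lemma chart_ker P (W : opens X) (hU : W `<=` U) a : oset W (psi P) ->
  res hU (iota a) = 0 -> pideal P a.
Proof.
move=> Wx e; apply: contrapT => /chart_unit/(unit_germ_res hU (iota a) Wx); rewrite e.
move=> [V [h [Vx [t]]]]; rewrite rmorph0 mul0r => /esym e1.
have : ~ pideal P 1 by exact: pideal1.
apply; apply: contrapT => P1.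
have [f [Pf hf]] := chart_nbhd Vx.
have [_ _ /(_ 1)[|n]] := chart_loc f.
  by rewrite rmorph1 -(rmorph1 (res hf)) e1 rmorph0.
by rewrite mul1r => secfun; apply: Pf; apply: (@pidealX _ _ _ n); rewrite secfun; apply: pideal0.
Qed.

Lemma chart_value_fun P V (s : sec V) v v' :
  chart_value s v -> chart_value s v' -> v = v' :> resfield P.
Proof.
move=> [f [a [W [hV [hU [Wx Pf e ev]]]]]] [f' [a' [W' [hV' [hU' [Wx' Pf' e' ev']]]]]].
have hI : opensI W W' `<=` U by move=> y [/hU].
have IV : opensI W W' `<=` V by move=> y [/hV].
have {}e : res IV s * res hI (iota f) = res hI (iota a).
  by have := congr1 (res (@opIl _ W W')) e; rewrite rmorphM !res2 !(res_irr _ IV) !(res_irr _ hI).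
have {}e' : res IV s * res hI (iota f') = res hI (iota a').
  by have := congr1 (res (@opIr _ W W')) e'; rewrite rmorphM !res2 !(res_irr _ IV) !(res_irr _
    hI).
have : pideal P (a * f' - a' * f).
  by apply: (@chart_ker P (opensI W W') hI) => //; rewrite !(rmorphB, rmorphM) -e -e' /=; ring.
move/rval_eq0; rewrite !(rmorphB, rmorphM) /= -ev -ev'.
have rf : rval P f != 0 by apply/eqP => /rval_eq0.
have rf' : rval P f' != 0 by apply/eqP => /rval_eq0.
move=> /eqP; rewrite mulrAC -mulrBl -mulrBl !mulf_eq0 subr_eq0 (negbTE rf) (negbTE rf') !orbF.
by move/eqP.
Qed.

Lemma chart_value_res P V (s : sec V) (v : resfield P) (V' : opens X) (h : V' `<=` V) : oset V'
  (psi P) ->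
  chart_value (res h s) v <-> chart_value s v.
Proof.
move=> Vx; split=> [[f [a [W [hV [hU [Wx Pf e ev]]]]]]|[f [a [W [hV [hU [Wx Pf e ev]]]]]]].
  by exists f, a, W, (subset_trans hV h), hU; split=> //; rewrite -e res2.
exists f, a, (opensI W V'), (@opIr _ _ _), (subset_trans (@opIl _ W V') hU); split=> //.
by rewrite res2 -!(res2 _ (@opIl _ W V')) -e rmorphM (res2 hV); congr (_ * _); apply: res_irr.
Qed.

Lemma chart_frac P V (s : sec V) : oset V (psi P) -> exists v : resfield P, chart_value s v.
Proof.
move=> /chart_nbhd[f [Pf hf]]; have [_ frac _] := chart_loc f.
have [n [a e]] := frac (res hf s).
exists (rval P a / rval P (f ^+ n)), (f ^+ n), a, (chartD f), hf, (@chartD_sub f); split.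
- exact/chartD_in.
- by move=> /pidealX.
- by rewrite rmorphXn rmorphXn; exact: e.
- by rewrite mulfVK //; apply/eqP => /rval_eq0 /pidealX.
Qed.

Lemma chart_value1 P V : oset V (psi P) -> chart_value (1 : sec V) (1 : resfield P).
Proof.
move=> Vx; exists 1, 1, (opensI V U), (@opIl _ _ _), (@opIr _ _ _); split=> //.
- by split=> //; apply: chart_in.
- exact: pideal1.
- by rewrite !rmorph1 mul1r.
- by rewrite rmorph1 mul1r.
Qed.

Lemma chart_value2 P V (s t : sec V) (v u : resfield P) : chart_value s v -> chart_value t u ->
  chart_value (s - t) (v - u) /\ chart_value (s * t) (v * u).
Proof.
move=> [f [a [W [hV [hU [Wx Pf e ev]]]]]] [f' [a' [W' [hV' [hU' [Wx' Pf' e' ev']]]]]].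
have hI : opensI W W' `<=` U by move=> y [/hU].
have IV : opensI W W' `<=` V by move=> y [/hV].
have {}e : res IV s * res hI (iota f) = res hI (iota a).
  by have := congr1 (res (@opIl _ W W')) e; rewrite rmorphM !res2 !(res_irr _ IV) !(res_irr _ hI).
have {}e' : res IV t * res hI (iota f') = res hI (iota a').
  by have := congr1 (res (@opIr _ W W')) e'; rewrite rmorphM !res2 !(res_irr _ IV) !(res_irr _
    hI).
split.
  exists (f * f'), (a * f' - a' * f), (opensI W W'), IV, hI; split=> //.
  - exact: pidealMN.
  - by rewrite !(rmorphB, rmorphM) -e -e' /=; ring.
  - by rewrite !(rmorphB, rmorphM) /= -ev -ev'; ring.
exists (f * f'), (a * a'), (opensI W W'), IV, hI; split=> //.
- exact: pidealMN.
- by rewrite !rmorphM -e -e' /=; ring.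
- by rewrite !rmorphM /= -ev -ev'; ring.
Qed.

Lemma chart_value_unit P V (s : sec V) (v : resfield P) : oset V (psi P) ->
  chart_value s v -> v <> 0 <-> unit_germ (psi P) s.
Proof.
move=> Vx [f [a [W [hV [hU [Wx Pf e ev]]]]]].
have rf : rval P f != 0 by apply/eqP => /rval_eq0.
have -> : v <> 0 <-> ~ pideal P a.
  split=> [v0 /rval_eq0|Pa v0]; last by apply/Pa/rval_eq0; rewrite -ev v0 mul0r.
  by rewrite -ev => /eqP; rewrite mulf_eq0 (negbTE rf) orbF => /eqP.
rewrite -chart_unit -(unit_germ_res hU) // -e unit_germM unit_germ_res // unit_germ_res //.
by split=> [[]|] // us; split=> //; apply/chart_unit.
Qed.

Lemma chart_value_surj P (v : resfield P) : exists V (s : sec V), oset V (psi P) /\ chart_value s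
  v.
Proof.
have [a [f [Pf ev]]] := rval_surj v; have [[t e] _ _] := chart_loc f.
exists (chartD f), (t * res (@chartD_sub f) (iota a)); split; first exact/chartD_in.
exists f, a, (chartD f), (@subset_refl _ _), (@chartD_sub f); split=> //.
  exact/chartD_in.
by rewrite res_id mulrAC [t * _]mulrC e mul1r.
Qed.

End Chart.

Section Points.
Variable X : scheme.
Implicit Types (U V W : opens X) (x : X).

(** The residue field at x is read off from one chosen chart; outside of this section it is handled
    through the values [kappa_val] of sections. *)
Record chart_at x := ChartAt {
  ca_U : opens X; ca_A : comPzRingType; ca_psi : prime_ideal ca_A -> X;
  ca_iota : {rmorphism ca_A -> sec ca_U}; ca_P : prime_ideal ca_A;
  ca_chart : is_affine_chart ca_psi ca_iota; ca_x : ca_psi ca_P = x }.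

Arguments ca_psi {x} c P : rename.
Arguments ca_iota {x} c : rename.

Lemma chart_at_inhabited x : inhabited (chart_at x).
Proof.
have [U [A [psi [iota [Ux hc]]]]] := affine_cover x.
have [P hP] := chart_surj hc Ux.
by constructor; exact: (ChartAt hc hP).
Qed.

Definition pick_chart x : chart_at x := inhabited_witness (chart_at_inhabited x).

Definition kappa x : fieldType := resfield (ca_P (pick_chart x)).

(** The default 0 outside of V makes the value additive and multiplicative at every point. *)
Definition kappa_val V (s : sec V) x : kappa x :=
  xget 0 [set v : kappa x | chart_value (ca_psi (pick_chart x)) (ca_iota (pick_chart x)) s v].

Let CV x V (s : sec V) (v : kappa x) :=
  chart_value (ca_psi (pick_chart x)) (ca_iota (pick_chart x)) s v.

Let psiP x : ca_psi (pick_chart x) (ca_P (pick_chart x)) = x.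
Proof. exact: ca_x. Qed.

Let psiV x V : oset V x -> oset V (ca_psi (pick_chart x) (ca_P (pick_chart x))).
Proof. by rewrite psiP. Qed.

Let kappa_valP V (s : sec V) x : oset V x -> CV s (kappa_val s x).
Proof.
move=> Vx; rewrite /kappa_val; case: xgetP => // no.
by have [v hv] := chart_frac (ca_chart (pick_chart x)) s (psiV Vx); case: (no v).
Qed.

Let CVin x V (s : sec V) (v : kappa x) : CV s v -> oset V x.
Proof. by move=> [f [a [W [hV [hU []]]]]]; rewrite psiP => /hV. Qed.

Let CVE x V (s : sec V) (v : kappa x) : CV s v -> kappa_val s x = v.
Proof.
move=> hv; apply: (chart_value_fun (ca_chart (pick_chart x)) _ hv).
exact/kappa_valP/(CVin hv).
Qed.

Lemma kappa_val_out V (s : sec V) x : ~ oset V x -> kappa_val s x = 0.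
Proof. by move=> Vx; rewrite /kappa_val; case: xgetP => // v _ /CVin. Qed.

Lemma kappa_valB V (s t : sec V) x : kappa_val (s - t) x = kappa_val s x - kappa_val t x.
Proof.
have [Vx|Vx] := pselect (oset V x); last by rewrite !kappa_val_out // subr0.
by apply: CVE; apply: (chart_value2 _ _).1; apply: kappa_valP.
Qed.

Lemma kappa_valM V (s t : sec V) x : kappa_val (s * t) x = kappa_val s x * kappa_val t x.
Proof.
have [Vx|Vx] := pselect (oset V x); last by rewrite !kappa_val_out // mulr0.
by apply: CVE; apply: (chart_value2 _ _).2; apply: kappa_valP.
Qed.

Lemma kappa_val1 V x : oset V x -> kappa_val (1 : sec V) x = 1.
Proof. by move=> Vx; apply: CVE; apply: (chart_value1 (ca_chart _)); apply: psiV. Qed.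

Lemma kappa_val_res U V (h : V `<=` U) (s : sec U) x : oset V x -> kappa_val (res h s) x =
  kappa_val s x.
Proof.
move=> Vx; apply: CVE; have := kappa_valP s (h x Vx); exact: (chart_value_res _ _ _ _ (psiV
  Vx)).2.
Qed.

Lemma kappa_val_unit V (s : sec V) x : oset V x -> kappa_val s x <> 0 <-> unit_germ x s.
Proof.
move=> Vx; have := chart_value_unit (ca_chart (pick_chart x)) (psiV Vx) (kappa_valP s Vx).
by rewrite psiP.
Qed.

Lemma kappa_val_surj x (v : kappa x) : exists V (s : sec V), oset V x /\ v = kappa_val s x.
Proof.
have [V [s [Vx cv]]] := chart_value_surj (ca_chart (pick_chart x)) v.
by exists V, s; split; [rewrite -(psiP x)|rewrite (CVE cv)].
Qed.

Definition perf_kappa x : fieldType := perfcl (kappa x).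

Definition secfun V (s : sec V) : dfun perf_kappa := fun x => pemb (kappa_val s x).

Lemma secfun_out V (s : sec V) x : ~ oset V x -> secfun s x = 0.
Proof. by move=> Vx; rewrite /secfun kappa_val_out // rmorph0. Qed.

Lemma secfunB V (s t : sec V) : secfun (s - t) = secfun s - secfun t.
Proof. by apply: dfunP => x; rewrite dfunB /secfun kappa_valB rmorphB. Qed.

Lemma secfunM V (s t : sec V) : secfun (s * t) = secfun s * secfun t.
Proof. by apply: dfunP => x; rewrite dfunM /secfun kappa_valM rmorphM. Qed.

Lemma secfun1 V x : oset V x -> secfun (1 : sec V) x = 1.
Proof. by move=> Vx; rewrite /secfun kappa_val1 // rmorph1. Qed.

Lemma secfun0 V : secfun (0 : sec V) = 0.
Proof. by rewrite -(subrr 0) secfunB subrr. Qed.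

Lemma secfunN V (s : sec V) : secfun (- s) = - secfun s.
Proof. by rewrite -sub0r secfunB secfun0 sub0r. Qed.

Lemma secfunD V (s t : sec V) : secfun (s + t) = secfun s + secfun t.
Proof. by rewrite -[t in LHS]opprK secfunB secfunN opprK. Qed.

(** The exponent is positive because 0-th powers disagree outside of V: there the section 1 has
    value 0. *)
Lemma secfunX V (s : sec V) n : secfun (s ^+ n.+1) = secfun s ^+ n.+1.
Proof. by elim: n => [|n IH]; [rewrite !expr1|rewrite exprS secfunM IH [in RHS]exprS]. Qed.

Lemma secfunX_in V (s : sec V) n x : oset V x -> secfun (s ^+ n) x = secfun s x ^+ n.
Proof.
by move=> Vx; case: n => [|n]; [rewrite !expr0 secfun1|rewrite secfunX dfunX].
Qed.

Lemma secfun_sum V n (F : 'I_n -> sec V) : secfun (\sum_(i < n) F i) = \sum_(i < n) secfun (F i).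
Proof. exact: (big_morph _ (@secfunD V) (@secfun0 V)). Qed.

Lemma secfun_res U V (h : V `<=` U) (s : sec U) x : oset V x -> secfun (res h s) x = secfun s x.
Proof. by move=> Vx; rewrite /secfun kappa_val_res. Qed.

Lemma secfun_unit V (s : sec V) x : secfun s x <> 0 <-> unit_germ x s.
Proof.
have [Vx|Vx] := pselect (oset V x); last first.
  by split=> [|/unit_germ_in //]; rewrite secfun_out.
by rewrite -kappa_val_unit // /secfun; split=> h e; apply: h; [rewrite e rmorph0|apply/eqP;
  move/eqP: e; rewrite fmorph_eq0].
Qed.

Lemma secfun_in V (s : sec V) x : secfun s x <> 0 -> oset V x.
Proof. by move=> /secfun_unit/unit_germ_in. Qed.

Lemma unit_opensP V (s : sec V) x : oset (unit_opens s) x <-> secfun s x <> 0.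
Proof. by rewrite secfun_unit. Qed.

Lemma unit_opens_sub V (s : sec V) : unit_opens s `<=` V.
Proof. by move=> x /unit_germ_in. Qed.

Lemma perf_kappa_root x (v : perf_kappa x) Q : [pchar perf_kappa x].-nat Q -> exists u :
  perf_kappa x, u ^+ Q = v.
Proof.
rewrite (eq_pnat _ (fmorph_pchar (@pemb (kappa x)))) => /pnat_expchar[k ->].
exact: perfcl_root.
Qed.

Lemma perf_kappa_secfun x (v : perf_kappa x) : exists Q V (s : sec V),
  [/\ [pchar perf_kappa x].-nat Q, oset V x & v ^+ Q = secfun s x].
Proof.
have [k [a e]] := perfcl_pow v; have [V [s [Vx as_]]] := kappa_val_surj a.
exists (expchar (kappa x) ^ k)%N, V, s; split=> //; last by rewrite e as_.
rewrite (eq_pnat _ (fmorph_pchar (@pemb (kappa x)))); exact: expchar_pnat.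
Qed.

(** A Frobenius power of each element is the value of a section, and Frobenius powers are injective
    on L. *)
Lemma perf_kappa_uniq x (L : fieldType) (phi phi' : {rmorphism perf_kappa x -> L}) :
  (forall V (s : sec V), oset V x -> phi (secfun s x) = phi' (secfun s x)) -> phi =1 phi'.
Proof.
move=> h v; have [Q [V [s [hQ Vx e]]]] := perf_kappa_secfun v.
apply: (@expr_pnat_inj L Q); first by rewrite (eq_pnat _ (fmorph_pchar phi)).
by rewrite -!rmorphXn e h.
Qed.

Lemma kappa_val_surj2 x (v u : kappa x) : exists V (s t : sec V), [/\ oset V x, v = kappa_val s x
  & u = kappa_val t x].
Proof.
have [V [s [Vx ->]]] := kappa_val_surj v; have [W [t [Wx ->]]] := kappa_val_surj u.
exists (opensI V W), (res (@opIl _ _ _) s), (res (@opIr _ _ _) t).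
by split=> //; rewrite kappa_val_res.
Qed.

End Points.

(** * Residue field extensions induced by a morphism *)

Section ResidueMaps.
Variables (Z W : scheme) (f : lrs_hom Z W) (z : Z).

(** Locality of f is what counts: a - b is no unit at f z, so its pullback is no unit at z and has
    value 0. *)
Lemma kappa_val_sharp_eq V V' (a : sec V) (b : sec V') : oset V (f z) -> oset V' (f z) ->
  kappa_val a (f z) = kappa_val b (f z) -> kappa_val (sharp f V a) z = kappa_val (sharp f V' b) z.
Proof.
move=> Vx Vx' e; pose I := opensI V V'.
have hl : preim (base_cont f) I `<=` preim (base_cont f) V by move=> y [].
have hr : preim (base_cont f) I `<=` preim (base_cont f) V' by move=> y [].
have Iz : oset (preim (base_cont f) I) z by [].
rewrite -(kappa_val_res hl) // -(kappa_val_res hr) //.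
rewrite (sharp_nat (@opIl _ V V') hl) (sharp_nat (@opIr _ V V') hr).
apply/eqP; rewrite -subr_eq0 -kappa_valB -rmorphB; apply/eqP; apply: contrapT.
move/(kappa_val_unit _ Iz)/sharp_local => /(_ Iz)/kappa_val_unit; apply=> //.
by rewrite kappa_valB !kappa_val_res // e subrr.
Qed.

Lemma kappa_map_ex : exists phi : {rmorphism kappa (f z) -> kappa z},
  forall V (a : sec V), oset V (f z) -> phi (kappa_val a (f z)) = kappa_val (sharp f V a) z.
Proof.
have [|phi hphi] := @choice_ex (kappa (f z)) (kappa z) (fun v u => forall V (a : sec V),
    oset V (f z) -> v = kappa_val a (f z) -> u = kappa_val (sharp f V a) z).
  move=> v; have [V [a [Vx ->]]] := kappa_val_surj v.
  by exists (kappa_val (sharp f V a) z) => V' a' Vx' e; apply: kappa_val_sharp_eq.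
have phiE V (a : sec V) : oset V (f z) -> phi (kappa_val a (f z)) = kappa_val (sharp f V a) z.
  by move=> Vx; apply: hphi.
have phiB : zmod_morphism phi.
  move=> v u; have [V [s [t [Vx -> ->]]]] := kappa_val_surj2 v u.
  by rewrite -kappa_valB !phiE // rmorphB kappa_valB.
have phiM : monoid_morphism phi.
  split=> [|v u].
    have [V [s [Vx _]]] := kappa_val_surj (1 : kappa (f z)).
    by rewrite -(kappa_val1 Vx) phiE // rmorph1 kappa_val1.
  have [V [s [t [Vx -> ->]]]] := kappa_val_surj2 v u.
  by rewrite -kappa_valM !phiE // rmorphM kappa_valM.
pose p1 := GRing.isZmodMorphism.Build _ _ phi phiB.
pose p2 := GRing.isMonoidMorphism.Build _ _ phi phiM.
pose phi' : {rmorphism kappa (f z) -> kappa z} := HB.pack phi p1 p2.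
by exists phi'.
Qed.

Definition kappa_map : {rmorphism kappa (f z) -> kappa z} := projT1 (cid kappa_map_ex).
Definition kmap : {rmorphism perf_kappa (f z) -> perf_kappa z} := pmap kappa_map.

Lemma kmapE V (a : sec V) : kmap (secfun a (f z)) = secfun (sharp f V a) z.
Proof.
have [Vx|Vx] := pselect (oset V (f z)); last by rewrite !secfun_out // rmorph0.
by rewrite [LHS]pmap_emb (projT2 (cid kappa_map_ex) V a Vx).
Qed.

Lemma kmap_eq0 v : kmap v = 0 -> v = 0.
Proof. by move/eqP; rewrite fmorph_eq0 => /eqP. Qed.

Lemma kmap_inj : injective kmap. Proof. exact: fmorph_inj. Qed.

End ResidueMaps.

(** * Affine open subsets *)

Lemma prime_ideal_eq (A : comPzRingType) (P Q : prime_ideal A) :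
  (forall a, pideal P a <-> pideal Q a) -> P = Q.
Proof.
case: P Q => [P P0 PD PM P1 PP] [Q Q0 QD QM Q1 QP] /= e.
have {}e : P = Q by apply/seteqP; split=> a /e.
by subst Q; congr PrimeIdeal; apply: Prop_irrelevance.
Qed.

Program Definition comap (A B : comPzRingType) (phi : {rmorphism A -> B}) (P : prime_ideal B) :
  prime_ideal A := @PrimeIdeal A [set a | pideal P (phi a)] _ _ _ _ _.
Next Obligation. by move=> A B phi P /=; rewrite rmorph0; apply: pideal0. Qed.
Next Obligation. by move=> A B phi P a b /= h h'; rewrite rmorphD; apply: pidealD. Qed.
Next Obligation. by move=> A B phi P a b /= h; rewrite rmorphM; apply: pidealM. Qed.
Next Obligation. by move=> A B phi P /=; rewrite rmorph1; apply: pideal1. Qed.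
Next Obligation. by move=> A B phi P a b /=; rewrite rmorphM => /pideal_prime. Qed.

Program Definition ker_ideal (A : comPzRingType) (k : fieldType) (phi : {rmorphism A -> k}) :
  prime_ideal A := @PrimeIdeal A [set a | phi a = 0] _ _ _ _ _.
Next Obligation. by move=> A k phi /=; rewrite rmorph0. Qed.
Next Obligation. by move=> A k phi a b /= h h'; rewrite rmorphD h h' addr0. Qed.
Next Obligation. by move=> A k phi a b /= h; rewrite rmorphM h mulr0. Qed.
Next Obligation. by move=> A k phi /=; rewrite rmorph1 => /eqP; rewrite oner_eq0. Qed.
Next Obligation.
by move=> A k phi a b /=; rewrite rmorphM => /eqP; rewrite mulf_eq0 => /orP[]/eqP; [left|right].
Qed.

Section AffineOpens.
Variable X : scheme.
Implicit Types (U V W : opens X) (x : X).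

Program Definition point_ideal U x (Ux : oset U x) : prime_ideal (sec U) :=
  @PrimeIdeal (sec U) [set s | secfun s x = 0] _ _ _ _ _.
Next Obligation. by move=> U x Ux /=; rewrite secfun0. Qed.
Next Obligation. by move=> U x Ux a b /= h h'; rewrite secfunD dfunD h h' addr0. Qed.
Next Obligation. by move=> U x Ux a b /= h; rewrite secfunM dfunM h mulr0. Qed.
Next Obligation. by move=> U x Ux /=; rewrite secfun1 // => /eqP; rewrite oner_eq0. Qed.
Next Obligation.
move=> U x Ux a b /=; rewrite secfunM dfunM => /eqP; rewrite mulf_eq0.
by move=> /orP[]/eqP; [left|right].
Qed.

(** An intrinsic substitute for an affine chart, phrased with values of sections, so that it passes
    to basic open subsets without transport along ring isomorphisms. *)
Definition affine_open U : Prop :=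
 [/\ forall P : prime_ideal (sec U), exists x, oset U x /\ forall s, pideal P s <-> secfun s x =
   0,
     forall x y, oset U x -> oset U y ->
       (forall s : sec U, secfun s x = 0 <-> secfun s y = 0) -> x = y,
     forall x V, oset U x -> oset V x ->
       exists s : sec U, secfun s x <> 0 /\ forall y, secfun s y <> 0 -> oset V y
   & forall (f : sec U) V (h : V `<=` U), (forall x, oset V x <-> secfun f x <> 0) ->
       is_localization f (res h)].

Lemma not_secfun_unit V (s : sec V) x : secfun s x = 0 <-> ~ unit_germ x s.
Proof.
by split=> [e /secfun_unit //|u]; apply: contrapT => /secfun_unit.
Qed.

Lemma is_localization_comp (A B C : comPzRingType) (i : {rmorphism A -> B})
    (phi : {rmorphism B -> C}) (a : A) :
  (forall b, exists a, b = i a) -> (forall a, i a = 0 -> a = 0) ->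
  is_localization a (phi \o i : {rmorphism A -> C}) -> is_localization (i a) phi.
Proof.
move=> isurj iinj [hu hf hk]; split=> //.
- by move=> b; have [n [c e]] := hf b; exists n, (i c).
- move=> b; have [c ->] := isurj b => /hk[n e]; exists n.
  by rewrite -rmorphXn -rmorphM e rmorph0.
Qed.

Lemma affine_open_chart (A : comPzRingType) (psi : prime_ideal A -> X) U
    (iota : {rmorphism A -> sec U}) : is_affine_chart psi iota -> affine_open U.
Proof.
move=> hc; have [_ _ _ _ hl] := hc.
(* As U is the basic open set of 1, [iota] is a localization at 1, hence bijective. *)
have D1 : psi @` Dset 1 = U :> set X.
  rewrite -(chart_range hc); apply/seteqP; split=> _ [P _ <-]; exists P => //.
  exact: pideal1.
have [_ is1 ii1] := hl 1 U (@subset_refl _ _) D1.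
have isurj b : exists a, b = iota a.
  have [n [a]] := is1 b; rewrite /= !res_id !rmorph1 expr1n mulr1 => ->.
  by exists a.
have iinj a : iota a = 0 -> a = 0.
  by move=> e; have [|n] := ii1 a; rewrite /= ?res_id // expr1n mulr1.
split.
- move=> P; exists (psi (comap iota P)); split; first exact: (chart_in hc).
  move=> s; have [a ->] := isurj s; rewrite not_secfun_unit (chart_unit hc) /=.
  by split=> [Pa|/contrapT].
- move=> x y /(chart_surj hc)[P <-] /(chart_surj hc)[Q <-] e; congr psi.
  apply: prime_ideal_eq => a; have := e (iota a); rewrite !not_secfun_unit !(chart_unit hc).
  by move=> [h h']; split=> Pa; [apply: contrapT; apply: h|apply: contrapT; apply: h'].
- move=> x V /(chart_surj hc)[P <-] /(chart_nbhd hc)[f [Pf hf]].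
  exists (iota f); split; first exact/secfun_unit/(chart_unit hc).
  move=> y; have [Uy|Uy] := pselect (oset U y); last by rewrite secfun_out.
  have [Q <-] := chart_surj hc Uy.
  by move=> /secfun_unit/(chart_unit hc) Qf; apply: hf; exists Q.
- move=> f V h; have [a ->] := isurj f => hV; apply: is_localization_comp => //.
  apply: hl; apply/seteqP; split=> [_ [P Pa <-]|x /[dup] /h Ux /hV].
    exact/hV/secfun_unit/(chart_unit hc).
  by have [P <-] := chart_surj hc Ux => /secfun_unit/(chart_unit hc) Pa; exists P.
Qed.

Lemma affine_open_basic U (f : sec U) V : affine_open U -> (forall x, oset V x <-> secfun f x <>
  0) -> affine_open V.
Proof.
move=> [ha hb hc hd] hV; have h : V `<=` U by move=> x /hV/secfun_in.
have [[t ft] frac ker] := hd f V h hV.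
have fx x : oset V x -> secfun (res h f) x != 0 by move=> Vx; rewrite secfun_res //; apply/eqP/hV.
have VM (s : sec V) x n : oset V x -> secfun s x = 0 <-> secfun (s * res h f ^+ n) x = 0.
  move=> Vx; rewrite secfunM dfunM secfunX_in //; split=> [->|/eqP]; first by rewrite mul0r.
  by rewrite mulf_eq0 expf_eq0 (negbTE (fx _ Vx)) andbF orbF => /eqP.
split.
- move=> P; have [x [Ux hx]] := ha (comap (res h) P).
  have Vx : oset V x.
    apply/hV => /hx /= Pf; apply: (@pideal1 _ P); rewrite -ft; exact: pidealMr.
  exists x; split=> // s; have [n [a e]] := frac s.
  rewrite (VM _ _ n Vx) e secfun_res // -hx /= -e; split=> [Ps|]; first exact: pidealMr.
  rewrite mulrC; apply: pidealV => /pidealX Pf.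
  by apply: (@pideal1 _ P); rewrite -ft; exact: pidealMr.
- move=> x y Vx Vy e; apply: (hb _ _ (h _ Vx) (h _ Vy)) => s.
  by rewrite -(secfun_res h _ Vx) -(secfun_res h _ Vy).
- move=> x W Vx Wx; have [s [sx sW]] := hc _ _ (h _ Vx) Wx.
  exists (res h s); split=> [|y]; first by rewrite secfun_res.
  by have [Vy|Vy] := pselect (oset V y); [rewrite secfun_res //; apply: sW|rewrite secfun_out].
- move=> g W hWV hW; have [n [a ea]] := frac g.
  have hWU : W `<=` U by move=> y /hWV/h.
  (* With g = a / f ^+ n on V, the basic open set W of g in V is the one of a * f in U. *)
  have hW' x : oset W x <-> secfun (a * f) x <> 0.
    have E : oset V x -> secfun g x <> 0 <-> secfun (a * f) x <> 0.
      move=> Vx; have := VM g x n Vx; rewrite ea secfun_res // secfunM dfunM => e.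
      move/hV : (Vx) => /eqP f0.
      by rewrite e; split=> + h0; apply; [move/eqP: h0; rewrite mulf_eq0 (negbTE f0) orbF =>
        /eqP|rewrite h0 mul0r].
    split=> [Wx|]; first by apply/(E (hWV _ Wx))/hW.
    move=> /[dup] h0; rewrite secfunM dfunM => h1; have Vx : oset V x.
      by apply/hV => f0; apply: h1; rewrite f0 mulr0.
    by apply/hW/E.
  have [_ frac' ker'] := hd (a * f) W hWU hW'.
  have gf : res hWU (a * f) = res hWV (g * res h f ^+ n.+1).
    by rewrite exprSr mulrA ea -rmorphM; apply: esym; apply: res_comp.
  have u1 : exists t, res hWV g * t = 1.
    apply: unit_section => x Wx; apply/unit_germ_res => //.
    exact/secfun_unit/hW.
  split=> // [b|s es].
    have [k [c ec]] := frac' b; exists k, (res h c * t ^+ (n.+1 * k)).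
    have -> : res hWV (res h c * t ^+ (n.+1 * k)) = res hWU c * res hWV t ^+ (n.+1 * k).
      by rewrite rmorphM rmorphXn (res_comp h hWV hWU).
    rewrite -ec gf !rmorphM rmorphXn exprMn -exprM -!mulrA -exprMn -rmorphM ft.
    by rewrite rmorph1 expr1n mulr1.
  have [m [c ec]] := frac s.
  have [|k] := ker' c.
    by rewrite -(res_comp h hWV hWU) -ec rmorphM es mul0r.
  move=> /(congr1 (res h)); rewrite rmorph0 rmorphM -ec rmorphXn rmorphM -ea => e0.
  exists k; have : (s * g ^+ k) * res h f ^+ (m + n.+1 * k) = 0.
    by rewrite -e0 exprD !exprMn -!exprM exprM exprS !exprMn -exprM; ring.
  move/(congr1 ( *%R^~ (t ^+ (m + n.+1 * k)))); rewrite -mulrA -exprMn ft expr1n mulr1 => ->.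
  by rewrite mul0r.
Qed.

Lemma affine_open_nbhd x V : oset V x -> exists U, [/\ affine_open U, oset U x & U `<=` V].
Proof.
move=> Vx; have [U [A [psi [iota [Ux /affine_open_chart hU]]]]] := affine_cover x.
have [_ _ hc _] := hU; have [s [sx sV]] := hc _ _ Ux Vx.
exists (unit_opens s); split.
- by apply: (affine_open_basic hU (f := s)) => y; apply: unit_opensP.
- exact/unit_opensP.
- by move=> y /unit_opensP/sV.
Qed.

Definition germ x : set (dfun (@perf_kappa X)) :=
  [set m | exists V (a : sec V), oset V x /\ forall y, oset V y -> m y = secfun a y].

Lemma germ_ring x : subring (germ x).
Proof.
split.
- by exists (Opens openT), 1; split=> // y Vy; rewrite secfun1.
- move=> m m' [V [a [Vx e]]] [V' [a' [Vx' e']]].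
  exists (opensI V V'), (res (@opIl _ _ _) a - res (@opIr _ _ _) a'); split=> // y [Vy Vy'].
  by rewrite dfunB secfunB dfunB !secfun_res // e ?e'.
- move=> m m' [V [a [Vx e]]] [V' [a' [Vx' e']]].
  exists (opensI V V'), (res (@opIl _ _ _) a * res (@opIr _ _ _) a'); split=> // y [Vy Vy'].
  by rewrite dfunM secfunM dfunM !secfun_res // e ?e'.
Qed.

Lemma germ_loc x s t : germ x s -> near_eq x s t -> germ x t.
Proof.
move=> [V [a [Vx e]]] [W [Wx ew]].
exists (opensI V W), (res (@opIl _ _ _) a); split=> // y [Vy Wy].
by rewrite secfun_res // -ew // e.
Qed.

Lemma germ_secfun x V (a : sec V) : oset V x -> germ x (secfun a).
Proof. by move=> Vx; exists V, a. Qed.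

Lemma germ_near_nz x m : germ x m -> m x <> 0 ->
  exists V, oset V x /\ forall y, oset V y -> m y <> 0.
Proof.
move=> [V [a [Vx e]]]; rewrite e // => /unit_opensP ax; exists (unit_opens a); split=> // y ay.
by rewrite e; [apply/unit_opensP|apply: unit_opens_sub ay].
Qed.

Lemma germ_inv x m : germ x m -> m x <> 0 -> germ x (fun y => (m y)^-1).
Proof.
move=> [V [a [Vx e]]]; rewrite e // => /secfun_unit[W [h [Wx [t et]]]].
exists W, t; split=> // y Wy; rewrite e; last exact: (h y Wy).
have := congr1 (fun s => secfun s y) et; rewrite secfunM dfunM secfun_res // secfun1 // => e1.
rewrite -[LHS]mulr1 -e1 mulrA mulVf ?mul1r //; apply/eqP => a0.
by move/eqP: e1; rewrite a0 mul0r eq_sym oner_eq0.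
Qed.

Lemma affine_open_germ U x m : affine_open U -> oset U x -> germ x m ->
  exists g a : sec U, secfun g x <> 0 /\ secfun g * m = secfun a.
Proof.
move=> hU Ux [V [b [Vx e]]]; have [_ _ hc hd] := hU.
have [f [fx fV]] := hc _ _ Ux Vx.
have hf : unit_opens f `<=` U by apply: unit_opens_sub.
have hfV : unit_opens f `<=` V by move=> y /unit_opensP/fV.
have [_ frac _] := hd f (unit_opens f) hf (fun y => unit_opensP f y).
(* The extra factor f makes both sides vanish where f does, so the identity holds on the whole
   space. *)
have [n [a ea]] := frac (res hfV b); exists (f ^+ n.+1), (f * a); split.
  by rewrite secfunX dfunX => /eqP; rewrite expf_eq0 => /andP[_ /eqP].
apply: dfunP => y; rewrite dfunM secfunX dfunX secfunM dfunM.
have [->|/eqP f0] := eqVneq (secfun f y) 0; first by rewrite expr0n !mul0r.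
have Dy := (unit_opensP f y).2 f0.
rewrite e; last exact: fV.
have := congr1 (fun s => secfun s y) ea; rewrite secfunM dfunM secfunX_in // !secfun_res // => <-.
by rewrite exprS; ring.
Qed.

Lemma affine_open_germs U x n (m : nat -> dfun (@perf_kappa X)) : affine_open U -> oset U x ->
  (forall i, germ x (m i)) ->
  exists (g : sec U) (a : nat -> sec U), secfun g x <> 0 /\ forall i, (i < n)%N -> secfun g * m i
    = secfun (a i).
Proof.
move=> hU Ux hm; elim: n => [|n [g [a [gx IH]]]].
  by exists 1, (fun=> 0); split=> //; rewrite secfun1 // => /eqP; rewrite oner_eq0.
have [g' [b [gx' e]]] := affine_open_germ hU Ux (hm n).
exists (g * g'), (fun i => if i == n then g * b else g' * a i); split.
  rewrite secfunM dfunM => /eqP; rewrite mulf_eq0 => /orP[]/eqP //.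
move=> i; rewrite ltnS leq_eqVlt; case: eqVneq => [-> _|_ /= /IH].
  by rewrite !secfunM -mulrA e.
by rewrite !secfunM => <-; rewrite -mulrA mulrCA.
Qed.

End AffineOpens.

(** * The absolute weak normalization *)

Section WnMap.
Variables (F F' : comPzRingType) (k k' : fieldType) (eps : {rmorphism F -> k})
  (eps' : {rmorphism F' -> k'}) (G : set F) (G' : set F').
Variables (pi : {rmorphism F -> F'}) (theta : {rmorphism k -> k'}).
Hypothesis pieps : forall s, eps' (pi s) = theta (eps s).
Hypothesis piG : forall s, G s -> G' (pi s).

Lemma span_map w z t : span eps G w z t -> span eps' G' (map pi w) z (pi t).
Proof.
elim=> [|c e u Gc ec ew _ IH]; first by rewrite rmorph0; apply: SpanZero.
rewrite rmorphD rmorphM; apply: SpanCons => //; [exact: piG| |exact: map_f].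
by move=> hz; rewrite pieps ec // rmorph0.
Qed.

Lemma stab_map w z t : stab eps G w z t -> stab eps' G' (map pi w) z (pi t).
Proof. by move=> st _ /mapP[e ew ->]; rewrite -rmorphM; apply/span_map/st. Qed.

Lemma wsi_map s : weakly_subintegral eps G s -> weakly_subintegral eps' G' (pi s).
Proof.
move=> [w [w1 ss [Q [c [hQ Gc [sc [N sN]]]]]]]; exists (map pi w); split.
- by rewrite -(rmorph1 pi); apply: map_f.
- exact: stab_map.
exists Q, (pi c); split; [by rewrite (eq_pnat _ (fmorph_pchar theta))|exact: piG|].
rewrite -rmorphXn -rmorphB; split; first exact: stab_map.
by exists N; rewrite -rmorphXn; apply: stab_map.
Qed.
End WnMap.

Section FunctionSheafUnits.
Variable S : fsys.
Implicit Types U V : opens (fspace S).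

Lemma fvalX U (s : fsec U) n x : oset U x -> fval (s ^+ n) x = fval s x ^+ n.
Proof.
move=> Ux; elim: n => [|n IH]; first by rewrite !expr0 /= indT.
by rewrite !exprS -IH.
Qed.

Lemma fval_sum U n (F : 'I_n -> fsec U) x : fval (\sum_(i < n) F i) x = \sum_(i < n) fval (F i) x.
Proof. exact: (big_morph (fun s : fsec U => fval s x)). Qed.

Lemma fspace_unit U (s : sec (r := fspace S) U) x : unit_germ x s -> fval s x <> 0.
Proof.
move=> [V [h [Vx [t e]]]] s0; have := congr1 (fun u => fval u x) e.
by rewrite /= !dfunM !indT // s0 mulr0 mul0r => /eqP; rewrite eq_sym oner_eq0.
Qed.
End FunctionSheafUnits.

Section WeakNormalization.
Variable Y : scheme.
Implicit Types (U V : opens Y) (x : Y).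

Definition wsi_germ x : set (dfun (@perf_kappa Y)) := weakly_subintegral (dev x) (germ x).

Lemma wsi_germ_ring x : subring (wsi_germ x).
Proof. exact/wsi_ring/germ_ring. Qed.

Lemma wsi_germ_sub x m : germ x m -> wsi_germ x m.
Proof. exact/wsi_sub/germ_ring. Qed.

Lemma wsi_germ_loc x s t : wsi_germ x s -> near_eq x s t -> wsi_germ x t.
Proof.
move=> ws [V [Vx e]]; rewrite -[t](subrK s) addrC; apply: (subD (wsi_germ_ring x)) => //.
apply: wsi_germ_sub; apply: germ_loc (sub0 (germ_ring x)) _; exists V; split=> // y Vy.
by rewrite dfunB e // subrr.
Qed.

(* [weakly_subintegral] is not an open condition, but sections have to satisfy it
   at every point of their domain. *)
Definition awn_fsys : fsys := FSys wsi_germ_ring wsi_germ_loc.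
Definition awn_space : ringed_space := fspace awn_fsys.

Lemma wsi_germ_divides x s : wsi_germ x s -> s x <> 0 -> exists s' d,
  [/\ wsi_germ x s', germ x d, d x <> 0 & s * s' = d].
Proof. exact/wsi_inv/germ_ring. Qed.

(** Some multiple of s is a germ of sections of Y not vanishing at x, and such germs do not vanish
    on a neighbourhood. *)
Lemma wsi_germ_near_nz x s : wsi_germ x s -> s x <> 0 ->
  exists V, oset V x /\ forall y, oset V y -> s y <> 0.
Proof.
move=> ws sx; have [s' [d [_ Gd dx e]]] := wsi_germ_divides ws sx.
have [V [Vx hV]] := germ_near_nz Gd dx; exists V; split=> // y /hV; rewrite -e dfunM => h s0.
by apply: h; rewrite s0 mul0r.
Qed.

Lemma wsi_germ_inv x s : wsi_germ x s -> s x <> 0 -> wsi_germ x (fun y => (s y)^-1).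
Proof.
move=> ws sx; have [s' [d [ws' Gd dx e]]] := wsi_germ_divides ws sx.
have [V [Vx hV]] := germ_near_nz Gd dx.
apply: (wsi_germ_loc (s := s' * (fun y => (d y)^-1))).
  by apply: (subM (wsi_germ_ring x)) => //; apply/wsi_germ_sub/germ_inv.
exists V; split=> // y /hV; rewrite -e !dfunM => /eqP; rewrite mulf_eq0 negb_or => /andP[s0 s'0].
by rewrite invfM mulrCA mulfV // mulr1.
Qed.

Lemma awn_unit U (s : sec (r := awn_space) U) x : oset U x -> unit_germ (X := awn_space) x s <->
  fval s x <> 0.
Proof.
move=> Ux; split; first exact: fspace_unit.
move=> sx; have [V [Vx hV]] := wsi_germ_near_nz (fvalG s Ux) sx.
pose W := opensI U V; exists W, (@opIl _ _ _); split=> //.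
pose t : dfun (@perf_kappa Y) := fun y => if `[< oset W y >] then (fval s y)^-1 else 0.
have t0 y : ~ oset W y -> t y = 0 by rewrite /t; case: asboolP.
have tG y : oset W y -> wsi_germ y t.
  move=> Wy; have [Uy Vy] := Wy; apply: (wsi_germ_loc (s := fun y => (fval s y)^-1)).
    by apply: wsi_germ_inv; [exact: (fvalG s Uy)|exact: hV].
  by exists W; split=> // y' Wy'; rewrite /t; case: asboolP.
exists (@FSec awn_fsys W t t0 tG); apply: fsec_eq => y Wy.
rewrite /= !dfunM !indT // mul1r /t; case: asboolP => // _.
by rewrite mulfV //; apply/eqP; apply: hV; have [] := Wy.
Qed.

Lemma secfun_one V : secfun (1 : sec V) = ind (S := awn_fsys) V.
Proof.
apply: dfunP => x; have [Vx|Vx] := pselect (oset V x); first by rewrite secfun1 // indT.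
by rewrite secfun_out // indF.
Qed.

Definition esec V (a : sec V) : fsec (S := awn_fsys) V :=
  @FSec awn_fsys V (secfun a) (fun x => @secfun_out _ _ a x) (fun x Vx => wsi_germ_sub
    (germ_secfun a Vx)).

Lemma esec_zmod V : zmod_morphism (@esec V).
Proof. by move=> a b; apply/fsecP/secfunB. Qed.
Lemma esec_monoid V : monoid_morphism (@esec V).
Proof. by split=> [|a b]; apply/fsecP; [apply: secfun_one|apply: secfunM]. Qed.
HB.instance Definition _ V := GRing.isZmodMorphism.Build (sec V) (fsec (S := awn_fsys) V)
  (@esec V) (@esec_zmod V).
HB.instance Definition _ V := GRing.isMonoidMorphism.Build (sec V) (fsec (S := awn_fsys) V)
  (@esec V) (@esec_monoid V).

(** Let x be the point of the restriction of q to sections of Y. After clearing denominators, g s ^+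
    Q - a satisfies a monic equation with lower coefficients in q, where a stands for g c; so it
    lies in q, and s belongs to q if and only if a does, that is, if and only if s vanishes at x. *)
Lemma awn_prime U (q : prime_ideal (fsec (S := awn_fsys) U)) : affine_open U ->
  exists x, oset U x /\ forall s, pideal q s <-> fval s x = 0.
Proof.
move=> hU; have [ha _ _ _] := hU; have [x [Ux hx]] := ha (comap (@esec U : {rmorphism _ -> _}) q).
exists x; split=> // s.
have [Q [c [N [n [m [hQ Gc Gm em e]]]]]] := wsi_poly (germ_ring x) (fvalG s Ux).
have sc : fval s x ^+ Q = c x := wsi_poly_eps em e.
have Q0 : (0 < Q)%N by case/andP: hQ.
(* One denominator g for c, in position 0, and for the n coefficients m i. *)
have [g [a [gx ga]]] := @affine_open_germs _ U x n.+1 (fun i => if i is j.+1 then m j else c) hU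
  Ux
  (fun i => match i with 0%N => Gc | j.+1 => Gm j end).
have gc : secfun g * c = secfun (a 0%N) by exact: (ga 0%N).
have gm i : (i < n)%N -> secfun g * m i = secfun (a i.+1) by exact: (ga i.+1).
have nq : ~ pideal q (esec g) by move/hx.
have tq : pideal q (esec g * s ^+ Q - esec (a 0%N)).
  (* The additional factor g leaves, for each i < n, a factor g that clears the denominator of m i,
     also when N = 0. *)
  pose u := esec g * (esec g * s ^+ Q - esec (a 0%N)) ^+ N.
  pose T := (fval s ^+ Q - c) ^+ N.
  have uy y : oset U y -> fval u y = secfun g y ^+ N.+1 * T y.
    move=> Uy; rewrite /u [LHS]dfunM fvalX //= dfunB dfunM fvalX // -gc dfunM -mulrBr exprMn.
    by rewrite mulrA -exprS /T dfunX dfunB dfunX.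
  have eu : u ^+ n = \sum_(i < n) esec g ^+ (N.+1 * (n - i)).-1 * esec (a i.+1) * u ^+ i.
    apply: fsec_eq => y Uy; rewrite fvalX // fval_sum uy // exprMn.
    have -> : T y ^+ n = \sum_(i < n) m i y * T y ^+ i.
      by rewrite -dfunX e dfun_sum; apply: eq_bigr => i _; rewrite dfunM dfunX.
    rewrite mulr_sumr; apply: eq_bigr => i _.
    rewrite [RHS]dfunM fvalX // uy // [fval (_ * _) y]dfunM fvalX //= -gm // dfunM.
    have hi := ltn_ord i.
    have E : (N.+1 * n)%N = ((N.+1 * (n - i)).-1.+1 + N.+1 * i)%N by nia.
    by rewrite !exprMn -!exprM E exprD exprS; ring.
  have : pideal q (u ^+ n).
    rewrite eu; apply: pideal_sum => i; rewrite mulrAC mulrC; apply: pidealMr.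
    apply/hx; rewrite -gm // dfunM; have -> : m i x = 0 by exact: em.
    exact: mulr0.
  by move=> /pidealX/(pidealV nq)/pidealX.
have -> : pideal q s <-> pideal q (esec (a 0%N)).
  split=> [qs|qa].
    rewrite -[esec _](subKr (esec g * s ^+ Q)); apply: pidealB => //.
    by apply: pidealM; rewrite -(prednK Q0) exprS; apply: pidealMr.
  apply: (@pidealX _ _ _ Q); apply: (pidealV nq).
  by rewrite -[_ * _](subrK (esec (a 0%N))); apply: pidealD.
have -> : pideal q (esec (a 0%N)) <-> secfun (a 0%N) x = 0 by exact: hx.
rewrite -gc dfunM -sc; split=> [/eqP|->]; last by rewrite expr0n gtn_eqF // mulr0.
by rewrite mulf_eq0 expf_eq0 => /orP[/eqP //|/andP[_ /eqP]].
Qed.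

Section Localization.
Variables (U V : opens Y) (f : fsec (S := awn_fsys) U) (b : fsec (S := awn_fsys) V).
Hypotheses (hU : affine_open U) (h : V `<=` U) (hV : forall x, oset V x <-> fval f x <> 0).

Let J n (c : fsec (S := awn_fsys) U) := exists a : nat -> fsec (S := awn_fsys) U, forall y, oset
  V y ->
  fval c y * fval b y ^+ n = \sum_(i < n) fval (a i) y * fval b y ^+ i.

Let J_S n c : J n c -> J n.+1 c.
Proof.
move=> [a ha]; exists (fun i => if i is j.+1 then a j else 0) => y Vy.
rewrite big_ord_recl /= mul0r add0r exprS mulrCA ha // mulr_sumr.
by apply: eq_bigr => i _; rewrite [in RHS]exprS mulrCA.
Qed.

Let J_mono n d c : J n c -> J (n + d) c.
Proof. by move=> Jc; elim: d => [|d IH]; rewrite ?addn0 // addnS; apply: J_S. Qed.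

(* The [c] for which [c * b ^+ n] is a combination of lower powers of [b] form an
   ideal, which is contained in no prime of [V]. *)
Lemma awn_denominator : exists k n, J n (f ^+ k).
Proof.
have [|q hq|k [n Jn]] := @prime_notin_power _ [set c | exists n, J n c] f.
- split.
  + by exists 0%N, (fun=> 0) => y _; rewrite big_ord0 mul0r.
  + move=> c c' [n /(@J_mono n)hn] [n' /(@J_mono n')hn']; exists (n + n')%N.
    have [a ha] := hn n'; have := hn' n; rewrite addnC => -[a' ha'].
    exists (fun i => a i + a' i) => y Vy; rewrite mulrDl ha // ha' // -big_split.
    by apply: eq_bigr => i _; rewrite mulrDl.
  + move=> c c' [n [a ha]]; exists n, (fun i => c * a i) => y Vy.
    rewrite -mulrA ha // mulr_sumr; apply: eq_bigr => i _.
    by rewrite mulrA.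
- have [x [Ux hx]] := awn_prime q hU.
  apply: contrapT => nf; have Vx : oset V x by apply/hV => f0; apply/nf/hx.
  have [n [a [Ga ea]]] := wsi_monic (germ_ring x) (fvalG b Vx).
  have [g [al [gx gal]]] := affine_open_germs n hU Ux Ga.
  have : pideal q (esec g).
    apply: hq; exists n, (fun i => esec (al i)) => y _.
    have := congr1 (fun s : dfun _ => secfun g y * s y) ea; rewrite dfunX => ->.
    rewrite dfun_sum mulr_sumr; apply: eq_bigr => i _ /=.
    by rewrite -gal // !dfunM dfunX mulrA.
  by move/hx.
- by exists k, n.
Qed.

Lemma awn_extend : exists k (t : fsec (S := awn_fsys) U), forall y, oset V y ->
  fval b y * fval f y ^+ k = fval t y.
Proof.
(* [J_S] makes the degree positive, so that the equation for t also holds off V, where t is 0. *)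
have [k [n0 /J_S]] := awn_denominator; move: (n0.+1) (ltn0Sn n0) => n n_gt0 [a ha].
exists k.+1; pose t : dfun (@perf_kappa Y) := fval f ^+ k.+1 * fval b.
have tV x : ~ oset V x -> fval f x = 0 by move=> /hV/contrapT.
have t0 x : ~ oset U x -> t x = 0.
  by move=> Ux; rewrite /t dfunM [fval b x]fval0 ?mulr0 // => /h.
(* Since t carries f to the power k.+1 and not k, each coefficient keeps at least one factor f and
   vanishes wherever f does. *)
pose A i : dfun (@perf_kappa Y) := fval f ^+ (k.+1 * (n - i) - k.+1).+1 * fval (a i).
have et : t ^+ n = \sum_(i < n) A i * t ^+ i.
  apply: dfunP => y; rewrite dfunX dfun_sum.
  have [Vy|Vy] := pselect (oset V y); last first.
    rewrite /t dfunM dfunX tV // expr0n mul0r expr0n gtn_eqF // big1 // => i _.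
    by rewrite dfunM /A dfunM dfunX tV // expr0n !mul0r.
  have -> : t y ^+ n = fval f y ^+ (k.+1 * n - k) * (fval (f ^+ k) y * fval b y ^+ n).
    rewrite /t dfunM dfunX exprMn -exprM fvalX; last exact: h.
    rewrite mulrA -exprD subnK //; nia.
  rewrite ha // mulr_sumr; apply: eq_bigr => i _.
  rewrite /A /t !dfunM !dfunX dfunM dfunX exprMn -exprM.
  have hi := ltn_ord i.
  rewrite (_ : k.+1 * n - k = (k.+1 * (n - i) - k.+1).+1 + k.+1 * i)%N; last by nia.
  by rewrite exprD; ring.
have wf x : oset U x -> wsi_germ x (fval f) by exact: (@fvalG awn_fsys U f).
have tG x : oset U x -> wsi_germ x t.
  move=> Ux; have [Vx|Vx] := pselect (oset V x).
    apply: (subM (wsi_germ_ring x)); first by apply: (subX (wsi_germ_ring x)); exact: wf.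
    exact: (fvalG b Vx).
  have wA i : wsi_germ x (A i).
    apply: (subM (wsi_germ_ring x)); first by apply: (subX (wsi_germ_ring x)); exact: wf.
    exact: (fvalG (a i) Ux).
  (* At a point off V all A i vanish, so one equation gives both integrality and the condition over
     the maximal ideal, with Q = N = 1 and c = 0. *)
  apply: (@wsi_trans _ _ _ _ (germ_ring x) t n A 1 0 1 n A) => //.
  - exact: (sub0 (wsi_germ_ring x)).
  - by move=> i; rewrite -[LHS]/(A i x) /A dfunM dfunX tV // expr0n mul0r.
  - by rewrite !expr1 subr0.
exists (@FSec awn_fsys U t t0 tG) => y Vy /=.
by rewrite /t dfunM dfunX mulrC.
Qed.
End Localization.

Lemma awn_localization U V (f : fsec (S := awn_fsys) U) (h : V `<=` U) : affine_open U ->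
  (forall x, oset V x <-> fval f x <> 0) -> is_localization f (res (r := awn_space) (U := U) (V
    := V) h).
Proof.
move=> hU hV; split.
- apply: (@unit_section awn_space) => x Vx; apply/awn_unit => //.
  by rewrite fresE //; apply/hV.
- move=> b; have [k [t e]] := awn_extend b hU h hV; exists k, t.
  apply: fsec_eq => y Vy; rewrite fresE // -e // [LHS]dfunM fvalX //.
  by rewrite fresE.
(* The product with f vanishes everywhere: a is 0 on V and f is 0 off V. *)
- move=> a a0; exists 1%N; rewrite expr1; apply: fsec_eq => y Uy; rewrite [LHS]dfunM.
  have [Vy|Vy] := pselect (oset V y); last first.
    by have -> : fval f y = 0 by [apply: contrapT => /hV]; rewrite mulr0.
  by rewrite -(@fresE awn_fsys U V h a y Vy) (a0 : @fres awn_fsys U V h a = 0) mul0r.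
Qed.

Program Definition awn_point_ideal U x (Ux : oset U x) : prime_ideal (fsec (S := awn_fsys) U) :=
  @PrimeIdeal (fsec (S := awn_fsys) U) [set s : fsec (S := awn_fsys) U | fval s x = 0] _ _ _ _ _.
Next Obligation. by []. Qed.
Next Obligation. by move=> U x Ux a b /= h h'; rewrite dfunD h h' addr0. Qed.
Next Obligation. by move=> U x Ux a b /= h; rewrite dfunM h mulr0. Qed.
Next Obligation. by move=> U x Ux /=; rewrite indT // => /eqP; rewrite oner_eq0. Qed.
Next Obligation.
by move=> U x Ux a b /=; rewrite dfunM => /eqP; rewrite mulf_eq0 => /orP[]/eqP; [left|right].
Qed.

Lemma awn_chart U : affine_open U -> exists psi : prime_ideal (fsec (S := awn_fsys) U) ->
  awn_space,
  is_affine_chart (X := awn_space) (U := U) psi (idfun : {rmorphism fsec (S := awn_fsys) U -> sec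
    (r := awn_space) U}).
Proof.
move=> hU; have [_ hb hc _] := hU.
have [psi hpsi] := @choice_ex (prime_ideal (fsec (S := awn_fsys) U)) Y
  (fun q x => oset U x /\ forall s : fsec (S := awn_fsys) U, pideal q s <-> fval s x = 0)
  (fun q => @awn_prime U q hU).
have psiE q x : oset U x -> (forall s : fsec (S := awn_fsys) U, pideal q s <-> fval s x = 0) ->
  psi q = x.
  move=> Ux hx; have [Ux' hx'] := hpsi q; apply: hb => // s.
  by have := hx (esec s); rewrite (hx' (esec s)).
have psi_rpt x (Ux : oset U x) : psi (awn_point_ideal Ux) = x by apply: psiE.
exists psi; split.
- apply/seteqP; split=> [_ [q _ <-]|x Ux]; first by have [] := hpsi q.
  by exists (awn_point_ideal Ux).
- move=> q q' e; have [_ h] := hpsi q; have [_ h'] := hpsi q'.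
  by apply: prime_ideal_eq => s; rewrite h h' e.
- move=> W Wo; exists [set s : fsec (S := awn_fsys) U | forall y : Y, fval s y <> 0 -> W y];
  apply/seteqP; split=> q /=.
    move=> Wq; have [Uq hq] := hpsi q.
    have [s [sx sW]] := hc _ (Opens Wo) Uq Wq => sub.
    by apply: sx; apply/(hq (esec s)); apply: sub.
  move=> nsub; apply: contrapT => nW; apply: nsub => s hs.
  by have [_ hq] := hpsi q; apply/hq; apply: contrapT => /hs.
- move=> W [E ->]; apply: open_local => _ [q /= nE <-].
  move/existsNP: nE => [s /not_implyP[Es qs]]; have [Uq hq] := hpsi q.
  have sq : fval s (psi q) <> 0 by move/hq.
  have [V [Vx hV]] := wsi_germ_near_nz (fvalG s Uq) sq.
  exists (opensI U V); split=> // y [Uy Vy]; exists (awn_point_ideal Uy); last exact: psi_rpt.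
  by move=> /= sub; apply: (hV y Vy); apply: sub.
- move=> f V h e; have hV x : oset V x <-> fval f x <> 0.
    rewrite -[oset V x]/((V : set _) x) -e; split=> [[q qf <-] /(hpsi q).2//|fx].
    have Ux : oset U x by apply: contrapT => /(fval0 f).
    by exists (awn_point_ideal Ux).
  have := awn_localization h hU hV.
  by rewrite (_ : _ \o _ = res (r := awn_space) (U := U) (V := V) h :> {rmorphism _ -> _}) //;
    apply: rmorph_eq.
Qed.

Lemma awn_cover (x : awn_space) : exists (U : opens awn_space) (A : comPzRingType)
      (psi : prime_ideal A -> awn_space) (iota : {rmorphism A -> sec U}),
    oset U x /\ is_affine_chart psi iota.
Proof.
have [U [hU Ux _]] := @affine_open_nbhd Y x (Opens openT) I.
have [psi hpsi] := awn_chart hU.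
by exists U, (fsec (S := awn_fsys) U), psi, idfun.
Qed.

Definition awn : scheme := Scheme awn_cover.

End WeakNormalization.

Definition awn_map (Y : scheme) : lrs_hom (awn Y) Y.
Proof.
refine (@LrsHom (awn Y) Y idfun (@id_cont Y)
  (fun V => @esec Y V : {rmorphism sec V -> sec (r := awn Y) V}) _ _).
- move=> U V h h' s; apply: fsec_eq => x Vx; rewrite fresE //=.
  by rewrite secfun_res.
- move=> x V s Vx u; apply/secfun_unit.
  exact: (@fspace_unit (awn_fsys Y) V (esec s) x u).
Defined.

(** * Functoriality of the weak normalization *)

Section Pullback.
Variables (Z W : scheme) (f : lrs_hom Z W).

Definition pull (s : dfun (@perf_kappa W)) : dfun (@perf_kappa Z) := fun z => kmap f z (s (base f
  z)).

Lemma pull_zmod : zmod_morphism pull.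
Proof. by move=> s t; apply: dfunP => z; apply: rmorphB. Qed.
Lemma pull_monoid : monoid_morphism pull.
Proof. by split=> [|s t]; apply: dfunP => z; [apply: rmorph1|apply: rmorphM]. Qed.
HB.instance Definition _ := GRing.isZmodMorphism.Build (dfun (@perf_kappa W)) (dfun (@perf_kappa
  Z)) pull pull_zmod.
HB.instance Definition _ := GRing.isMonoidMorphism.Build (dfun (@perf_kappa W)) (dfun
  (@perf_kappa Z)) pull pull_monoid.

Lemma pull_secfun V (a : sec V) : pull (secfun a) = secfun (sharp f V a).
Proof. by apply: dfunP => z; apply: kmapE. Qed.

Lemma pull_germ z s : germ (base f z) s -> germ z (pull s).
Proof.
move=> [V [a [Vx e]]]; exists (preim (base_cont f) V), (sharp f V a); split=> // y Vy.
by rewrite -pull_secfun /pull e.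
Qed.

Lemma pull_wng z s : wsi_germ (base f z) s -> wsi_germ z (pull s).
Proof. by apply: (@wsi_map _ _ _ _ _ _ _ _ pull (kmap f z)) => //; apply: pull_germ. Qed.

Program Definition psec V (s : fsec (S := awn_fsys W) V) : fsec (S := awn_fsys Z) (preim
  (base_cont f) V) :=
  @FSec (awn_fsys Z) (preim (base_cont f) V) (pull (fval s)) _ _.
Next Obligation. by move=> V s x Vx; rewrite /pull fval0 ?rmorph0. Qed.
Next Obligation. by move=> V s x Vx; apply: pull_wng; apply: (@fvalG (awn_fsys W) V s). Qed.

Lemma psec_zmod V : zmod_morphism (@psec V).
Proof. by move=> a b; apply/fsecP/rmorphB. Qed.
Lemma psec_monoid V : monoid_morphism (@psec V).
Proof.
split=> [|a b]; last by apply/fsecP/rmorphM.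
apply: fsec_eq => x Vx /=; rewrite indT // /pull indT ?rmorph1 //.
Qed.
HB.instance Definition _ V := GRing.isZmodMorphism.Build (fsec (S := awn_fsys W) V)
  (fsec (S := awn_fsys Z) (preim (base_cont f) V)) (@psec V) (@psec_zmod V).
HB.instance Definition _ V := GRing.isMonoidMorphism.Build (fsec (S := awn_fsys W) V)
  (fsec (S := awn_fsys Z) (preim (base_cont f) V)) (@psec V) (@psec_monoid V).

Definition awn_fmap : lrs_hom (awn Z) (awn W).
Proof.
refine (@LrsHom (awn Z) (awn W) (base f) (base_cont f)
  (fun V => @psec V : {rmorphism sec (r := awn W) V -> sec (r := awn Z) (preim (base_cont f) V)})
    _ _).
- move=> U V h h' s; apply: fsec_eq => x Vx; rewrite fresE //.
  by apply: (congr1 (kmap f x)); rewrite fresE.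
- move=> x V s Vx u; apply/awn_unit => // s0.
  by apply: (@fspace_unit (awn_fsys Z) _ (psec s) x u); rewrite /= /pull s0 rmorph0.
Defined.

Lemma awn_map_natural : lrs_comp f (awn_map Z) = lrs_comp (awn_map W) awn_fmap.
Proof.
apply: (@lrs_hom_eq (awn Z) W (base f) (base_cont f)) => V s.
by apply/fsecP; rewrite /= pull_secfun.
Qed.
End Pullback.

Lemma kmap_comp (X Y Z : scheme) (g : lrs_hom Y Z) (f : lrs_hom X Y) x (v : perf_kappa (base g
  (base f x))) :
  kmap (lrs_comp g f) x v = kmap f x (kmap g (base f x) v).
Proof.
pose phi : {rmorphism perf_kappa (base g (base f x)) -> perf_kappa x} := kmap f x \o kmap g (base
  f x).
apply: (@perf_kappa_uniq Z (base g (base f x)) (perf_kappa x) (kmap (lrs_comp g f) x) phi) => V s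
  _.
by rewrite /phi /= !kmapE (@kmapE X Z (lrs_comp g f) x V s).
Qed.

Lemma awn_fmap_comp (X Y Z : scheme) (g : lrs_hom Y Z) (f : lrs_hom X Y) :
  awn_fmap (lrs_comp g f) = lrs_comp (awn_fmap g) (awn_fmap f).
Proof.
apply: (@lrs_hom_eq (awn X) (awn Z) (base g \o base f) (comp_cont (base_cont f) (base_cont g)))
  => V s.
by apply/fsecP/dfunP => x; apply: kmap_comp.
Qed.

(** Some power s ^+ Q has at z the same value as a section a of Y. Their difference is no unit of
    [awn Y] at z, so the residue field of [awn Y] sees the same equality, and Q-th powers are
    injective. *)
Lemma secfun_awn (Y : scheme) (V : opens Y) (s : sec (r := awn Y) V) : secfun s = pull (awn_map
  Y) (fval s).
Proof.
apply: dfunP => z; have [Vz|Vz] := pselect (oset V z); last first.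
  by rewrite secfun_out // /pull fval0 ?rmorph0.
have [Q [V' [a [hQ Vz' e]]]] := perf_kappa_secfun (fval s z).
have hQ' : [pchar @perf_kappa (awn Y) z].-nat Q by rewrite (eq_pnat _ (fmorph_pchar (kmap
  (awn_map Y) z))).
apply: (expr_pnat_inj hQ'); rewrite /pull -rmorphXn [fval s _ ^+ Q]e.
rewrite -secfunX_in // [RHS](@kmapE _ _ (awn_map Y) z V' a) /=.
pose I := opensI V V'; have Iz : oset I z by [].
rewrite -(@secfun_res (awn Y) _ I (@opIl _ V V')) // -(@secfun_res (awn Y) _ I (@opIr _ V V')
  (esec a)) //.
have : secfun (res (r := awn Y) (@opIl _ V V') (s ^+ Q) - res (r := awn Y) (@opIr _ V V') (esec
  a)) z = 0.
  apply/not_secfun_unit => /fspace_unit; apply.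
  rewrite [fval _ z]dfunB fresE // fresE // fvalX //= e.
  by rewrite subrr.
by rewrite secfunB dfunB => /eqP; rewrite subr_eq0 => /eqP.
Qed.

Lemma awn_fmap_map (Y : scheme) : awn_fmap (awn_map Y) = awn_map (awn Y).
Proof.
apply: (@lrs_hom_eq (awn (awn Y)) (awn Y) idfun (@id_cont (awn Y))) => V s.
by apply/fsecP; rewrite /= secfun_awn.
Qed.

(* Only the universal property of [Y'] is used: the composite of [awn X' -> Y']
   with [awn Y' -> awn X'] is [awn_map Y'], a homeomorphism. *)
Lemma awn_map_universal_homeomorphism (Y : scheme) : universal_homeomorphism (awn_map Y).
Proof.
move=> X' Y' g f' g' [sq univ].
have [|u [[u1 u2] _]] := univ (awn X') (awn_fmap g) (awn_map X'); first exact: esym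
  (awn_map_natural g).
have {}sq : lrs_comp (awn_map Y) g' = lrs_comp g f' := sq.
have {}u1 : lrs_comp g' u = awn_fmap g := u1.
have {}u2 : lrs_comp f' u = awn_map X' := u2.
have uR : lrs_comp u (awn_fmap f') = awn_map Y'.
  have [|t [_ tuniq]] := univ (awn Y') (lrs_comp g' (awn_map Y')) (lrs_comp f' (awn_map Y')).
    by rewrite /= !lrs_compA sq.
  rewrite -(tuniq (lrs_comp u (awn_fmap f'))); first by apply: tuniq.
  split; rewrite /= lrs_compA; last by rewrite u2; exact: esym (awn_map_natural f').
  rewrite u1 -awn_fmap_comp -sq awn_fmap_comp awn_fmap_map; exact: esym (awn_map_natural g').
exists (base u); split.
- by move=> y; apply: (congr1 (fun h : lrs_hom (awn Y') Y' => base h y) uR).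
- by move=> x; apply: (congr1 (fun h : lrs_hom (awn X') X' => base h x) u2).
- by apply/continuousP => V; apply: (base_cont f').
- by apply/continuousP => V; apply: (base_cont u).
Qed.

Lemma awn_reduced (Y : scheme) : reduced (awn Y).
Proof.
move=> U s n e; apply: fsec_eq => x Ux /=.
have := congr1 (fun t => fval t x) e; rewrite fvalX //= => /eqP.
by rewrite expf_eq0 => /andP[_ /eqP].
Qed.

(** * Isomorphisms and coreflections *)

(** Restricting both sides to a common U avoids transporting sections along the equality of base
    maps. *)
Lemma lrs_ext (X Y : ringed_space) (f g : lrs_hom X Y) :
  (forall x, base f x = base g x) ->
  (forall V (s : sec V) (U : opens X) (u : U `<=` preim (base_cont f) V)
     (v : U `<=` preim (base_cont g) V), res u (sharp f V s) = res v (sharp g V s)) -> f = g.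
Proof.
case: f g => [f fc fs secfun fl] [g gc gs gn glob] /= e; have {}e : f = g by apply: funext.
subst g; have ec := Prop_irrelevance fc gc; subst gc => h.
apply: lrs_hom_eq => V s; have := h V s (preim fc V) (@subset_refl _ _) (@subset_refl _ _).
by rewrite !res_id.
Qed.

Definition lrs_iso (X Y : ringed_space) (h : lrs_hom X Y) := exists k : lrs_hom Y X,
  lrs_comp k h = lrs_id X /\ lrs_comp h k = lrs_id Y.

Section IsoCriterion.
Variables (X Y : ringed_space) (h : lrs_hom X Y) (g : Y -> X).
Hypotheses (hK : cancel (base h) g) (gK : cancel g (base h)) (gc : cont g).
Hypothesis hbij : forall V, bijective (sharp h V).

(** The two open sets have the same points but are not convertible; the inclusion lets [res] mediate
    between them. *)
Lemma iso_sub (U : opens X) : preim (base_cont h) (preim gc U) `<=` U.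
Proof. by move=> x /=; rewrite /preimage /= hK. Qed.

Lemma iso_inv_ex (U : opens X) : exists phi : {rmorphism sec U -> sec (preim gc U)},
  forall s, sharp h (preim gc U) (phi s) = res (@iso_sub U) s.
Proof.
have [inv iK Ki] := hbij (preim gc U).
pose phi s := inv (res (@iso_sub U) s).
have phiB : zmod_morphism phi.
  by move=> s t; apply: (can_inj iK); rewrite rmorphB /= !Ki rmorphB.
have phiM : monoid_morphism phi.
  split=> [|s t]; apply: (can_inj iK); first by rewrite /phi Ki !rmorph1.
  by rewrite rmorphM /= !Ki rmorphM.
pose p1 := GRing.isZmodMorphism.Build _ _ phi phiB.
pose p2 := GRing.isMonoidMorphism.Build _ _ phi phiM.
pose phi' : {rmorphism sec U -> sec (preim gc U)} := HB.pack phi p1 p2.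
by exists phi' => s; apply: Ki.
Qed.

Definition iso_inv (U : opens X) : {rmorphism sec U -> sec (preim gc U)} :=
  projT1 (cid (iso_inv_ex U)).

Lemma iso_invE U s : sharp h (preim gc U) (iso_inv U s) = res (@iso_sub U) s.
Proof. exact: (projT2 (cid (iso_inv_ex U))). Qed.

Definition iso_inv_hom : lrs_hom Y X.
Proof.
refine (@LrsHom Y X g gc iso_inv _ _).
- move=> U V i i' s; apply: (bij_inj (hbij (preim gc V))).
  have k : preim (base_cont h) (preim gc V) `<=` preim (base_cont h) (preim gc U).
    by move=> x /i'.
  by rewrite -(sharp_nat i' k) !iso_invE !res2; apply: res_irr.
- move=> y U s Uy u.
  have := @sharp_unit _ _ h (preim gc U) (iso_inv U s) (g y); rewrite gK => /(_ u).
  by rewrite iso_invE => /unit_germ_res; apply; rewrite /preimage /= gK.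
Defined.

Lemma iso_criterion : lrs_iso h.
Proof.
exists iso_inv_hom; split; apply: lrs_ext => [x|V s U u v /=].
- exact: hK.
- by rewrite iso_invE res2; apply: res_irr.
- exact: gK.
apply: (bij_inj (hbij _)).
have e1 : preim (base_cont h) U `<=` preim (base_cont h) (preim gc (preim (base_cont h) V)).
  by move=> x /u.
have e2 : preim (base_cont h) U `<=` preim (base_cont h) V by move=> x /v.
rewrite -(sharp_nat u e1) -(sharp_nat v e2).
apply: (etrans (congr1 (res e1) (iso_invE (sharp h V s)))).
rewrite res2; exact: res_irr.
Qed.
End IsoCriterion.

(** * Descent of weakly subintegral functions along a homeomorphism *)

Section Descent.
Variables (Z W : scheme) (f : lrs_hom Z W) (g : W -> Z).
Hypotheses (fK : cancel (base f) g) (gK : cancel g (base f)) (gc : cont g).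
Hypothesis kmap_surj : forall z v, exists u, kmap f z u = v.
Hypothesis germ_descent : forall z s, germ z (pull f s) -> wsi_germ (base f z) s.

Lemma pull_inj : injective (pull f).
Proof.
move=> s t e; apply: dfunP => w; rewrite -(gK w).
by apply: (@kmap_inj _ _ f (g w)); apply: (congr1 (fun h => h (g w)) e).
Qed.

Lemma pull_surj m : exists s, pull f s = m.
Proof.
(* The value at w lies in [perf_kappa w] while [kmap f z] starts from [perf_kappa (base f z)], hence
   the cast along e. *)
have [s hs] : exists s : dfun (@perf_kappa W), forall w z (e : w = base f z),
    kmap f z (ecast w (perf_kappa w) e (s w)) = m z.
  apply: (choice_dfun (P := fun w v => forall z (e : w = base f z),
    kmap f z (ecast w (perf_kappa w) e v) = m z)) => w.
  have [z0 ->] : exists z, w = base f z by exists (g w); rewrite gK.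
  have [v hv] := kmap_surj (m z0); exists v => z e.
  have ez : z0 = z by apply: (can_inj fK).
  by subst z; rewrite (Prop_irrelevance e erefl).
by exists s; apply: dfunP => z; apply: (hs _ z erefl).
Qed.

(** The coefficients of the two equations of [pull f s] are germs of Z and descend by
    [germ_descent]; as [pull f] is injective the equations descend too, and [wsi_trans] applies. *)
Lemma wsi_germ_descent z s : wsi_germ z (pull f s) -> wsi_germ (base f z) s.
Proof.
move=> ws; have [n [a [Ga ea]]] := wsi_monic (germ_ring z) ws.
have [Q [c [N [n' [m [hQ Gc Gm em e]]]]]] := wsi_poly (germ_ring z) ws.
have [a' ha'] := @choice_ex _ _ (fun i t => pull f t = a i) (fun i => pull_surj (a i)).
have [m' hm'] := @choice_ex _ _ (fun i t => pull f t = m i) (fun i => pull_surj (m i)).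
have [c' hc'] := pull_surj c.
apply: (@wsi_trans _ _ _ _ (germ_ring (base f z)) s n a' Q c' N n' m').
- by move=> i; apply: germ_descent; rewrite ha'.
- apply: pull_inj; rewrite rmorphXn ea rmorph_sum; apply: eq_bigr => i _.
  by rewrite rmorphM rmorphXn /= ha'.
- by rewrite -(eq_pnat _ (fmorph_pchar (kmap f z))).
- by apply: germ_descent; rewrite hc'.
- by move=> i; apply: germ_descent; rewrite hm'.
- move=> i; apply: (@kmap_eq0 _ _ f z); have := em i; rewrite -hm'; exact.
- apply: pull_inj; rewrite !(rmorphXn, rmorphB) /= hc' e rmorph_sum; apply: eq_bigr => i _.
  by rewrite rmorphM !(rmorphXn, rmorphB) /= hm' hc'.
Qed.

Lemma awn_fmap_iso : lrs_iso (awn_fmap f).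
Proof.
apply: (@iso_criterion (awn Z) (awn W) (awn_fmap f) g fK gK gc) => V.
pose F : fsec (S := awn_fsys W) V -> fsec (S := awn_fsys Z) (preim (base_cont f) V) := @psec Z W
  f V.
have Fi : injective F.
  by move=> s t e; apply/fsecP/pull_inj; exact: (congr1 (@fval _ _) e).
have Fs t : exists s, F s = t.
  have [s hs] := pull_surj (fval t).
  have s0 (x : W) : ~ oset V x -> s x = 0.
    rewrite -(gK x) => Vx; apply: (@kmap_eq0 _ _ f (g x)).
    by rewrite -[LHS]/(pull f s (g x)) hs; apply: (fval0 t).
  have sG (x : W) : oset V x -> wsi_germ x s.
    rewrite -(gK x) => Vx; apply: wsi_germ_descent; rewrite hs; exact: (fvalG t Vx).
  by exists (@FSec (awn_fsys W) V s s0 sG); apply/fsecP.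
have [G hG] := @choice_ex _ _ (fun t s => F s = t) Fs.
by exists G => [s|t]; [apply: Fi; rewrite hG|rewrite -[RHS]hG].
Qed.
End Descent.

Lemma awn_map_awn_iso (Y : scheme) : lrs_iso (awn_map (awn Y)).
Proof.
rewrite -awn_fmap_map; apply: (@awn_fmap_iso (awn Y) Y (awn_map Y) id) => //.
- move=> z v; have [Q [V [s [hQ Vz e]]]] := perf_kappa_secfun v.
  have hQ' : [pchar @perf_kappa Y z].-nat Q by rewrite -(eq_pnat _ (fmorph_pchar (kmap (awn_map
    Y) z))).
  (* The power v ^+ Q comes from the residue field of Y through [secfun_awn], and the perfect
     closure contains its Q-th root. *)
  have [u hu] := perf_kappa_root (fval s z) hQ'.
  by exists u; apply: (expr_pnat_inj hQ); rewrite -rmorphXn hu e secfun_awn.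
- move=> z s [V [a [Vz e]]].
  apply: (@wsi_germ_loc _ _ (fval a)); first exact: (fvalG a Vz).
  exists V; split=> // y Vy; apply: (@kmap_inj _ _ (awn_map Y) y).
  by have := e y Vy; rewrite secfun_awn => h; exact: esym h.
Qed.

(** On an affine open set, a section that vanishes at all points lies in all primes, so it is
    nilpotent. *)
Lemma secfun_reduced (Z : scheme) (U : opens Z) (s : sec U) : reduced Z -> secfun s = 0 -> s = 0.
Proof.
move=> rZ s0; apply: sec_eq_local => x Ux.
have [V [[ha _ _ _] Vx VU]] := affine_open_nbhd Ux; exists V, VU; split=> //; rewrite rmorph0.
have [||n] := @prime_notin_power _ [set 0] (res VU s); last by move/rZ.
  by split=> [|a b -> ->|a b ->] //; rewrite ?addr0 ?mulr0.
move=> P _; have [y [Vy hy]] := ha P; apply/hy; rewrite secfun_res //.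
by rewrite s0.
Qed.

(** [awn_map Z] is the identity on points and sends a section to its function of values, which
    determines it as Z is reduced. *)
Lemma awn_map_epi (Z T : scheme) (a b : lrs_hom Z T) : reduced Z ->
  lrs_comp a (awn_map Z) = lrs_comp b (awn_map Z) -> a = b.
Proof.
move=> rZ e; apply: lrs_ext => [x|V s U u v].
  exact: (congr1 (fun h : lrs_hom (awn Z) T => base h x) e).
apply/eqP; rewrite -subr_eq0; apply/eqP; apply: (secfun_reduced rZ).
rewrite secfunB; apply: dfunP => x; rewrite dfunB.
have [Ux|Ux] := pselect (oset U x); last by rewrite !secfun_out // subrr.
rewrite !secfun_res //; apply/eqP; rewrite subr_eq0; apply/eqP.
exact: (congr1 (fun h : lrs_hom (awn Z) T => fval (sharp h V s : fsec (S := awn_fsys Z) _) x) e).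
Qed.

Lemma awn_rigid_of (Y : scheme) :
  (forall (Z : scheme) (f : lrs_hom Z (awn Y)), reduced Z -> universal_homeomorphism f ->
    lrs_iso (awn_fmap f)) -> topologically_rigid (awn Y).
Proof.
move=> H Z f rZ uf; have [r [r1 r2]] := H Z f rZ uf; have [k [k1 k2]] := awn_map_awn_iso Y.
(* The inverse of f: k leads from [awn Y] to its own weak normalization, r from there to [awn Z]. As
   Z is reduced, the other composite can be checked after [awn_map Z]. *)
pose sg := lrs_comp (awn_map Z) (lrs_comp r k).
have sgf : lrs_comp f sg = lrs_id (awn Y).
  rewrite /sg lrs_compA awn_map_natural -lrs_compA [lrs_comp (awn_fmap f) _]lrs_compA r2.
  by rewrite lrs_comp1m k2.
exists sg; split=> //=; apply: (awn_map_epi rZ).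
rewrite [RHS]lrs_comp1m -[LHS]lrs_compA (awn_map_natural f) /sg -[LHS]lrs_compA -[lrs_comp
  (lrs_comp r k) _]lrs_compA.
by rewrite [lrs_comp k _]lrs_compA k1 lrs_comp1m r1 lrs_compm1.
Qed.

Lemma awn_map_rigid_iso (T : scheme) : topologically_rigid T -> lrs_iso (awn_map T).
Proof. by move=> h; apply: h (@awn_reduced T) (@awn_map_universal_homeomorphism T). Qed.

Lemma awn_coreflection (T Y : scheme) (f : lrs_hom T Y) : topologically_rigid T ->
  exists! g : lrs_hom T (awn Y), lrs_comp (awn_map Y) g = f.
Proof.
move=> /awn_map_rigid_iso[k [k1 k2]]; exists (lrs_comp (awn_fmap f) k); split.
  by rewrite lrs_compA -awn_map_natural -lrs_compA k2 lrs_compm1.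
(* Idempotence and naturality recover g from its composite with [awn_map Y]. *)
move=> g <-; rewrite awn_fmap_comp awn_fmap_map -awn_map_natural -lrs_compA k2.
exact: lrs_compm1.
Qed.

(** * Right adjoints from universal arrows *)

Section Coreflection.
Variables (C : category) (P : C -> Prop) (R : C -> C) (eps : forall d, hom (R d) d).
Hypothesis RP : forall d, P (R d).
Hypothesis univ : forall (c d : C) (f : hom c d), P c -> exists! g : hom c (R d), eps d \;o g = f.

Let lift c d (Pc : P c) (f : hom c d) : hom c (R d) := projT1 (cid (univ f Pc)).

Let liftP c d (Pc : P c) (f : hom c d) : eps d \;o lift Pc f = f.
Proof. exact: (projT2 (cid (univ f Pc))).1. Qed.

Let liftU c d (Pc : P c) (f : hom c d) g : eps d \;o g = f -> lift Pc f = g.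
Proof. exact: (projT2 (cid (univ f Pc))).2. Qed.

Definition coreflector : functor C (full_subcategory P).
Proof.
refine (@Functor C (full_subcategory P) (fun d => exist _ (R d) (RP d))
  (fun a b f => lift (RP a) (f \;o eps a)) _ _).
- by move=> a; apply: liftU; rewrite comp1m compm1.
- move=> a b c g f; apply: liftU; rewrite /= compA liftP -compA liftP.
  exact: compA.
Defined.

Lemma coreflective_right_adjoint : has_right_adjoint (inclusion P).
Proof.
exists coreflector; constructor.
refine (@Adjunction _ _ (inclusion P) coreflector (fun c d f => lift (proj2_sig c) f) _ _ _).
- move=> c d; exists (fun g => eps d \;o g) => [f|g]; first exact: liftP.
  exact: liftU.
- move=> c c' d u f; apply: liftU.
  by rewrite [LHS]compA liftP.
- move=> c d d' v f; apply: liftU.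
  by rewrite [LHS]compA liftP -[LHS]compA liftP.
Qed.
End Coreflection.

(** * Spectra of reduced rings and morphisms to affine open subsets *)

Definition reduced_ring (C : comPzRingType) := forall (a : C) n, a ^+ n = 0 -> a = 0.

Lemma reduced_primes (C : comPzRingType) (a : C) : reduced_ring C ->
  (forall P : prime_ideal C, pideal P a) -> a = 0.
Proof.
move=> rC h; have [||n] := @prime_notin_power _ [set 0] a; last by move/rC.
  by split=> [|b c -> ->|b c ->] //; rewrite ?addr0 ?mulr0.
by move=> P _.
Qed.

Section Spec.
Variables (C : comPzRingType) (rC : reduced_ring C).
Local Notation T := (prime_ideal C : topologicalType).

Definition Spec_field (P : T) : fieldType := resfield P.

(* As [C] is reduced, its structure sheaf consists of functions with values in
   the residue fields which are locally fractions. *)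
Definition Spec_germ (P : T) : set (dfun Spec_field) := [set s | exists f a, ~ pideal P f /\
  forall Q : T, ~ pideal Q f -> s Q * rval Q f = rval Q a].

Lemma Spec_germ_ring P : subring (Spec_germ P).
Proof.
split.
- by exists 1, 1; split=> [|Q _]; [apply: pideal1|rewrite rmorph1 mulr1].
- move=> s t [f [a [Pf e]]] [g [b [Pg e']]]; exists (f * g), (a * g - b * f).
  split=> [|Q Qfg]; first exact: pidealMN.
  have Qf : ~ pideal Q f by move=> h; apply/Qfg/pidealMr.
  have Qg : ~ pideal Q g by move=> h; apply/Qfg/pidealM.
  by rewrite dfunB rmorphB !rmorphM /= -e // -e' //; ring.
- move=> s t [f [a [Pf e]]] [g [b [Pg e']]]; exists (f * g), (a * b).
  split=> [|Q Qfg]; first exact: pidealMN.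
  have Qf : ~ pideal Q f by move=> h; apply/Qfg/pidealMr.
  have Qg : ~ pideal Q g by move=> h; apply/Qfg/pidealM.
  by rewrite dfunM !rmorphM /= -e // -e' //; ring.
Qed.

Lemma Spec_germ_loc P s t : Spec_germ P s -> near_eq P s t -> Spec_germ P t.
Proof.
move=> [f [a [Pf e]]] [V [VP eV]]; have [g [Pg gV]] := open_basic (osetP V) VP.
exists (f * g), (a * g); split=> [|Q Qfg]; first exact: pidealMN.
have Qf : ~ pideal Q f by move=> h; apply/Qfg/pidealMr.
have Qg : ~ pideal Q g by move=> h; apply/Qfg/pidealM.
by rewrite -eV; [rewrite !rmorphM /= -e // mulrA|apply: gV].
Qed.

Definition Spec_fsys : fsys := FSys Spec_germ_ring Spec_germ_loc.

Definition opensT (S : topologicalType) : opens S := Opens openT.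

Program Definition Spec_val (a : C) : fsec (S := Spec_fsys) (opensT T) :=
  @FSec Spec_fsys (opensT T) (fun Q => rval Q a) _ _.
Next Obligation. by move=> a x []. Qed.
Next Obligation.
by move=> a P _; exists 1, a; split=> [|Q _]; [apply: pideal1|rewrite rmorph1 mulr1].
Qed.

Lemma Spec_val_zmod : zmod_morphism Spec_val.
Proof. by move=> a b; apply/fsecP/dfunP => Q; apply: rmorphB. Qed.
Lemma Spec_val_monoid : monoid_morphism Spec_val.
Proof.
split=> [|a b]; apply/fsecP/dfunP => Q; last exact: rmorphM.
by rewrite /= indT // rmorph1.
Qed.
HB.instance Definition _ := GRing.isZmodMorphism.Build C (fsec (S := Spec_fsys) (opensT T))
  Spec_val Spec_val_zmod.
HB.instance Definition _ := GRing.isMonoidMorphism.Build C (fsec (S := Spec_fsys) (opensT T))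
  Spec_val Spec_val_monoid.

Lemma Spec_chart : is_affine_chart (X := fspace Spec_fsys) (U := opensT T)
  (idfun : prime_ideal C -> fspace Spec_fsys) (Spec_val : {rmorphism C -> sec (r := fspace
    Spec_fsys) (opensT T)}).
Proof.
split=> //.
- by apply/seteqP; split=> x // _; exists x.
- by move=> W Wo; rewrite image_id.
move=> f V h e; have hV Q : oset V Q <-> ~ pideal Q f.
  by rewrite -[oset V Q]/((V : set _) Q) -e image_id.
have rf (Q : T) : ~ pideal Q f -> rval Q f != 0 by move=> Qf; apply/eqP => /rval_eq0.
split.
- pose u : dfun Spec_field := fun Q => if `[<oset V Q>] then (rval Q f)^-1 else 0.
  have u0 Q : ~ oset V Q -> u Q = 0 by rewrite /u; case: asboolP.
  have uG Q : oset V Q -> Spec_germ Q u.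
    move=> /hV Qf; exists f, 1; split=> // Q' Qf'; rewrite /u; case: asboolP => [_|/hV //].
    by rewrite mulVf ?rmorph1 // rf.
  exists (@FSec Spec_fsys V u u0 uG); apply: fsec_eq => Q VQ.
  rewrite /= !dfunM !indT // mul1r /u /=; case: asboolP => // _.
  by rewrite mulfV // rf //; apply/hV.
- move=> b.
  (* The c for which c * b is given by an element of C on V form an ideal, which no prime of V
     contains; so some power of f is such a denominator. *)
  have [||n [a ha]] := @prime_notin_power _ [set c | exists a, forall Q : T, ~ pideal Q f ->
      rval Q c * fval b Q = rval Q a] f.
  + split.
    * by exists 0 => Q _; rewrite rmorph0 mul0r.
    * by move=> c d [a ha] [a' ha']; exists (a + a') => Q Qf; rewrite !rmorphD mulrDl /= ha //
      ha'.
    * by move=> c d [a ha]; exists (c * a) => Q Qf; rewrite !rmorphM /= -mulrA ha.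
  + move=> P hP; apply: contrapT => Pf; have VP := (hV P).2 Pf.
    have [g [a [Pg e']]] := fvalG b VP.
    (* The second factor g makes the identity true also at the primes containing g, about which [e']
       is silent. *)
    suff : pideal P (g * g) by move/pideal_prime => [].
    apply: hP; exists (g * a) => Q Qf; rewrite !rmorphM /=.
    have [Qg|Qg] := pselect (pideal Q g); last by rewrite -e' //; ring.
    by rewrite (rval_eq0 Q g).2 // !mul0r.
  exists n, a; apply: fsec_eq => Q VQ; rewrite [LHS]dfunM fvalX //=.
  rewrite !dfunM !indT // !mul1r /= -ha; last exact/hV.
  by rewrite rmorphXn mulrC.
(* The product a * f lies in every prime, so it is 0 in the reduced ring C. *)
- move=> a a0; exists 1%N; rewrite expr1; apply: (reduced_primes rC) => Q.
  have [Qf|Qf] := pselect (pideal Q f); first exact: pidealM.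
  apply: pidealMr; apply/rval_eq0; have VQ := (hV Q).2 Qf.
  have := congr1 (fun s : fsec (S := Spec_fsys) V => fval s Q) a0.
  by rewrite /= dfunM indT // mul1r.
Qed.

Lemma Spec_cover (x : fspace Spec_fsys) : exists (U : opens (fspace Spec_fsys)) (A :
  comPzRingType)
      (psi : prime_ideal A -> fspace Spec_fsys) (iota : {rmorphism A -> sec U}),
    oset U x /\ is_affine_chart psi iota.
Proof. by exists (opensT T), C, idfun, Spec_val; split=> //; apply: Spec_chart. Qed.

Definition Spec : scheme := Scheme Spec_cover.

Definition Spec_iota : {rmorphism C -> sec (r := Spec) (opensT T)} := Spec_val.

Lemma Spec_affine_open : affine_open (X := Spec) (opensT T).
Proof. exact: (@affine_open_chart Spec C _ _ _ Spec_chart). Qed.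

Lemma Spec_iota_inj : injective Spec_iota.
Proof.
move=> a b e; apply/eqP; rewrite -subr_eq0; apply/eqP/(reduced_primes rC) => Q.
apply/rval_eq0; rewrite rmorphB; apply/eqP; rewrite subr_eq0; apply/eqP.
exact: (congr1 (fun s : fsec (S := Spec_fsys) (opensT T) => fval s Q) e).
Qed.

Lemma Spec_iota_surj s : exists a, Spec_iota a = s.
Proof.
have [_ _ _ _ hl] := Spec_chart.
have [|_ is1 _] := hl 1 (opensT T) (@subset_refl _ _).
  by rewrite image_id; apply/seteqP; split=> Q //= _; apply: pideal1.
have [n [a]] := is1 s; rewrite /= => ea; exists a; move: ea; rewrite !(@res_id (fspace
  Spec_fsys)) rmorph1 expr1n mulr1 => ->.
by [].
Qed.

Lemma Spec_secfun (a : C) (Q : Spec) : secfun (Spec_iota a) Q = 0 <-> pideal (Q : prime_ideal C)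
  a.
Proof.
rewrite not_secfun_unit (chart_unit Spec_chart Q a); split=> [/contrapT|] //.
by move=> h; apply.
Qed.
End Spec.

Section MapsToAffine.
Variables (S X : scheme) (V : opens X) (hV : affine_open V).
Variable phi : {rmorphism sec V -> sec (opensT S)}.
Variable h : S -> X.
Hypothesis hin : forall y, oset V (h y).
Hypothesis hphi : forall y s, secfun s (h y) = 0 <-> secfun (phi s) y = 0.

(* Near each point, [s = a / f] and [t = phi a / phi f] for some [a] and [f]. *)
Definition induced (W : opens X) (s : sec W) (E : opens S) (t : sec E) :=
  forall y, oset E y -> exists f a (D : opens X) (hDW : D `<=` W) (hDV : D `<=` V)
    (E0 : opens S) (hE : E0 `<=` E) (hT : E0 `<=` opensT S),
  [/\ oset D (h y), oset E0 y, secfun f (h y) <> 0,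
      res hDW s * res hDV f = res hDV a & res hE t * res hT (phi f) = res hT (phi a)].

(** Two descriptions a / f and a' / f' of s agree near h y, so a power of some g kills a * f' - a' *
    f in [sec V]. Applying phi, where phi (f * f' * g) is a unit near y, gives t = t' there. *)
Lemma induced_fun W (s : sec W) E (t t' : sec E) : induced s t -> induced s t' -> t = t'.
Proof.
move=> it it'; apply: sec_eq_local => y Ey.
have [f [a [D [hDW [hDV [E0 [hE [hT [Dy E0y fy e1 e2]]]]]]]]] := it y Ey.
have [f' [a' [D' [hDW' [hDV' [E0' [hE' [hT' [Dy' E0y' fy' e1' e2']]]]]]]]] := it' y Ey.
have [_ _ hc hd] := hV.
have [g [gy gD]] := hc (h y) (opensI D D') (hin y) (conj Dy Dy').
have hg : unit_opens g `<=` V by apply: unit_opens_sub.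
have glob : unit_opens g `<=` D by move=> x /unit_opensP/gD [].
have gr : unit_opens g `<=` D' by move=> x /unit_opensP/gD [].
have [_ _ ker] := hd g (unit_opens g) hg (fun x => unit_opensP g x).
have gW : unit_opens g `<=` W by move=> x /glob/hDW.
have {}e1 : res gW s * res hg f = res hg a.
  by have := congr1 (res glob) e1; rewrite rmorphM !res2 !(res_irr _ gW) !(res_irr _ hg).
have {}e1' : res gW s * res hg f' = res hg a'.
  by have := congr1 (res gr) e1'; rewrite rmorphM !res2 !(res_irr _ gW) !(res_irr _ hg).
have [|n en] := ker (a * f' - a' * f).
  by rewrite rmorphB !rmorphM -e1 -e1' /=; ring.
pose u := f * f' * g.
have uy : secfun u (h y) <> 0.
  rewrite /u !secfunM !dfunM => /eqP; rewrite !mulf_eq0 => /orP[/orP[]|] /eqP //.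
pose O1 := opensI (opensI E0 E0') (unit_opens (phi u)).
have O1y : oset O1 y by split=> //; apply/unit_opensP => /hphi.
have O1l : O1 `<=` E0 by move=> x [[]].
have O1r : O1 `<=` E0' by move=> x [[]].
have O1E : O1 `<=` E by move=> x /O1l/hE.
have O1T : O1 `<=` opensT S by [].
exists O1, O1E; split=> //.
have [w wu] : exists w, res O1T (phi u) * w = 1.
  by apply: unit_section => x O1x; apply/(unit_germ_res _ _ O1x); have [_] := O1x.
have {}e2 : res O1E t * res O1T (phi f) = res O1T (phi a).
  by have := congr1 (res O1l) e2; rewrite rmorphM !res2 !(res_irr _ O1E) !(res_irr _ O1T).
have {}e2' : res O1E t' * res O1T (phi f') = res O1T (phi a').
  by have := congr1 (res O1r) e2'; rewrite rmorphM !res2 !(res_irr _ O1E) !(res_irr _ O1T).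
have := congr1 (fun x => res O1T (phi x)) en; rewrite !(rmorphM, rmorphB, rmorphXn, rmorph0) -e2
  -e2'.
move: wu; rewrite /u !rmorphM.
move: (res O1E t) (res O1E t') (res O1T (phi f)) (res O1T (phi f')) (res O1T (phi g)).
move=> T T' F F' G wu eG.
have {}eG : (T - T') * (F * F' * G) ^+ n.+1 = 0.
  rewrite exprS !exprMn (_ : _ * _ = (T * F * F' - T' * F' * F) * G ^+ n * (G * F ^+ n * F' ^+
    n)).
    by rewrite eG mul0r.
  by ring.
apply/eqP; rewrite -subr_eq0 -[_ - _]mulr1 -(expr1n _ n.+1) -wu exprMn mulrA eG mul0r.
exact: eqxx.
Qed.

Lemma induced_res W (s : sec W) E (t : sec E) (W' : opens X) (hW : W' `<=` W) (E' : opens S) (hE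
  : E' `<=` E) :
  (forall y, oset E' y -> oset W' (h y)) -> induced s t -> induced (res hW s) (res hE t).
Proof.
move=> EW it y Ey.
have [f [a [D [hDW [hDV [E0 [hE0 [hT [Dy E0y fy e1 e2]]]]]]]]] := it y (hE _ Ey).
have iV : opensI D W' `<=` V by move=> x [/hDV].
have iT : opensI E0 E' `<=` opensT S by [].
exists f, a, (opensI D W'), (@opIr _ _ _), iV, (opensI E0 E'), (@opIr _ _ _), iT.
split=> //; first by split=> //; apply: EW.
  have := congr1 (res (@opIl _ D W')) e1; rewrite rmorphM !res2 !(res_irr _ iV) => <-.
  by congr (_ * _); apply: res_irr.
have := congr1 (res (@opIl _ E0 E')) e2; rewrite rmorphM !res2 !(res_irr _ iT) => <-.
by congr (_ * _); apply: res_irr.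
Qed.

Lemma induced_local W (s : sec W) E (t : sec E) :
  (forall y, oset E y -> exists (E' : opens S) (hE : E' `<=` E), oset E' y /\ induced s (res hE
    t)) ->
  induced s t.
Proof.
move=> H y Ey; have [E' [hE [Ey' it]]] := H y Ey.
have [f [a [D [hDW [hDV [E0 [hE0 [hT [Dy E0y fy e1 e2]]]]]]]]] := it y Ey'.
exists f, a, D, hDW, hDV, E0, (subset_trans hE0 hE), hT; split=> //.
by rewrite -e2 res2.
Qed.

Lemma induced2 W (s s' : sec W) E (t t' : sec E) : induced s t -> induced s' t' ->
  induced (s - s') (t - t') /\ induced (s * s') (t * t').
Proof.
move=> it it'; split=> y Ey;
have [f [a [D [hDW [hDV [E0 [hE [hT [Dy E0y fy e1 e2]]]]]]]]] := it y Ey;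
have [f' [a' [D' [hDW' [hDV' [E0' [hE' [hT' [Dy' E0y' fy' e1' e2']]]]]]]]] := it' y Ey;
have iV : opensI D D' `<=` V by [move=> x [/hDV]];
have iW : opensI D D' `<=` W by [move=> x [/hDW]];
have iT : opensI E0 E0' `<=` opensT S by [];
have iE : opensI E0 E0' `<=` E by [move=> x [/hE]];
have {}e1 : res iW s * res iV f = res iV a by
  [have := congr1 (res (@opIl _ D D')) e1; rewrite rmorphM !res2 !(res_irr _ iV) !(res_irr _ iW)];
have {}e1' : res iW s' * res iV f' = res iV a' by
  [have := congr1 (res (@opIr _ D D')) e1'; rewrite rmorphM !res2 !(res_irr _ iV) !(res_irr _
    iW)];
have {}e2 : res iE t * res iT (phi f) = res iT (phi a) by
  [have := congr1 (res (@opIl _ E0 E0')) e2; rewrite rmorphM !res2 !(res_irr _ iE) !(res_irr _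
    iT)];
have {}e2' : res iE t' * res iT (phi f') = res iT (phi a') by
  [have := congr1 (res (@opIr _ E0 E0')) e2'; rewrite rmorphM !res2 !(res_irr _ iE) !(res_irr _
    iT)];
have ff : secfun (f * f') (h y) <> 0 by
  [move=> /eqP; rewrite secfunM dfunM mulf_eq0 => /orP[]/eqP].
  exists (f * f'), (a * f' - a' * f), (opensI D D'), iW, iV, (opensI E0 E0'), iE, iT.
  by split=> //; rewrite !(rmorphB, rmorphM) -?e1 -?e1' -?e2 -?e2' /=; ring.
exists (f * f'), (a * a'), (opensI D D'), iW, iV, (opensI E0 E0'), iE, iT.
by split=> //; rewrite !rmorphM -?e1 -?e1' -?e2 -?e2' /=; ring.
Qed.

Lemma induced1 W E : (forall y, oset E y -> oset W (h y)) -> induced (1 : sec W) (1 : sec E).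
Proof.
move=> EW y Ey; have iT : E `<=` opensT S by [].
exists 1, 1, (opensI W V), (@opIl _ _ _), (@opIr _ _ _), E, (@subset_refl _ _), iT.
split=> //; try by rewrite !rmorph1 mul1r.
- by split; [apply: EW|apply: hin].
- by rewrite secfun1 // => /eqP; rewrite oner_eq0.
Qed.

Lemma induced_near W (s : sec W) y : oset W (h y) ->
  exists E (t : sec E), [/\ oset E y, (forall z, oset E z -> oset W (h z)) & induced s t].
Proof.
move=> Wy; have [_ _ hc hd] := hV.
have [g [gy gW]] := hc (h y) W (hin y) Wy.
have hg : unit_opens g `<=` V by apply: unit_opens_sub.
have hgW : unit_opens g `<=` W by move=> x /unit_opensP/gW.
have [_ frac _] := hd g (unit_opens g) hg (fun x => unit_opensP g x).
have [n [a ea]] := frac (res hgW s).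
pose E := unit_opens (phi g); have ET : E `<=` opensT S by [].
have [w wu] : exists w, res ET (phi g) * w = 1.
  by apply: unit_section => x ux; apply/(unit_germ_res _ _ ux).
exists E, (res ET (phi a) * w ^+ n); split.
- by apply/unit_opensP => /hphi.
- by move=> z /unit_opensP gz; apply: gW => /hphi.
move=> z Ez; exists (g ^+ n), a, (unit_opens g), hgW, hg, E, (@subset_refl _ _), ET.
have gz : secfun g (h z) <> 0 by move: Ez => /unit_opensP gz /hphi.
split=> //.
- exact/unit_opensP.
- by rewrite secfunX_in // => /eqP; rewrite expf_eq0 => /andP[_ /eqP].
- by rewrite rmorphXn ea.
- by rewrite res_id !rmorphXn -mulrA -exprMn mulrC [w * _]mulrC wu expr1n mul1r.
Qed.

(** Local solutions agree on overlaps by [induced_fun], hence glue. *)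
Lemma induced_ex W (s : sec W) (E : opens S) : (forall y, oset E y <-> oset W (h y)) ->
  exists t : sec E, induced s t.
Proof.
move=> EW; pose I := {y | oset E y}.
have [F hF] := @choice_ex I (opens S) (fun i F => exists t : sec F,
  [/\ oset F (proj1_sig i), (forall z, oset F z -> oset W (h z)) & induced s t])
  (fun i => induced_near s ((EW (proj1_sig i)).1 (proj2_sig i))).
have [t ht] := @choice_dfun I (fun i => sec (F i)) (fun i t =>
  [/\ oset (F i) (proj1_sig i), (forall z, oset (F i) z -> oset W (h z)) & induced s t]) hF.
have hsub i : F i `<=` E by move=> z; have [_ h1 _] := ht i; move=> /h1/EW.
have cov : E `<=` \bigcup_i F i by move=> y Ey; exists (exist _ y Ey) => //; have [] := ht (exist
  _ y Ey).
have sW : W `<=` W by [].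
have [|u [hu _]] := @res_glue S I E F hsub t cov.
  move=> i j; apply: (@induced_fun W (res sW s)); apply: induced_res.
  - by move=> y [/hsub/EW].
  - by have [] := ht i.
  - by move=> y [/hsub/EW].
  - by have [] := ht j.
exists u; apply: induced_local => y Ey; have [i _ Fy] := cov _ Ey.
by exists (F i), (hsub i); split=> //; rewrite hu; have [] := ht i.
Qed.

Lemma affine_map_cont : cont h.
Proof.
move=> W Wo; apply: open_local => y Wy; have [_ _ hc _] := hV.
have [g [gy gW]] := hc (h y) (Opens Wo) (hin y) Wy.
exists (unit_opens (phi g)); split; first by apply/unit_opensP => /hphi.
by move=> z /unit_opensP gz; apply: gW => /hphi.
Qed.

Lemma induced_phi (a : sec V) (E : opens S) (hT : E `<=` opensT S) : induced a (res hT (phi a)).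
Proof.
move=> y Ey; exists 1, a, V, (@subset_refl _ _), (@subset_refl _ _), E, (@subset_refl _ _), hT.
split=> //; first by rewrite secfun1 // => /eqP; rewrite oner_eq0.
  by rewrite !res_id mulr1.
by rewrite !res_id !rmorph1 mulr1.
Qed.

Lemma affine_map_ex : exists f : lrs_hom S X, (forall y, base f y = h y) /\
  forall (a : sec V) (u : opensT S `<=` preim (base_cont f) V), res u (sharp f V a) = phi a.
Proof.
pose hc := affine_map_cont.
have sh_ex (W : opens X) : exists sh : {rmorphism sec W -> sec (preim hc W)},
    forall s, induced s (sh s).
  have [sh hsh] := @choice_ex (sec W) (sec (preim hc W)) (fun s t => induced s t)
    (fun s => @induced_ex W s (preim hc W) (fun y => conj id id)).
  have shB : zmod_morphism sh.
    by move=> s t; apply: (induced_fun (hsh _)); apply: (induced2 (hsh s) (hsh t)).1.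
  have shM : monoid_morphism sh.
    split=> [|s t]; apply: (induced_fun (hsh _)); first exact: induced1.
    exact: (induced2 (hsh s) (hsh t)).2.
  pose p1 := GRing.isZmodMorphism.Build _ _ sh shB.
  pose p2 := GRing.isMonoidMorphism.Build _ _ sh shM.
  pose sh' : {rmorphism sec W -> sec (preim hc W)} := HB.pack sh p1 p2.
  by exists sh'.
have [sh hsh] := choice_dfun sh_ex.
have nat (U W : opens X) (i : W `<=` U) (i' : preim hc W `<=` preim hc U) (s : sec U) :
    res i' (sh U s) = sh W (res i s).
  by apply: (induced_fun _ (hsh _ _)); apply: induced_res (hsh _ _).
have loc (x : S) (W : opens X) (s : sec W) : oset W (h x) -> unit_germ x (sh W s) -> unit_germ (h
  x) s.
  move=> Wx us; have [f [a [D [hDW [hDV [E0 [hE [hT [Dy E0y fy e1 e2]]]]]]]]] := hsh W s x Wx.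
  have : secfun (phi a) x <> 0.
    apply/secfun_unit/(unit_germ_res hT _ E0y); rewrite -e2; apply/unit_germM; split.
      exact/unit_germ_res.
    by apply/unit_germ_res => //; apply/secfun_unit => /hphi.
  move=> ax; have : secfun a (h x) <> 0 by move/hphi.
  by move/secfun_unit/(unit_germ_res hDV _ Dy); rewrite -e1 => /unit_germM[/unit_germ_res -/(_
    Dy)].
exists (@LrsHom S X h hc sh nat loc); split=> // a u /=.
have tT : opensT S `<=` opensT S by [].
apply: (@induced_fun V (res (@subset_refl _ V) a)).
  exact: induced_res (hsh _ _).
by rewrite res_id -[phi a](res_id tT); apply: induced_phi.
Qed.
End MapsToAffine.

Section MapsToAffineUniqueness.
Variables (S X : scheme) (V : opens X) (hV : affine_open V).

(** Near each point s is a fraction of sections over V, so a morphism landing in V is governed by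
    its effect on [sec V]; uniqueness then comes from [induced_fun]. *)
Lemma hom_induced (f : lrs_hom S X) (u : opensT S `<=` preim (base_cont f) V) W (s : sec W)
    (E : opens S) (e : E `<=` preim (base_cont f) W) :
  induced (res u \o sharp f V) (base f) s (res e (sharp f W s)).
Proof.
move=> y Ey; have Vy : oset V (base f y) by apply: u.
have [_ _ hc hd] := hV; have Wy := e _ Ey.
have [g [gy gW]] := hc (base f y) W Vy Wy.
have hg : unit_opens g `<=` V by apply: unit_opens_sub.
have hgW : unit_opens g `<=` W by move=> x /unit_opensP/gW.
have [_ frac _] := hd g (unit_opens g) hg (fun x => unit_opensP g x).
have [n [a ea]] := frac (res hgW s).
pose E0 := opensI E (preim (base_cont f) (unit_opens g)).
have ET : E0 `<=` opensT S by [].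
have Eg : preim (base_cont f) (unit_opens g) `<=` preim (base_cont f) V by move=> x /hg.
have EW : preim (base_cont f) (unit_opens g) `<=` preim (base_cont f) W by move=> x /hgW.
exists (g ^+ n), a, (unit_opens g), hgW, hg, E0, (@opIl _ _ _), ET; split=> //.
- exact/unit_opensP.
- by split=> //; apply/unit_opensP.
- by rewrite secfunX_in // => /eqP; rewrite expf_eq0 => /andP[_ /eqP].
- by rewrite rmorphXn ea.
have := congr1 (fun x => res (@opIr _ _ _ : E0 `<=` _) (sharp f _ x)) ea.
rewrite /= !(rmorphM, rmorphXn) -(sharp_nat hgW EW) -!(sharp_nat hg Eg) !res2 => E1.
etransitivity; [|etransitivity; [exact: E1|]]; last exact: res_irr.
by congr (_ * _ ^+ _); apply: res_irr.
Qed.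

Lemma affine_map_uniq (f g : lrs_hom S X) (u : opensT S `<=` preim (base_cont f) V)
    (v : opensT S `<=` preim (base_cont g) V) :
  (forall a : sec V, res u (sharp f V a) = res v (sharp g V a)) -> f = g.
Proof.
move=> e; have [_ hb _ _] := hV.
have fz (k : lrs_hom S X) (w : opensT S `<=` preim (base_cont k) V) y s :
    secfun s (base k y) = 0 <-> secfun (res w (sharp k V s)) y = 0.
  rewrite secfun_res // -kmapE; split=> [->|/kmap_eq0 //]; exact: rmorph0.
have ebase : base f = base g.
  apply: funext => y; apply: hb => [||s]; [exact: (u y I)|exact: (v y I)|].
  by rewrite (fz f u) (fz g v) e.
apply: lrs_ext => [x|W s U uf ug]; first by rewrite ebase.
apply: (@induced_fun S X V hV (res u \o sharp f V) (base f) _ _ W s).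
- by move=> y; exact: (u y I).
- by move=> y t; apply: fz.
- exact: hom_induced.
have E : (res v \o sharp g V : {rmorphism sec V -> sec (opensT S)}) =
    (res u \o sharp f V : {rmorphism sec V -> sec (opensT S)}).
  by apply: rmorph_eq => a /=; rewrite e.
(* The section is generalized before the base map is rewritten, because its expression depends on
   g. *)
by have := hom_induced v s ug; rewrite E; move: (res ug _) => t; rewrite -ebase.
Qed.
End MapsToAffineUniqueness.

(** * Universal homeomorphisms of reduced schemes *)

Lemma coef_XsubC_exp (L : fieldType) (beta : L) r : (0 < r)%N ->
  (('X - beta%:P) ^+ r)`_r.-1 = - (beta *+ r).
Proof.
move=> r0; have := @coefPn_prod_XsubC _ (nseq r beta); rewrite size_nseq => /(_ _).
rewrite !big_nseq; set lhs := iter _ _ _; rewrite (_ : lhs = ('X - beta%:P) ^+ r); last first.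
  by rewrite /lhs; elim: r {r0 lhs} => //= r ->; rewrite exprS.
move=> ->; last by rewrite -lt0n.
by congr (- _); elim: r {r0 lhs} => //= r ->; rewrite mulrS.
Qed.

Section PurelyInseparable.
Variables (k L : fieldType) (j : {rmorphism k -> L}).

(** If r is invertible in L, the coefficient - r beta in degree r - 1 recovers beta. Otherwise the
    characteristic p divides r, and the induction continues with beta ^+ p and r / p. *)
Lemma purely_inseparable_root r (beta : L) (m : {poly k}) : (0 < r)%N ->
  map_poly j m = ('X - beta%:P) ^+ r ->
  exists Q v, [pchar L].-nat Q /\ beta ^+ Q = j v.
Proof.
have [n] := ubnP r; elim: n => // n IH in r beta m *; rewrite ltnS => rn r0 e.
have [rz|rnz] := eqVneq (r%:R : L) 0; last first.
  have := congr1 (fun p : {poly L} => p`_r.-1) e; rewrite coef_map coef_XsubC_exp //= => e1.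
  exists 1%N, (- m`_r.-1 / r%:R); split=> //.
  by rewrite expr1 rmorphM fmorphV rmorph_nat rmorphN e1 opprK -[beta *+ r]mulr_natr mulfK.
have [p hp] := natf0_pchar r0 (introT eqP rz).
have pr : (p %| r)%N by rewrite (dvdn_pcharf hp) rz.
have pp := pcharf_prime hp; have p0 := prime_gt0 pp; have p1 := prime_gt1 pp.
case/dvdnP: pr => r' er; rewrite er in e rn r0.
have r'0 : (0 < r')%N by case: (r') r0.
have frob : ('X - beta%:P) ^+ p = ('X - (beta ^+ p)%:P) \Po 'X^p :> {poly L}.
  have hp' : [pchar {poly L}].-nat p.
    by rewrite pnatE // (rmorph_pchar (@polyC L : {rmorphism _ -> _}) hp).
  rewrite comp_polyB comp_polyX comp_polyC; apply/eqP; rewrite eq_sym subr_eq.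
  by rewrite rmorphXn -exprDn_pchar // subrK.
(* As ('X - beta) ^+ p is a polynomial in 'X^p, the coefficients of m in degrees p * i form a
   polynomial with image ('X - beta ^+ p) ^+ r'. *)
have [|||Q [v [hQ ev]]] := IH r' (beta ^+ p) (\poly_(i < r'.+1) m`_(p * i)).
- by apply: leq_trans rn; rewrite -{1}(muln1 r') ltn_pmul2l.
- exact: r'0.
- apply/polyP => i; rewrite coef_map coef_poly.
  have := congr1 (fun q : {poly L} => q`_(p * i)) e.
  rewrite [(r' * p)%N]mulnC exprM frob -rmorphXn /= coef_map coef_comp_poly_Xn // dvdn_mulr //
    mulKn // => E.
  rewrite -E; case: ifP => // /negbT; rewrite -leqNgt => hi.
  by rewrite rmorph0 E nth_default // size_exp_XsubC.
by exists (p * Q)%N, v; rewrite exprM ev pnatM hQ pnatE // hp.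
Qed.
End PurelyInseparable.

Lemma split_power (L : fieldType) (q : {poly L}) (beta : L) : q != 0 ->
  (forall h : {poly L}, h %| q -> h.[beta] != 0 -> (size h <= 1)%N) ->
  exists r c, c != 0 /\ q = c *: ('X - beta%:P) ^+ r.
Proof.
move=> q0 H; have [r [h hb eh]] := multiplicity_XsubC q beta; rewrite q0 /= in hb.
have hq : h %| q by rewrite eh dvdp_mulr.
have h0 : h != 0 by apply: contraNneq q0 => h0; rewrite eh h0 mul0r.
have /size1_polyC e : (size h <= 1)%N by apply: H => //; move: hb; rewrite /root.
exists r, h`_0; split; first by rewrite -polyC_eq0 -e.
by rewrite eh -mul_polyC -e.
Qed.

(** * Ring maps inducing a homeomorphism on affine lines *)

Section UniversalHomeomorphismAlgebra.
Variables (A B : comNzRingType) (phi : {rmorphism A -> B}).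
Local Notation Phi := (map_poly phi : {rmorphism {poly A} -> {poly B}}).
Variable g : prime_ideal {poly A} -> prime_ideal {poly B}.
Hypotheses (cK : forall Q, g (comap Phi Q) = Q) (gK : forall P, comap Phi (g P) = P).
Hypothesis gc : cont g.

(** By continuity of g, the closed set of primes containing F is cut out by polynomials with
    coefficients in A. *)
Lemma homeo_specialization (Q0 Q1 : prime_ideal {poly B}) :
  (forall F : {poly A}, pideal Q0 (Phi F) -> pideal Q1 (Phi F)) ->
  forall F, pideal Q0 F -> pideal Q1 F.
Proof.
move=> sub F Q0F; apply: contrapT => Q1F.
have [E hE] := gc (openD F).
have : (g @^-1` Dset F) (comap Phi Q1) by rewrite /preimage /= cK.
rewrite hE /= => /existsNP[G /not_implyP[EG Q1G]].
suff : (g @^-1` Dset F) (comap Phi Q0) by rewrite /preimage /= cK.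
by rewrite hE /= => /(_ G EG) /sub.
Qed.

Lemma one_minus_X_power (G : {poly A}) N : exists G', (1 - 'X * G) ^+ N = 1 - 'X * G'.
Proof.
elim: N => [|N [G' IH]]; first by exists 0; rewrite expr0 mulr0 subr0.
by exists (G + G' - 'X * G * G'); rewrite exprS IH; ring.
Qed.

(* The image [C] of [V (b X - 1)] is closed. A prime containing ['X] and all the
   polynomials vanishing on [C] would be the image of a prime containing both
   [b X - 1] and ['X]; so [1 - 'X * G] vanishes on [C] for some [G]. *)
Lemma homeo_integral (b : B) : exists n (a : nat -> A), b ^+ n = \sum_(i < n) phi (a i) * b ^+ i.
Proof.
pose bX : {poly B} := b%:P * 'X - 1.
have [E hE] := gc (openD bX).
have inE P : (forall F, E F -> pideal P F) <-> pideal (g P) bX.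
  have e : (g @^-1` Dset bX) P <-> ~ (E `<=` pideal P) by rewrite hE.
  by split=> [h|h]; apply: contrapT => n; [apply: e.1 h|apply: e.2 n h].
pose J : set {poly A} := [set F | forall Q, pideal Q bX -> pideal Q (Phi F)].
(* With the element 1: the ideal generated by J and 'X is contained in no prime. *)
have [||n [F [G [JF e1]]]] := @prime_notin_power _ [set H | exists F G, J F /\ H = F + 'X * G] 1.
- split.
  + by exists 0, 0; split=> [Q _|]; rewrite ?rmorph0 ?mulr0 ?addr0 //; apply: pideal0.
  + move=> _ _ [F [G [JF ->]]] [F' [G' [JF' ->]]]; exists (F + F'), (G + G'); split; last by ring.
    by move=> Q hQ; rewrite rmorphD; apply: pidealD; [apply: JF|apply: JF'].
  + move=> H _ [F [G [JF ->]]]; exists (H * F), (H * G); split; last by ring.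
    by move=> Q hQ; rewrite rmorphM; apply/pidealM/JF.
- move=> P hP; exfalso; have EP F : E F -> pideal P F.
    move=> EF; apply: hP; exists F, 0; split; last by rewrite mulr0 addr0.
    move=> Q hQ; have : pideal (comap Phi Q) F by apply: (inE _).2 EF; rewrite cK.
    by [].
  have XP : pideal P 'X.
    apply: hP; exists 0, 1; split; last by rewrite mulr1 add0r.
    by move=> Q _; rewrite rmorph0; apply: pideal0.
  have bg := (inE P).1 EP; rewrite -(gK P) /= map_polyX in XP.
  apply: (@pideal1 _ (g P)); rewrite -(subKr (b%:P * 'X) 1).
  by apply: pidealB => //; apply: pidealM.
move: e1; rewrite expr1n => e1.
(* The polynomial 1 - 'X * G lies in J, so its image is in every prime containing bX, and a power of
   that image is a multiple of bX. *)
have [||N [H eH]] := @prime_notin_power _ [set K | exists H, K = bX * H] (Phi (1 - 'X * G)).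
- split; first by exists 0; rewrite mulr0.
    by move=> _ _ [H ->] [H' ->]; exists (H + H'); rewrite mulrDr.
  by move=> c _ [H ->]; exists (c * H); ring.
- move=> P hP; have -> : 1 - 'X * G = F by rewrite e1; ring.
  by apply: JF; apply: hP; exists 1; rewrite mulr1.
have [G' eG'] := one_minus_X_power G N.
move: eH; rewrite -rmorphXn eG' rmorphB rmorph1 rmorphM /= map_polyX => eH.
pose gi i := phi G'`_i.
(* Comparing coefficients in 1 - 'X * Phi G' = (b 'X - 1) * H gives a Horner recursion for H, which
   [hn] solves. *)
have h0 : H`_0 = - 1.
  have := congr1 (fun p : {poly B} => p`_0) eH.
  rewrite /bX mulrBl mul1r -mulrA !coefB coefCM !coefXM coef1 /= mulr0 subr0 sub0r => e.
  by rewrite -[H`_0]opprK -e.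
have hS i : H`_i.+1 = b * H`_i + gi i.
  have := congr1 (fun p : {poly B} => p`_i.+1) eH.
  rewrite /bX mulrBl mul1r -mulrA !coefB coefCM !coefXM coef1 /= coef_map sub0r => e2.
  by rewrite /gi -[phi _]opprK e2; ring.
have hn n' : b ^+ n' = \sum_(i < n') gi i * b ^+ (n'.-1 - i) - H`_n'.
  elim: n' => [|n' IH]; first by rewrite big_ord0 h0 expr0 opprK add0r.
  rewrite exprS IH hS big_ord_recr /= subnn expr0 mulr1 mulrBr mulr_sumr.
  rewrite [\sum_(i < n') b * _](eq_bigr (fun i : 'I_n' => gi i * b ^+ (n' - i))); first by ring.
  move=> i _; rewrite mulrCA -exprS; congr (_ * b ^+ _).
  by have := ltn_ord i; lia.
(* The coefficient of H in degree [size H] is 0, so [hn] becomes a monic equation; the reversal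
   indexes it by powers of b. *)
exists (size H), (fun i => G'`_((size H).-1 - i)); rewrite hn nth_default // subr0.
rewrite (reindex_inj rev_ord_inj) /=; apply: eq_bigr => i _.
rewrite /gi; congr (phi G'`_ _ * b ^+ _); have := ltn_ord i; lia.
Qed.

Section ResidueField.
Variables (q : prime_ideal B) (k L : fieldType) (j : {rmorphism k -> L}).
Variables (gam : {rmorphism A -> k}) (psi : {rmorphism B -> L}).
Hypothesis jgam : forall a, j (gam a) = psi (phi a).

(* Let [m] be the minimal polynomial of [psi b] and [h] a factor of [m] prime to
   ['X - psi b]. A prime of [L[X]] above [h] lies over a prime of [A[X]] which
   contains that of [psi b]; since specializations lift along a homeomorphism, it
   would contain ['X - psi b]. *)
Lemma homeo_purely_inseparable (b : B) : exists Q v,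
  [pchar L].-nat Q /\ psi b ^+ Q = j v.
Proof.
pose beta := psi b.
pose isroot (p : {poly k}) := (map_poly j p).[beta] = 0.
have [m [m0 rm mdiv]] : exists m : {poly k}, [/\ m != 0, isroot m & forall p, isroot p -> m %| p].
  have : exists n, `[<exists p : {poly k}, [/\ p != 0, isroot p & size p = n]>].
    have [n [a ea]] := homeo_integral b.
    pose p : {poly k} := 'X^n - \poly_(i < n) gam (a i).
    exists (size p); apply/asboolP; exists p; split=> //.
      apply/eqP => /(congr1 (fun r : {poly k} => r`_n)) /eqP.
      by rewrite coefB coefXn eqxx coef_poly ltnn subr0 coef0 oner_eq0.
    rewrite /isroot rmorphB /= map_polyXn hornerD hornerN hornerXn /beta -rmorphXn ea.
    rewrite rmorph_sum poly_def rmorph_sum horner_sum -sumrB big1 // => i _.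
    by rewrite /= map_polyZ /= map_polyXn hornerZ hornerXn jgam rmorphM rmorphXn subrr.
  case/ex_minnP => n /asboolP[m [m0 rm sm]] min; exists m; split=> // p rp.
  rewrite /dvdp; apply: contrapT => /negP nz.
  have : (n <= size (p %% m)%R)%N.
    apply: min; apply/asboolP; exists (p %% m)%R; split=> //.
    move: rp; rewrite /isroot {1}(divp_eq p m) rmorphD rmorphM /= hornerD hornerM rm mulr0 add0r.
    exact.
  by rewrite leqNgt -sm ltn_modp m0.
have mL0 : map_poly j m != 0 by rewrite map_poly_eq0.
have [||r [c [c0 ec]]] := @split_power L (map_poly j m) beta; first exact: mL0.
  move=> h hm hb; rewrite leqNgt; apply/negP => sh.
  (* No prime contains h, so 1 is a multiple of h, against the assumption on its size. *)
  have [||n [u e1]] := @prime_notin_power {poly L} [set F | exists u, F = h * u] 1.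
  - split; first by exists 0; rewrite mulr0.
      by move=> _ _ [u ->] [v ->]; exists (u + v); rewrite mulrDr.
    by move=> v _ [u ->]; exists (v * u); ring.
  - move=> M hM; exfalso; have Mh : pideal M h by apply: hM; exists 1; rewrite mulr1.
    pose ev : {rmorphism {poly B} -> L} := horner_eval beta \o map_poly psi.
    pose ps : {rmorphism {poly B} -> {poly L}} := map_poly psi.
    (* A polynomial over A in [ker_ideal ev] maps to a multiple of m, thus of h, hence into M.
       Specialization extends this inclusion to polynomials over B such as 'X - b. *)
    have := @homeo_specialization (ker_ideal ev) (comap ps M) _ ('X - b%:P).
    rewrite /= /horner_eval map_polyXsubC hornerXsubC subrr => spec.
    have MX : pideal M ('X - beta%:P).
      apply: spec => // F; rewrite -map_poly_comp => eF.
      have eFj : map_poly (psi \o phi) F = map_poly j (map_poly gam F).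
        by rewrite -map_poly_comp; apply: eq_map_poly => a /=; rewrite jgam.
      have : isroot (map_poly gam F) by rewrite /isroot -eFj.
      move=> /mdiv; rewrite -(dvdp_map j) -eFj => /(dvdp_trans hm)/dvdpP[u ->].
      exact: pidealM.
    (* As h - h.[beta] is a multiple of 'X - beta, the prime M would contain the unit h.[beta]. *)
    have /factor_theorem[u eu] : root (h - h.[beta]%:P) beta.
      by rewrite /root hornerD hornerN hornerC subrr.
    have Mc : pideal M (h.[beta]%:P).
      by rewrite -[_%:P](subKr h) eu; apply: pidealB => //; apply: pidealM.
    apply: (@pideal1 _ M); rewrite -(_ : (h.[beta]^-1)%:P * (h.[beta])%:P = 1); first exact:
      pidealM.
    by rewrite -polyCM mulVf.
  move: e1; rewrite expr1n => e1; have : h %| 1 by rewrite e1 dvdp_mulr.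
  by rewrite dvdp1 => /eqP sh1; rewrite sh1 in sh.
have r0 : (0 < r)%N.
  rewrite lt0n; apply/eqP => rz; move: rm; rewrite /isroot ec rz expr0 hornerZ hornerC mulr1 =>
    /eqP.
  by rewrite (negbTE c0).
apply: (@purely_inseparable_root k L j r beta ((lead_coef m)^-1 *: m) r0).
rewrite map_polyZ fmorphV ec -lead_coef_map ec lead_coefZ.
by rewrite (monicP (monic_exp _ (monicXsubC beta))) mulr1 scalerA mulVf // scale1r.
Qed.
End ResidueField.
End UniversalHomeomorphismAlgebra.

Section UniquePrime.
Variables (A B : comPzRingType) (phi : {rmorphism A -> B}).

(** The ideal p B generated by the image of p. *)
Inductive extended (p : prime_ideal A) : B -> Prop :=
| ExtZero : extended p 0
| ExtCons m e x : pideal p m -> extended p x -> extended p (phi m * e + x).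

Lemma extended_ideal p : ideal (extended p).
Proof.
split; first exact: ExtZero.
- move=> x y hx hy; elim: hx => [|m e z pm _ IH]; first by rewrite add0r.
  by rewrite -addrA; apply: ExtCons.
- move=> c x; elim=> [|m e z pm _ IH]; first by rewrite mulr0; apply: ExtZero.
  by rewrite mulrDr mulrCA; apply: ExtCons.
Qed.

Lemma extended_sum p x : extended p x -> exists n (m : nat -> A) (e : nat -> B),
  (forall i, pideal p (m i)) /\ x = \sum_(i < n) phi (m i) * e i.
Proof.
elim=> [|m e y pm _ [n [m' [e' [pm' ->]]]]].
  by exists 0%N, (fun=> 0), (fun=> 0); split=> [_|]; [apply: pideal0|rewrite big_ord0].
exists n.+1, (fun i => if i is i'.+1 then m' i' else m), (fun i => if i is i'.+1 then e' i' else
  e).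
by split=> [[|i]|]; rewrite ?big_ord_recl.
Qed.

(** Otherwise some prime contains the extended ideal and avoids all phi s * b ^+ N. It lies over the
    same prime of A as q, hence equals q, which contains b. *)
Lemma unique_prime_nilpotent (q : prime_ideal B) (b : B) :
  (forall q' : prime_ideal B, comap phi q' = comap phi q -> q' = q) -> pideal q b ->
  exists s N, ~ pideal q (phi s) /\ extended (comap phi q) (phi s * b ^+ N).
Proof.
move=> uniq qb; apply: contrapT => no.
have [||P [hP hS]] := @prime_avoiding B (extended (comap phi q))
    [set x | exists s N, ~ pideal q (phi s) /\ x = phi s * b ^+ N] (extended_ideal _).
- split; first by exists 1, 0%N; rewrite rmorph1 mulr1; split=> //; exact: pideal1.
  move=> _ _ [s [N [qs ->]]] [t [M [qt ->]]]; exists (s * t), (N + M)%N.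
  by split; [rewrite rmorphM; exact: pidealMN|rewrite rmorphM exprD; ring].
- by move=> x ex [s [N [qs e]]]; apply: no; exists s, N; rewrite -e.
have eP : P = q.
  apply: uniq; apply: prime_ideal_eq => a /=; split=> [Pa|qa].
    apply: contrapT => qa; apply: (hS (phi a)) => //.
    by exists a, 0%N; rewrite mulr1.
  by apply: hP; rewrite -[phi a]mulr1 -[_ * 1]addr0; apply: ExtCons => //; apply: ExtZero.
apply: (hS b); last by rewrite eP.
exists 1, 1%N; rewrite rmorph1 mul1r expr1; split=> //; exact: pideal1.
Qed.
End UniquePrime.

(** The coefficient of p ^+ m in degree m * (size p - 1) is the m-th power of the leading
    coefficient of p. *)
Lemma poly_reduced (A : comNzRingType) : reduced_ring A -> reduced_ring {poly A}.
Proof.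
move=> nz_sec_poly_reduced p n e; apply/eqP; apply: contrapT => /negP p0.
have lc m : (p ^+ m)`_((size p).-1 * m) = lead_coef p ^+ m.
  elim: m => [|m IH]; first by rewrite muln0 !expr0 coef1.
  rewrite exprS coefM mulnS.
  have h : ((size p).-1 < ((size p).-1 + (size p).-1 * m).+1)%N by rewrite ltnS leq_addr.
  rewrite (bigD1 (Ordinal h)) //= addKn IH -lead_coefE -exprS big1 ?addr0 // => i /negP ni.
  have [hi|hi] := ltnP (size p).-1 i.
    by rewrite [p`_i]nth_default ?mul0r //; apply: leq_trans (leqSpred _) hi.
  have {}hi : (i < (size p).-1)%N.
    by rewrite ltn_neqAle hi andbT; apply/negP => /eqP hi'; apply: ni; apply/eqP/val_inj.
  rewrite [(p ^+ m)`_ _]nth_default ?mulr0 //; apply: leq_trans (size_exp_leq _ _) _.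
  by rewrite -addnBAC ?(ltnW hi) // -add1n leq_add2r subn_gt0.
have := lc n; rewrite e coef0 => /esym/nz_sec_poly_reduced/eqP; rewrite lead_coef_eq0; exact:
  negP.
Qed.

Lemma poly_map_ex (B : comNzRingType) (R : comPzRingType) (beta : {rmorphism B -> R}) (t : R) :
  exists psi : {rmorphism {poly B} -> R}, (forall b, psi b%:P = beta b) /\ psi 'X = t.
Proof.
(* R may be the zero ring, as for the sections over an empty scheme; this case is separate because
   evaluation of polynomials takes place in a nonzero ring. *)
have [R0|R0] := eqVneq (1 : R) 0.
  have all0 (x : R) : x = 0 by rewrite -[x]mul1r R0 mul0r.
  pose psi (p : {poly B}) : R := 0.
  have psiB : zmod_morphism psi by move=> p q; rewrite [RHS]all0.
  have psiM : monoid_morphism psi by split=> [|p q]; rewrite [RHS]all0.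
  pose p1 := GRing.isZmodMorphism.Build _ _ psi psiB.
  pose p2 := GRing.isMonoidMorphism.Build _ _ psi psiM.
  pose psi' : {rmorphism {poly B} -> R} := HB.pack psi p1 p2.
  by exists psi'; split=> [b|]; rewrite [LHS]all0 [RHS]all0.
pose R1 : comNzRingType := HB.pack R (GRing.PzSemiRing_isNonZero.Build R R0).
pose b1 : {rmorphism B -> R1} := beta.
pose psi : {rmorphism {poly B} -> R1} := horner_eval (t : R1) \o map_poly b1.
by exists psi; split=> [b|]; rewrite /psi /= /horner_eval ?map_polyC ?map_polyX ?hornerC ?hornerX.
Qed.

Lemma poly_map_uniq (B : comNzRingType) (R : comPzRingType) (psi psi' : {rmorphism {poly B} ->
  R}) :
  (forall b, psi b%:P = psi' b%:P) -> psi 'X = psi' 'X -> psi =1 psi'.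
Proof.
move=> hC hX p; elim/poly_ind: p => [|p c IH]; first by rewrite !rmorph0.
by rewrite !rmorphD !rmorphM IH hC hX.
Qed.

(** * Morphisms to affine schemes and pullback of global sections *)

Section GlobalPullback.
Variables (S X : ringed_space) (f : lrs_hom S X) (V : opens X).

Definition glob (u : opensT S `<=` preim (base_cont f) V) : {rmorphism sec V -> sec (opensT S)} :=
  res u \o sharp f V.

Lemma glob_irr u u' a : glob u a = glob u' a.
Proof. exact: res_irr. Qed.
End GlobalPullback.

Lemma secfun_glob (S X : scheme) (f : lrs_hom S X) (V : opens X)
    (u : opensT S `<=` preim (base_cont f) V) (a : sec V) y :
  secfun (glob u a) y = kmap f y (secfun a (base f y)).
Proof. by rewrite kmapE; apply: secfun_res. Qed.

Lemma glob_eq (S X : ringed_space) (f g : lrs_hom S X) (V : opens X)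
    (u : opensT S `<=` preim (base_cont f) V) (v : opensT S `<=` preim (base_cont g) V) a :
  f = g -> glob u a = glob v a.
Proof. by move=> e; subst g; apply: glob_irr. Qed.

Lemma opensT_sub (S X : ringed_space) (f : lrs_hom S X) : opensT S `<=` preim (base_cont f)
  (opensT X).
Proof. by []. Qed.

Lemma glob_comp (S X Y : ringed_space) (g : lrs_hom X Y) (f : lrs_hom S X) (V : opens Y)
    (u : opensT S `<=` preim (base_cont (lrs_comp g f)) V)
    (u' : opensT X `<=` preim (base_cont g) V) a :
  glob u a = glob (@opensT_sub S X f) (glob u' a).
Proof.
rewrite /glob /=.
have h' : preim (base_cont f) (opensT X) `<=` preim (base_cont f) (preim (base_cont g) V).
  by move=> x _; apply: u'.
by rewrite -(sharp_nat u' h') res2; apply: res_irr.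
Qed.

Lemma glob_comp_in (S X Y : ringed_space) (g : lrs_hom X Y) (f : lrs_hom S X) (V : opens Y)
    (u : opensT S `<=` preim (base_cont (lrs_comp g f)) V)
    (u' : opensT S `<=` preim (base_cont f) (preim (base_cont g) V)) a :
  glob u a = glob u' (sharp g V a).
Proof. exact: res_irr. Qed.

(** The image of y is the point of V whose prime consists of the sections s with phi s vanishing at
    y. *)
Lemma affine_hom_ex (S X : scheme) (V : opens X) (phi : {rmorphism sec V -> sec (opensT S)}) :
  affine_open V -> exists (f : lrs_hom S X) (u : opensT S `<=` preim (base_cont f) V), glob u =1
    phi.
Proof.
move=> hV; have [ha _ _ _] := hV.
have [h hh] := @choice_ex S X (fun y x => oset V x /\ forall s, secfun (phi s) y = 0 <-> secfun s
  x = 0)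
  (fun y => ha (comap phi (@point_ideal S (opensT S) y I))).
have [f [ef hf]] := @affine_map_ex S X V hV phi h (fun y => (hh y).1)
  (fun y s => iff_sym ((hh y).2 s)).
have u : opensT S `<=` preim (base_cont f) V by move=> y _; rewrite /= /preimage /= ef; have []
  := hh y.
by exists f, u => a; apply: hf.
Qed.

Lemma affine_hom_uniq (S X : scheme) (V : opens X) (f g : lrs_hom S X)
    (u : opensT S `<=` preim (base_cont f) V) (v : opensT S `<=` preim (base_cont g) V) :
  affine_open V -> glob u =1 glob v -> f = g.
Proof. by move=> hV e; apply: (affine_map_uniq hV e). Qed.

Lemma spec_hom_ex (C : comPzRingType) (rC : reduced_ring C) (S : scheme)
    (psi : {rmorphism C -> sec (opensT S)}) :
  exists f : lrs_hom S (Spec rC), forall c, glob (@opensT_sub _ _ f) (Spec_iota rC c) = psi c.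
Proof.
have [inv hinv] := @choice_ex _ _ (fun s c => Spec_iota rC c = s) (fun s => Spec_iota_surj s).
have invE c : inv (Spec_iota rC c) = c by apply: (@Spec_iota_inj C rC); rewrite hinv.
pose ph s := psi (inv s).
have phB : zmod_morphism ph.
  by move=> s t; rewrite /ph -rmorphB; congr (psi _); rewrite -{1}(hinv s) -{1}(hinv t) -rmorphB
    invE.
have phM : monoid_morphism ph.
  split=> [|s t]; rewrite /ph; first by rewrite -(rmorph1 (Spec_iota rC)) invE rmorph1.
  by rewrite -rmorphM; congr (psi _); rewrite -{1}(hinv s) -{1}(hinv t) -rmorphM invE.
pose p1 := GRing.isZmodMorphism.Build _ _ ph phB.
pose p2 := GRing.isMonoidMorphism.Build _ _ ph phM.
pose ph' : {rmorphism sec (r := Spec rC) (opensT _) -> sec (opensT S)} := HB.pack ph p1 p2.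
have [f [u hf]] := @affine_hom_ex S (Spec rC) (opensT _) ph' (Spec_affine_open rC).
by exists f => c; rewrite (glob_irr _ u) hf /= /ph invE.
Qed.

Lemma spec_hom_uniq (C : comPzRingType) (rC : reduced_ring C) (S : scheme) (f g : lrs_hom S (Spec
  rC)) :
  (forall c, glob (@opensT_sub _ _ f) (Spec_iota rC c) = glob (@opensT_sub _ _ g) (Spec_iota rC
    c)) -> f = g.
Proof.
move=> e; apply: (@affine_hom_uniq S (Spec rC) (opensT _) f g (@opensT_sub _ _ f) (@opensT_sub _
  _ g)).
  exact: Spec_affine_open.
by move=> s; have [c <-] := Spec_iota_surj s.
Qed.

(** * Base change along the affine line over an affine open subset *)

Section AffineLineBaseChange.
Variables (Z W : scheme) (f : lrs_hom Z W) (V : opens W).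
Hypotheses (rZ : reduced Z) (rW : reduced W).
Hypotheses (hV : affine_open V) (hV' : affine_open (preim (base_cont f) V)).
Variable z : Z.
Hypothesis Vz : oset V (base f z).
Local Notation V' := (preim (base_cont f) V).

Lemma sec_neq0 : (1 : sec V) != 0.
Proof.
apply/eqP => e; have := secfun1 Vz; rewrite e secfun0 => /eqP.
by rewrite eq_sym oner_eq0.
Qed.

Lemma sec_preim_neq0 : (1 : sec V') != 0.
Proof.
apply/eqP => e; have := @secfun1 Z V' z Vz; rewrite e secfun0 => /eqP.
by rewrite eq_sym oner_eq0.
Qed.

(** Polynomial rings are formed over nonzero rings; the point z witnesses that 1 is not 0. *)
Definition nz_sec : comNzRingType := HB.pack (sec V) (GRing.PzSemiRing_isNonZero.Build (sec V)
  sec_neq0).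
Definition nz_sec_preim : comNzRingType := HB.pack (sec V') (GRing.PzSemiRing_isNonZero.Build
  (sec V') sec_preim_neq0).
Definition nz_sharp : {rmorphism nz_sec -> nz_sec_preim} := sharp f V.

Lemma nz_sec_poly_reduced : reduced_ring {poly nz_sec}.
Proof. by apply: poly_reduced => a n; apply: (rW (U := V)). Qed.
Lemma nz_sec_preim_poly_reduced : reduced_ring {poly nz_sec_preim}.
Proof. by apply: poly_reduced => a n; apply: (rZ (U := V')). Qed.

Local Notation SA := (Spec nz_sec_poly_reduced).
Local Notation SB := (Spec nz_sec_preim_poly_reduced).

(** The square is cartesian over W and not only over V, because agreement over W forces the map to Z
    to land in the preimage of V. The induced ring map on polynomials is given by that map on
    constants and by the map to the line on the variable. *)
Lemma line_pullback : exists (gA : lrs_hom SA W) (gB : lrs_hom SB Z) (fAB : lrs_hom SB SA),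
  is_pullback (C := Sch) (a := Z) (b := SA) (c := W) (p := SB) f gA gB fAB /\
  forall F, glob (@opensT_sub _ _ fAB) (Spec_iota nz_sec_poly_reduced F) = Spec_iota
    nz_sec_preim_poly_reduced (map_poly nz_sharp F).
Proof.
have [gA [uA hA]] := @affine_hom_ex SA W V (Spec_iota nz_sec_poly_reduced \o (polyC : {rmorphism
  nz_sec -> _})) hV.
have [gB [uB hB]] := @affine_hom_ex SB Z V' (Spec_iota nz_sec_preim_poly_reduced \o (polyC :
  {rmorphism nz_sec_preim -> _})) hV'.
have [fAB hAB] := @spec_hom_ex _ nz_sec_poly_reduced SB (Spec_iota nz_sec_preim_poly_reduced \o
  map_poly nz_sharp).
have {}hA (a : nz_sec) : glob uA a = Spec_iota nz_sec_poly_reduced a%:P := hA a.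
have {}hB (b : nz_sec_preim) : glob uB b = Spec_iota nz_sec_preim_poly_reduced b%:P := hB b.
have {}hAB F : glob (@opensT_sub _ _ fAB) (Spec_iota nz_sec_poly_reduced F) = Spec_iota
  nz_sec_preim_poly_reduced (map_poly nz_sharp F) := hAB F.
exists gA, gB, fAB; split; last exact: hAB.
split.
  have v1 : opensT SB `<=` preim (base_cont (lrs_comp f gB)) V by move=> y _; apply: (uB y I).
  have v2 : opensT SB `<=` preim (base_cont (lrs_comp gA fAB)) V.
    by move=> y _; apply: (uA (base fAB y) I).
  apply: (@affine_hom_uniq SB W V _ _ v1 v2) => // a.
  rewrite (glob_comp_in _ uB) (glob_comp _ uA) hA (hB (sharp f V a)) hAB.
  by rewrite map_polyC.
move=> S ta tb e.
have {}e : lrs_comp f ta = lrs_comp gA tb := e.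
have ebase y : base f (base ta y) = base gA (base tb y).
  exact: (congr1 (fun h : lrs_hom S W => base h y) e).
have ua : opensT S `<=` preim (base_cont ta) V'.
  by move=> y _; rewrite /= /preimage /= ebase; apply: (uA (base tb y) I).
have [psi [psiC psiX]] := @poly_map_ex nz_sec_preim (sec (opensT S)) (glob ua) (glob (@opensT_sub
  _ _ tb) (Spec_iota nz_sec_poly_reduced 'X)).
have [u hu] := @spec_hom_ex _ nz_sec_preim_poly_reduced S psi.
have constE a : glob ua (sharp f V a) = glob (@opensT_sub _ _ tb) (Spec_iota nz_sec_poly_reduced
  (a : nz_sec)%:P).
  have w1 : opensT S `<=` preim (base_cont (lrs_comp f ta)) V by move=> y _; apply: (ua y I).
  have w2 : opensT S `<=` preim (base_cont (lrs_comp gA tb)) V.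
    by move=> y _; apply: (uA (base tb y) I).
  rewrite -(glob_comp_in w1 ua) (glob_eq w1 w2) // (glob_comp w2 uA) hA.
  by [].
exists u; split.
- split.
    have w : opensT S `<=` preim (base_cont (lrs_comp gB u)) V' by move=> y _; apply: (uB (base u
      y) I).
    apply: (@affine_hom_uniq S Z V' _ _ w ua) => // b.
    by rewrite (glob_comp _ uB) hB hu psiC.
  apply: (@spec_hom_uniq _ nz_sec_poly_reduced S) => F.
  rewrite (glob_comp _ (@opensT_sub _ _ fAB)) hAB hu.
  pose p1 : {rmorphism {poly nz_sec} -> sec (opensT S)} := psi \o map_poly nz_sharp.
  pose p2 : {rmorphism {poly nz_sec} -> sec (opensT S)} := glob (@opensT_sub _ _ tb) \o Spec_iota
    nz_sec_poly_reduced.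
  apply: (@poly_map_uniq nz_sec _ p1 p2) => [a|]; rewrite /p1 /p2 /=.
    by rewrite map_polyC psiC constE.
  by rewrite map_polyX psiX.
move=> u' [u1 u2].
have {}u1 : lrs_comp gB u' = ta := u1.
have {}u2 : lrs_comp fAB u' = tb := u2.
apply: (@spec_hom_uniq _ nz_sec_preim_poly_reduced S) => F; rewrite hu.
pose p2 : {rmorphism {poly nz_sec_preim} -> sec (opensT S)} := glob (@opensT_sub _ _ u') \o
  Spec_iota nz_sec_preim_poly_reduced.
apply: (@poly_map_uniq nz_sec_preim _ psi p2) => [b|]; rewrite /p2 /=.
  have w : opensT S `<=` preim (base_cont (lrs_comp gB u')) V' by move=> y _; apply: (uB (base u'
    y) I).
  by rewrite psiC -(glob_eq w ua) // (glob_comp _ uB) hB.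
rewrite psiX -(glob_eq (@opensT_sub _ _ (lrs_comp fAB u')) (@opensT_sub _ _ tb)) //.
by rewrite (glob_comp _ (@opensT_sub _ _ fAB)) hAB map_polyX.
Qed.

Lemma line_homeo : universal_homeomorphism f ->
  exists g : prime_ideal {poly nz_sec} -> prime_ideal {poly nz_sec_preim},
  [/\ forall Q, g (comap (map_poly nz_sharp : {rmorphism _ -> _}) Q) = Q,
      forall P, comap (map_poly nz_sharp : {rmorphism _ -> _}) (g P) = P & cont g].
Proof.
have [gA [gB [fAB [pb hAB]]]] := line_pullback.
move=> /(_ SA SB gA fAB gB pb)[g [gK Kg _ gc]].
have ebase (Q : SB) : base fAB Q = comap (map_poly nz_sharp : {rmorphism _ -> _}) Q.
  apply: prime_ideal_eq => F; rewrite -(@Spec_secfun _ nz_sec_poly_reduced F (base fAB Q)).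
  rewrite -[pideal (comap _ _) F]/(pideal (Q : prime_ideal _) (map_poly nz_sharp F)).
  rewrite -(@Spec_secfun _ nz_sec_preim_poly_reduced) -hAB secfun_glob.
  by split=> [->|/kmap_eq0 //]; rewrite rmorph0.
exists g; split.
- by move=> Q; rewrite -ebase gK.
- by move=> P; rewrite -ebase Kg.
- by move=> U Uo; move/continuousP: gc; apply.
Qed.
End AffineLineBaseChange.

(** The factor a allows n = 0, in contrast to [secfunX]: outside of U both sides vanish. *)
Lemma secfunMX (X : scheme) (U : opens X) (a b : sec U) n : secfun (a * b ^+ n) = secfun a *
  secfun b ^+ n.
Proof.
elim: n => [|n IH]; first by rewrite !expr0 !mulr1.
by rewrite exprSr mulrA secfunM IH [in RHS]exprSr mulrA.
Qed.

(** * Universal homeomorphisms become isomorphisms after weak normalization *)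

Section UniversalHomeomorphisms.
Variables (Z W : scheme) (f : lrs_hom Z W).
Hypotheses (rZ : reduced Z) (rW : reduced W) (uf : universal_homeomorphism f).

Lemma uh_inverse : exists g : W -> Z, [/\ cancel (base f) g, cancel g (base f) & cont g].
Proof.
(* The trivial cartesian square over the identity of W shows that f itself is a homeomorphism. *)
have [|g [gK Kg _ gc]] := uf (X' := W) (Y' := Z) (g := lrs_id W) (f' := f) (g' := lrs_id Z).
  split=> [|t ta tb e]; first by rewrite /= lrs_comp1m lrs_compm1.
  exists ta; split=> [|u [<- _]]; last by rewrite /= lrs_comp1m.
  by split; rewrite /= ?lrs_comp1m // (e : lrs_comp f ta = lrs_comp _ tb) lrs_comp1m.
by exists g; split=> // U Uo; move/continuousP: gc; apply.
Qed.

(** An affine neighbourhood U of z above an affine V1 is the preimage of an open set of W, as f is a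
    homeomorphism. This set contains a basic open set of V1 around f z, whose preimage is basic in
    U. *)
Lemma uh_affine z : exists V : opens W, [/\ affine_open V, oset V (base f z) & affine_open (preim
  (base_cont f) V)].
Proof.
have [g [fK gK gc]] := uh_inverse.
have [V1 [hV1 V1z _]] := @affine_open_nbhd W (base f z) (opensT W) I.
have [U [hU Uz UV1]] := @affine_open_nbhd Z z (preim (base_cont f) V1) V1z.
have [_ _ hc _] := hV1.
have [|s [sz sU]] := hc (base f z) (preim gc U) V1z; first by rewrite /= /preimage /= fK.
pose s' := res UV1 (sharp f V1 s).
exists (unit_opens s); split.
- by apply: (affine_open_basic hV1 (f := s)) => y; apply: unit_opensP.
- exact/unit_opensP.
- apply: (affine_open_basic hU (f := s')) => y; rewrite -[oset _ y]/(oset (unit_opens s) (base f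
  y)) unit_opensP.
  have [Uy|Uy] := pselect (oset U y); last first.
    by rewrite [secfun s' y]secfun_out //; split=> // /sU; rewrite /= /preimage /= fK.
  rewrite /s' secfun_res // -kmapE; split=> h h0; apply: h; first exact: kmap_eq0 h0.
  by rewrite h0 rmorph0.
Qed.

Section AtPoint.
Variables (z : Z) (V : opens W).
Hypotheses (hV : affine_open V) (hV' : affine_open (preim (base_cont f) V)) (Vz : oset V (base f
  z)).
Local Notation V' := (preim (base_cont f) V).

Lemma uh_integral (b : sec V') : exists n (a : nat -> sec V),
  b ^+ n = \sum_(i < n) sharp f V (a i) * b ^+ i.
Proof.
have [g [gK Kg gc]] := line_homeo rZ rW hV hV' Vz uf.
exact: (@homeo_integral (nz_sec Vz) (nz_sec_preim Vz) (nz_sharp Vz) g gK Kg gc b).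
Qed.

Lemma uh_inseparable (b : sec V') : exists Q U (c : sec U),
  [/\ [pchar @perf_kappa Z z].-nat Q, oset U (base f z) & secfun b z ^+ Q = kmap f z (secfun c
    (base f z))].
Proof.
have [g [gK Kg gc]] := line_homeo rZ rW hV hV' Vz uf.
pose gam0 (a : nz_sec Vz) : kappa (base f z) := kappa_val (a : sec V) (base f z).
have gamB : zmod_morphism gam0 by move=> a a'; apply: kappa_valB.
have gamM : monoid_morphism gam0 by split=> [|a a']; [apply: kappa_val1|apply: kappa_valM].
pose p1 := GRing.isZmodMorphism.Build _ _ gam0 gamB.
pose p2 := GRing.isMonoidMorphism.Build _ _ gam0 gamM.
pose gam : {rmorphism nz_sec Vz -> kappa (base f z)} := HB.pack gam0 p1 p2.
pose psi0 (a : nz_sec_preim Vz) : @perf_kappa Z z := secfun (a : sec V') z.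
have psiB : zmod_morphism psi0 by move=> a a'; rewrite /psi0 secfunB.
have psiM : monoid_morphism psi0.
  by split=> [|a a']; rewrite /psi0; [apply: (@secfun1 Z V' z Vz)|rewrite secfunM].
pose q1 := GRing.isZmodMorphism.Build _ _ psi0 psiB.
pose q2 := GRing.isMonoidMorphism.Build _ _ psi0 psiM.
pose psi : {rmorphism nz_sec_preim Vz -> @perf_kappa Z z} := HB.pack psi0 q1 q2.
pose j : {rmorphism kappa (base f z) -> @perf_kappa Z z} :=
  kmap f z \o (@pemb (kappa (base f z)) : {rmorphism kappa (base f z) -> @perf_kappa W (base f
    z)}).
have jg a : j (gam a) = psi (nz_sharp Vz a) by exact: kmapE.
have [Q [v [hQ e]]] := homeo_purely_inseparable gK Kg gc jg b.
have [U [c [Uz ev]]] := kappa_val_surj v.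
by exists Q, U, c; split=> //; rewrite [LHS]e ev.
Qed.

Hypothesis fi : injective (base f).

(** Injectivity of f makes the prime of z the only one over the prime of f z, so
    [unique_prime_nilpotent] applies. *)
Lemma uh_nilpotent (b : sec V') : secfun b z = 0 -> exists (s : sec V) N n (m : nat -> sec V) (e
  : nat -> sec V'),
  [/\ secfun s (base f z) <> 0, forall i, secfun (m i) (base f z) = 0 &
      sharp f V s * b ^+ N = \sum_(i < n) sharp f V (m i) * e i].
Proof.
move=> bz; pose q : prime_ideal (sec V') := @point_ideal Z V' z Vz.
have [||s [N [qs /extended_sum[n [m [e [hm e1]]]]]]] := @unique_prime_nilpotent _ _ (sharp f V) q
  b; last first.
- exists s, N, n, m, e; split=> //.
    by move=> s0; apply: qs; rewrite /= -kmapE s0 rmorph0.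
  by move=> i; apply: (@kmap_eq0 _ _ f z); rewrite kmapE; apply: hm.
- exact: bz.
move=> q' eq'; have [ha _ _ _] := hV'; have [y [Vy hy]] := ha q'.
have [_ hb _ _] := hV; have yz : y = z.
  apply: fi; apply: hb => // s; have := congr1 (fun P => pideal P s) eq' => /= E.
  have := hy (sharp f V s); rewrite E -!kmapE.
  by move=> [h1 h2]; split=> h0; apply: (@kmap_eq0 _ _ f _); [apply: h2|apply: h1]; rewrite h0
    rmorph0.
by subst y; apply: prime_ideal_eq => s; rewrite hy.
Qed.

End AtPoint.

Lemma uh_kmap_surj z v : exists u, kmap f z u = v.
Proof.
have [V [hV Vz hV']] := uh_affine z.
have [Q [U0 [s [hQ U0z e]]]] := perf_kappa_secfun v.
have [g [b [gz eb]]] := affine_open_germ hV' Vz (germ_secfun s U0z).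
have [Q1 [U1 [c1 [hQ1 U1z e1]]]] := uh_inseparable hV hV' Vz b.
have [Q2 [U2 [c2 [hQ2 U2z e2]]]] := uh_inseparable hV hV' Vz g.
(* Here v ^+ Q = b / g at z, while b ^+ Q1 and g ^+ Q2 come from W; the crossed exponents make y the
   element below (b / g) ^+ (Q1 * Q2). *)
pose y := secfun c1 (base f z) ^+ Q2 / secfun c2 (base f z) ^+ Q1.
have hQ' : [pchar @perf_kappa Z z].-nat (Q * Q1 * Q2)%N by rewrite !pnatM hQ hQ1.
have [u hu] : exists u, u ^+ (Q * Q1 * Q2)%N = y.
  by apply: perf_kappa_root; rewrite -(eq_pnat _ (fmorph_pchar (kmap f z))).
exists u; apply: (expr_pnat_inj hQ'); rewrite -rmorphXn hu /y rmorphM fmorphV !rmorphXn -e1 -e2.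
have := congr1 (fun t : dfun _ => t z) eb; rewrite dfunM => <-.
have g0 : secfun g z != 0 by apply/eqP.
rewrite -!exprM [(Q2 * Q1)%N]mulnC exprMn mulrAC mulfV ?mul1r ?expf_neq0 //.
by rewrite -mulnA [RHS]exprM e.
Qed.

(** A germ at z is a fraction of sections over an affine preimage: [wlift] treats sections,
    [wsi_germ_inv] the denominator. For a section b, inseparability makes d = g * b ^+ Q - a vanish
    at z, and d is then nilpotent modulo the maximal ideal of f z by [uh_nilpotent], as
    [wsi_criterion] asks. *)
Lemma uh_germ_descent z s : germ z (pull f s) -> wsi_germ (base f z) s.
Proof.
have [g0 [fK gK gc]] := uh_inverse.
have fi := can_inj fK.
have [V [hV Vz hV']] := uh_affine z; set x := base f z.
have pinj := pull_inj gK; have psurj := pull_surj fK gK uh_kmap_surj.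
have gr := @germ_ring W x.
have lift_integral (b : sec (preim (base_cont f) V)) (bt : dfun (@perf_kappa W)) : pull f bt =
  secfun b ->
    integral (dev x) (germ x) bt.
  move=> eb; have [n [a ea]] := uh_integral hV hV' Vz b.
  apply: (@integral_monic _ _ _ _ gr bt n (fun i => secfun (a i))).
    by move=> i _; apply/wsi_integral/(wsi_sub _ gr)/germ_secfun.
  (* At z an equation of degree 0 would read 1 = 0; positivity is what [secfunX] asks for. *)
  have n0 : (0 < n)%N.
    case: n ea => //; rewrite big_ord0 expr0 => /(congr1 (fun t => secfun t z)).
    by rewrite secfun0 (@secfun1 Z (preim (base_cont f) V) z Vz) => /eqP; rewrite oner_eq0.
  apply: pinj; rewrite rmorphXn rmorph_sum /= eb -(prednK n0) -secfunX prednK // ea secfun_sum.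
  by apply: eq_bigr => i _; rewrite secfunMX rmorphM rmorphXn /= eb pull_secfun.
have wlift (b : sec (preim (base_cont f) V)) (bt : dfun (@perf_kappa W)) : pull f bt = secfun b
  -> wsi_germ x bt.
  move=> eb.
  have [Q [U [c0 [hQ Uz ec]]]] := uh_inseparable hV hV' Vz b.
  have Q0 : (0 < Q)%N by case/andP: hQ.
  have [g [a [gx ga]]] := affine_open_germ hV Vz (germ_secfun c0 Uz).
  pose c := secfun c0.
  pose d := sharp f V g * b ^+ Q - sharp f V a.
  have ed : pull f (secfun g * (bt ^+ Q - c)) = secfun d.
    rewrite mulrBr ga rmorphB rmorphM rmorphXn /= eb !pull_secfun /d secfunB secfunMX //.
  have dz : secfun d z = 0.
    have dzE : (secfun g * (bt ^+ Q - c)) x = 0.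
      rewrite dfunM; apply/eqP; rewrite mulf_eq0; apply/orP; right; apply/eqP.
      apply: (@kmap_eq0 _ _ f z); rewrite dfunB dfunX rmorphB rmorphXn.
      rewrite -[kmap f z (bt x)]/(pull f bt z) eb ec; exact: subrr.
    by rewrite -ed /pull dzE rmorph0.
  have [s0 [N [n [m [e [s0x mx es]]]]]] := uh_nilpotent hV hV' Vz fi dz.
  have [et het] := @choice_ex _ _ (fun i t => pull f t = secfun (e i)) (fun i => psurj (secfun (e
    i))).
  pose k := secfun s0 * secfun g ^+ N.
  have ek : k * (bt ^+ Q - c) ^+ N = \sum_(i < n) secfun (m i) * et i.
    apply: pinj; rewrite /k -mulrA -exprMn rmorphM rmorphXn /= ed pull_secfun -secfunMX es
      secfun_sum rmorph_sum.
    by apply: eq_bigr => i _; rewrite rmorphM /= het secfunM pull_secfun.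
  have Gk : germ x k by apply: (subM gr); [apply: germ_secfun|apply: (subX gr); apply:
    germ_secfun].
  have kx : k x <> 0.
    rewrite /k dfunM dfunX => /eqP; rewrite mulf_eq0 expf_eq0 => /orP[/eqP //|/andP[_ /eqP]] //.
  pose ki : dfun (@perf_kappa W) := fun y => (k y)^-1.
  have Gki : germ x ki := germ_inv Gk kx.
  (* The product ki * k is 1 only where k does not vanish. The defect nu is zero near x; as one more
     coefficient, with e' equal to 1, it makes the identity hold at every point. *)
  pose nu := (bt ^+ Q - c) ^+ N * (1 - ki * k).
  have Gnu : germ x nu.
    apply: germ_loc (sub0 gr) _; have [O1 [O1x hO1]] := germ_near_nz Gk kx.
    exists O1; split=> // y /hO1 /eqP ky.
    by rewrite /nu dfunM dfunB dfunM mulVf // subrr mulr0.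
  have nux : dev x nu = 0.
    rewrite /nu rmorphM rmorphB rmorphM rmorph1 /dev mulVf ?subrr ?mulr0 //; exact/eqP.
  pose m' i := if (i < n)%N then ki * secfun (m i) else nu.
  pose e' i := if (i < n)%N then et i else 1.
  apply: (@wsi_criterion _ _ (dev x) _ gr bt Q c N n.+1 m' e').
  - by rewrite -(eq_pnat _ (fmorph_pchar (kmap f z))).
  - exact: germ_secfun.
  - exact: lift_integral eb.
  - move=> i _; rewrite /e'; case: ifP => _; first exact: lift_integral (het i).
    exact/wsi_integral/(wsi_sub _ gr)/(sub1 gr).
  - move=> i; rewrite /m'; case: ifP => _ //; apply: (subM gr) => //; exact: germ_secfun.
  - move=> i; rewrite /m'; case: ifP => _ //; rewrite rmorphM.
    by apply/eqP; rewrite mulf_eq0; apply/orP; right; apply/eqP; apply: mx.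
  - rewrite big_ord_recr /= /m' /e' ltnn mulr1.
    under eq_bigr => i _ do rewrite ltn_ord -mulrA.
    by rewrite -mulr_sumr -ek /nu; ring.
move=> Gs; have [g [b [gz eb]]] := affine_open_germ hV' Vz Gs.
have [gt hg] := psurj (secfun g); have [bt hb] := psurj (secfun b).
have egb : gt * s = bt by apply: pinj; rewrite rmorphM /= hg eb hb.
have gx : gt x <> 0.
  by move=> h; apply: gz; rewrite -hg /pull (h : gt (base f z) = 0) rmorph0.
have wg := wlift g gt hg.
apply: (@wsi_germ_loc _ x (bt * (fun y => (gt y)^-1))).
  by apply: (subM (wsi_germ_ring x)); [apply: wlift hb|apply: wsi_germ_inv].
have [O1 [O1x hO1]] := wsi_germ_near_nz wg gx; exists O1; split=> // y /hO1 /eqP gy.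
by rewrite -egb !dfunM mulrAC mulfV // mul1r.
Qed.

Lemma uh_awn_fmap_iso : lrs_iso (awn_fmap f).
Proof.
have [g [fK gK gc]] := uh_inverse.
exact: (awn_fmap_iso fK gK gc uh_kmap_surj uh_germ_descent).
Qed.

End UniversalHomeomorphisms.

Lemma awn_rigid (Y : scheme) : topologically_rigid (awn Y).
Proof. by apply: awn_rigid_of => Z f rZ uf; apply: uh_awn_fmap_iso => //; apply: awn_reduced. Qed.

Theorem proposition7p1 (X : scheme) (hX : coherent X) :
  has_right_adjoint (trig_inclusion X).
Proof.
(* The weak normalization keeps the underlying space, so the coherence proof of a scheme is also one
   for its weak normalization. *)
pose R (d : Sch_coh X) : Sch_coh X := exist (fun Y : slice (C := Sch) X => coherent (dom Y))
  (@Over Sch X (awn (dom (proj1_sig d))) (comp (str (proj1_sig d)) (awn_map (dom (proj1_sig d)) :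
    @hom Sch _ _)))
  (proj2_sig d).
pose eps (d : Sch_coh X) : hom (R d) d :=
  @OverHom Sch X (proj1_sig (R d)) (proj1_sig d) (awn_map (dom (proj1_sig d))) erefl.
apply: (@coreflective_right_adjoint (Sch_coh X) (@is_trig X) R eps) => [d|c d f Pc].
  exact: awn_rigid.
have [g [eg ug]] := awn_coreflection (over_fun f : lrs_hom _ _) Pc.
have hg : comp (str (proj1_sig (R d))) (g : @hom Sch _ _) = str (proj1_sig c).
  rewrite -(over_funP f) /= -lrs_compA; congr lrs_comp; exact: eg.
exists (@OverHom Sch X (proj1_sig c) (proj1_sig (R d)) g hg); split.
  by apply: over_hom_eq; exact: eg.
move=> g' e'; apply: over_hom_eq; apply: ug.
exact: (congr1 (fun h : over_hom _ _ => over_fun h) e').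
Qed.
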